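(* For every fixed $\epsilon>0$, the Power Dominating Set problem (on undirected graphs) cannot be approximated in polynomial time within ratio $2^{\log^{1-\epsilon} n}$, where $n$ is the number of nodes of the input graph, unless $\mathrm{NP}\subseteq \mathrm{DTIME}(n^{\mathrm{polylog}(n)})$.
   Context: Let $G=(V,E)$ be a finite simple undirected graph with $n$ nodes. For $S\subseteq V$, the set $\mathcal{P}_S$ of nodes power dominated by $S$ is obtained as follows: (Rule 1) every node of $S$ and every neighbor of a node of $S$ belongs to $\mathcal{P}_S$; (Rule 2, propagation) if a node $v\in\mathcal{P}_S$ has exactly one neighbor $w\notin\mathcal{P}_S$ (all its other neighbors being in $\mathcal{P}_S$), then $w$ is inserted into $\mathcal{P}_S$; Rule 2 is applied repeatedly until no further node can be inserted (the resulting set does not depend on the order). $S$ power dominates $G$ if $\mathcal{P}_S=V$. The Power Dominating Set (PDS) problem asks for a set $S$ of minimum size that power dominates $G$. *)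

(* Defs.v *)
From mathcomp Require Import all_boot all_order all_algebra.
From mathcomp Require Import reals exp.

Set Implicit Arguments.
Unset Strict Implicit.
Unset Printing Implicit Defensive.

Import Order.TTheory GRing.Theory Num.Theory.

Inductive move := MoveL | Stay | MoveR.

(* [None] is the blank, [Some (inl b)] an input/output bit and [Some (inr a)]
   an auxiliary tape symbol. *)
Definition symbol (A : finType) : finType := option (bool + A)%type.

(* The transition table is a finite object, since both [state] and the functions
   {ffun 'I_tapes.+1 -> symbol aux} range over finite types. *)
Record TM := {
  tapes : nat; (* the machine has [tapes.+1] tapes *)
  state : finType;
  aux : finType;
  start : state;
  halting : pred state;
  delta : state -> {ffun 'I_tapes.+1 -> symbol aux} ->
          state * {ffun 'I_tapes.+1 -> symbol aux * move}
}.

(* A two-way infinite tape: the cells to the left of the head, nearest first,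
   the scanned cell, and the cells to the right of the head, nearest first; all
   the cells that are not listed are blank. *)
Record tape (A : finType) := Tape {
  lcells : seq (symbol A);
  scanned : symbol A;
  rcells : seq (symbol A)
}.

Definition tape_act (A : finType) (t : tape A) (am : symbol A * move) : tape A :=
  let: (a, m) := am in
  match m with
  | MoveL => Tape (behead (lcells t)) (head None (lcells t)) (a :: rcells t)
  | Stay => Tape (lcells t) a (rcells t)
  | MoveR => Tape (a :: lcells t) (head None (rcells t)) (behead (rcells t))
  end.

Definition config (M : TM) : Type :=
  (state M * ('I_(tapes M).+1 -> tape (aux M)))%type.

Definition step (M : TM) (c : config M) : config M :=
  if halting c.1 then c else
  let qa := delta c.1 [ffun i => scanned (c.2 i)] in
  (qa.1, fun i => tape_act (c.2 i) (qa.2 i)).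

Definition input_tape (A : finType) (x : seq bool) : tape A :=
  let s := [seq Some (inl b) : symbol A | b <- x] in
  Tape [::] (head None s) (behead s).

Definition init (M : TM) (x : seq bool) : config M :=
  (start M, fun i => input_tape (aux M) (if i == ord0 then x else [::])).

Fixpoint leading_bits (A : finType) (s : seq (symbol A)) : seq bool :=
  if s is Some (inl b) :: s' then b :: leading_bits s' else [::].

(* The output is the maximal bit string that starts under the head of the first
   tape, read to the right. *)
Definition output (M : TM) (c : config M) : seq bool :=
  let t := c.2 ord0 in leading_bits (scanned t :: rcells t).

Definition outputs_within (M : TM) (t : nat) (x y : seq bool) : Prop :=
  let c := iter t (@step M) (init M x) in halting c.1 /\ output c = y.

Definition language := seq bool -> Prop.

Definition DTIME (T : nat -> nat) (L : language) : Prop :=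
  exists (M : TM) (c : nat), forall x : seq bool, exists2 b : bool,
    outputs_within M (c * T (size x) + c) x [:: b] & L x <-> b.

Definition PTIME (L : language) : Prop := exists k, DTIME (fun n => n ^ k) L.

(* A self-delimiting encoding of pairs: the bits of [x] are doubled, and the
   block 01 separates them from [y]. *)
Definition pair_code (x y : seq bool) : seq bool :=
  flatten [seq [:: b; b] | b <- x] ++ [:: false; true] ++ y.

Definition NP (L : language) : Prop :=
  exists2 V : language, PTIME V &
  exists c : nat, forall x : seq bool,
    L x <-> exists2 y : seq bool, size y <= c * size x ^ c + c & V (pair_code x y).

(* DTIME(n^polylog(n)); [up_log 2 n] is log_2 n rounded up. *)
Definition QPTIME (L : language) : Prop :=
  exists k, DTIME (fun n => n ^ (up_log 2 n ^ k)) L.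

Definition simple_graph (V : finType) (e : rel V) : Prop :=
  symmetric e /\ irreflexive e.

Section PowerDomination.
Variables (V : finType) (e : rel V).
Implicit Types (P Q S : {set V}).

Definition neighbors (v : V) : {set V} := [set w | e v w].

Definition dominated S : {set V} := S :|: \bigcup_(v in S) neighbors v.

Definition propagate P : {set V} :=
  P :|: [set w | [exists v in P, neighbors v :\: P == [set w]]].

(* Each round applies the propagation rule at all the nodes simultaneously, and
   #|V| rounds suffice: see [power_dominatedP] and [power_dominated_min]. *)
Definition power_dominated S : {set V} := iter #|V| propagate (dominated S).

Definition power_dominates S : bool := power_dominated S == [set: V].

(* The default value is itself feasible, see [power_dominates_setT]. *)
Definition pds_opt : nat :=
  #|[arg min_(S < [set: V] | power_dominates S) #|S|]|.

Lemma power_dominatedP S :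
  propagate (power_dominated S) = power_dominated S.
Proof.
rewrite /power_dominated; set f := propagate; set D := dominated S.
have sub P : P \subset f P by apply: subsetUl.
have stable n : f (iter n f D) = iter n f D \/ n <= #|iter n f D|.
  elim: n => [|n [IH|IH]]; [by right | by left; rewrite /= !IH |].
  have [eqf|neqf] := eqVneq (f (iter n f D)) (iter n f D).
    by left; rewrite /= !eqf.
  right; apply: leq_ltn_trans IH _; apply: proper_card.
  by rewrite properEneq eq_sym neqf sub.
case: (stable #|V|) => // le_card.
suff -> : iter #|V| f D = [set: V] by apply/eqP; rewrite -subTset sub.
by apply/eqP; rewrite eqEcard subsetT cardsT.
Qed.

Lemma power_dominated_min S Q :
  dominated S \subset Q -> propagate Q \subset Q -> power_dominated S \subset Q.
Proof.
move=> sDQ sQQ; rewrite /power_dominated; elim: #|V| => //= n IH.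
set P := iter n _ _ in IH *; apply/subUsetP; split=> //.
apply/subsetP => w; rewrite inE => /exists_inP[v vP /eqP nvP].
have [//|wQ] := boolP (w \in Q); case/negP: (wQ); apply: (subsetP sQQ).
rewrite !inE; apply/orP; right; apply/exists_inP; exists v.
  exact: (subsetP IH).
rewrite eqEsubset -{1}nvP setDS //= sub1set inE wQ /=.
by have : w \in neighbors v :\: P; [rewrite nvP set11 | case/setDP].
Qed.

Lemma power_dominates_setT : power_dominates [set: V].
Proof.
rewrite /power_dominates -subTset /power_dominated.
elim: #|V| => /= [|n IH]; first exact: subsetUl.
exact: subset_trans IH (subsetUl _ _).
Qed.

End PowerDomination.

(* The adjacency matrix, row by row; its length n ^ 2 determines n. *)
Definition graph_code (n : nat) (e : rel 'I_n) : seq bool :=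
  [seq e i j | i <- enum 'I_n, j <- enum 'I_n].

Definition set_code (n : nat) (S : {set 'I_n}) : seq bool :=
  [seq i \in S | i <- enum 'I_n].

Local Open Scope ring_scope.

Definition pds_approximable (R : realType) (ratio : nat -> R) : Prop :=
  exists (M : TM) (c : nat), forall (n : nat) (e : rel 'I_n), simple_graph e ->
  exists S : {set 'I_n},
    [/\ outputs_within M (c * size (graph_code e) ^ c + c)%N
          (graph_code e) (set_code S),
        power_dominates e S
      & #|S|%:R <= ratio n * (pds_opt e)%:R].

Definition log2 (R : realType) (n : nat) : R := ln n%:R / ln 2.

(* Main.v *)
Require Import Defs.
From mathcomp Require Import all_boot all_order all_algebra.
From mathcomp Require Import boolp reals exp.
From mathcomp Require Import zify ring lra.

(* Let L be in NP. The runs of its verifier on x are the solutions of constraints on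
   three variables, the variables being indexed by m = O(log |x|) bits and their
   values being smaller than q = (m+1)! + 1. An assignment is encoded by its
   multilinear extension to (Z/q)^m, whose (m+1)-st differences vanish on every line.
   An atom is a pair of a point and a value; a test consists of three lines, and
   accepts a set of atoms if for some assignment of values to points of the lines,
   consistent with the differences and the constraints, the set contains all the
   corresponding atoms. If L x, the q^m atoms of a multilinear extension pass all the
   tests. Conversely, if a set with fewer than (1 + 1/(m+1)) q^m atoms passes all the
   tests, each point has a value and fewer than q^m/(m+1) points have several ones;
   hence through each point there is a line on which the other points have a single
   value, and interpolating along such lines yields a solution of the constraints.

   The tests form a monotone formula, and substituting it k = (m+1) m^a times into
   itself raises the gap 1 + 1/(m+1) to its k-th power, which is at least 2^(m^a).
   A monotone formula becomes a graph in which propagation evaluates many copies of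
   the formula from common inputs, and then dominates the rest; selecting nodes other
   than inputs is useless, since two copies without selected nodes are enough to block
   the propagation. The graph has at most 2^(m^(a+8)) nodes, so that a gap of 2^(m^a)
   exceeds the ratio as soon as a * eps >= 9.

   The Turing machine that decides L writes the adjacency matrix of this graph, runs
   the approximation algorithm on it and compares the size of the answer with the
   threshold; it is obtained by compiling programs of a counter machine, whose running
   time is polynomial in the size of the graph. *)

Set Implicit Arguments.
Unset Strict Implicit.
Unset Printing Implicit Defensive.

Import Order.TTheory GRing.Theory Num.Theory.

(** * Tapes as functions of the position relative to the head *)

(** The separation hypothesis allows time [2^polylog(n)], and this sets the economy of the proof.
    All the views of all the tests can be listed, so it is enough to start from a gap of
    [1 + 1/(m+1)]. This gap is measured in atoms and not in rejected tests, since a set of atoms has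
    to pass every test. Composition multiplies the gap because a leaf is labelled by the atoms on
    its path and not by the tests: leaves reached through different tests share their input, just as
    tests share atoms at a single level. Propagation has no direction, and a node that is dominated
    without being selected can force a neighbour too; the pendant nodes and the copies of the
    formula are there against these two effects. The reduction has to be a Turing machine. Hence
    points, tests, views and tree nodes are numbers, and all the functions on them are arithmetic;
    unary counters are affordable because time polynomial in the number of nodes is. *)

Definition cells (A : finType) (t : tape A) (z : int) : symbol A :=
  match z with
  | Posz k => nth None (scanned t :: rcells t) k
  | Negz k => nth None (lcells t) k
  end.

Definition shift (m : move) : int :=
  match m with MoveL => -1 | Stay => 0 | MoveR => 1 end.

(** The head stays at position 0 and a move renumbers the cells: cell [z] of the new tape is cell
    [z + shift m] of the old one. *)
Definition act (T : Type) (f : int -> T) (a : T) (m : move) : int -> T :=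
  fun z => if (z + shift m == 0)%R then a else f (z + shift m)%R.

Definition blank (A : finType) : int -> symbol A := fun=> None.

Definition inp (A : finType) (x : seq bool) (z : int) : symbol A :=
  if z is Posz k then nth None [seq Some (inl b) | b <- x] k else None.

Lemma cells_act (A : finType) (t : tape A) am :
  cells (tape_act t am) = act (cells t) am.1 am.2.
Proof.
apply/funext => z; case: am => a m; rewrite /act /=.
case: m => /=; rewrite ?addr0 //=.
- case: z => [[|k]|k] /=.
  + by rewrite nth0.
  + by rewrite (_ : (k.+1%:Z + -1)%R = k) //; case: k => [|k] //=; lia.
  + by rewrite nth_behead addn0.
- by case: z => [[|k]|k].
- case: z => [[|k]|k] /=.
  + by rewrite nth0.
  + by rewrite nth_behead addn1.
  + case: k => [|k] //=.
    by rewrite subn1.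
Qed.

Lemma cells_input (A : finType) x : cells (input_tape A x) = inp A x.
Proof.
apply/funext => -[k|k] /=; last by rewrite nth_nil.
by case: x => [|b x] //=; case: k => [|k] //=; rewrite !nth_nil.
Qed.

Lemma inp_nil (A : finType) : inp A [::] = blank A.
Proof. by apply/funext => -[k|k] //=; rewrite nth_nil. Qed.

Definition fconfig (M : TM) : Type :=
  (state M * ('I_(tapes M).+1 -> int -> symbol (aux M)))%type.

Definition fstep (M : TM) (c : fconfig M) : fconfig M :=
  if halting c.1 then c else
  let qa := delta c.1 [ffun i => c.2 i 0] in
  (qa.1, fun i => act (c.2 i) (qa.2 i).1 (qa.2 i).2).

Definition finit (M : TM) (x : seq bool) : fconfig M :=
  (start M, fun i => if i == ord0 then inp _ x else blank _).

Definition fcfg (M : TM) (c : config M) : fconfig M :=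
  (c.1, fun i => cells (c.2 i)).

Lemma fcfg_step (M : TM) (c : config M) : fcfg (step c) = fstep (fcfg c).
Proof.
rewrite /fcfg /step /fstep /=; case: ifP => // _ /=.
by congr pair; apply/funext => i; rewrite cells_act.
Qed.

Lemma fcfg_iter (M : TM) n x :
  fcfg (iter n (@step M) (init M x)) = iter n (@fstep M) (finit M x).
Proof.
elim: n => [|n IH] /=; last by rewrite fcfg_step IH.
rewrite /fcfg /finit /=; congr pair; apply/funext => i.
by rewrite cells_input; case: ifP => // _; rewrite inp_nil.
Qed.

Lemma fstep_halt (M : TM) n (c : fconfig M) :
  halting c.1 -> iter n (@fstep M) c = c.
Proof. by move=> hc; elim: n => //= n ->; rewrite /fstep hc. Qed.

Definition outs (A : finType) (f : int -> symbol A) (s : seq bool) : Prop :=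
  (forall k : nat, k < size s -> f k = Some (inl (nth false s k))) /\
  (forall b, f (size s) <> Some (inl b)).

Lemma leading_bitsP (A : finType) (l : seq (symbol A)) s :
  leading_bits l = s <->
  (forall k, k < size s -> nth None l k = Some (inl (nth false s k))) /\
  (forall b, nth None l (size s) <> Some (inl b)).
Proof.
elim: l s => [|a l IH] s /=.
  split=> [<-|[]]; first by split.
  by case: s => [|b s] // /(_ 0 isT).
case: a => [[b|a]|]; last 2 first.
- split=> [<-|[]]; first by split.
  by case: s => [|b s] // /(_ 0 isT).
- split=> [<-|[]]; first by split.
  by case: s => [|b s] // /(_ 0 isT).
case: s => [|b' s]; first by split=> // -[_ /(_ b)].
split=> [[<-] /IH[h1 h2]|[h1 h2]].
  by split=> // -[|k] //= /h1.
have [<-] := h1 0 isT; congr cons; apply/IH; split=> // k kb.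
exact: (h1 k.+1).
Qed.

Lemma outputs_withinP (M : TM) t x y :
  outputs_within M t x y <->
  halting (iter t (@fstep M) (finit M x)).1 /\
  outs ((iter t (@fstep M) (finit M x)).2 ord0) y.
Proof.
rewrite /outputs_within /output -fcfg_iter; set c := iter _ _ _.
split=> -[h1 h2]; split=> //; first exact: (iffLR (leading_bitsP _ _) h2).
exact: (iffRL (leading_bitsP _ _) h2).
Qed.

(** * A counter machine with a Turing machine as a subroutine *)

(** Jumps are relative, so that a block of code behaves the same wherever it is placed. [Fin] writes
    on the input tape, which is also the one where the output is read. *)
Inductive instr :=
  | Inc of nat | Dec of nat | Jz of nat & nat | Jb of nat
  | InR | InL | Jin of option bool & nat | Fin of bool
  | WPut of bool | WL | WR | Jw of nat.

Definition ireg (i : instr) : nat :=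
  match i with Inc r | Dec r | Jz r _ => r.+1 | _ => 0 end.

Section Machine.
Variable M : TM.

Definition maux : finType := (aux M + unit)%type.
Definition msym := symbol maux.
Definition mark : msym := Some (inr (inr tt)).
Definition tt_bit : msym := Some (inl true).

Definition emb (s : symbol (aux M)) : msym :=
  match s with
  | None => None
  | Some (inl b) => Some (inl b)
  | Some (inr a) => Some (inr (inl a))
  end.

Definition prj (s : msym) : symbol (aux M) :=
  match s with
  | Some (inl b) => Some (inl b)
  | Some (inr (inl a)) => Some (inr a)
  | _ => None
  end.

Lemma embK : cancel emb prj.
Proof. by case=> [[]|]. Qed.

(* The input tape [it] and the work tape [wt] are centered at their heads. *)
Record st := St { rg : nat -> nat; it : int -> msym; wt : int -> msym }.

Definition mv (m : move) (f : int -> msym) : int -> msym :=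
  fun z => f (z + shift m)%R.

Definition setr (s : st) (r v : nat) : st :=
  St (fun r' => if r' == r then v else rg s r') (it s) (wt s).

Definition exec_st (i : instr) (s : st) : st :=
  match i with
  | Inc r => setr s r (rg s r).+1
  | Dec r => setr s r (rg s r).-1
  | InR => St (rg s) (mv MoveR (it s)) (wt s)
  | InL => St (rg s) (mv MoveL (it s)) (wt s)
  | Fin b => St (rg s) (act (it s) (Some (inl b)) Stay) (wt s)
  | WPut b => St (rg s) (it s) (act (wt s) (Some (inl b)) MoveR)
  | WL => St (rg s) (it s) (mv MoveL (wt s))
  | WR => St (rg s) (it s) (mv MoveR (wt s))
  | _ => s
  end.

Definition exec_pc (i : instr) (pc : nat) (s : st) : nat :=
  match i with
  | Jz r k => if rg s r == 0 then pc + k else pc.+1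
  | Jb k => pc - k
  | Jin o k => if it s 0 == omap inl o then pc.+1 else pc + k
  | Jw k => if wt s 0 == tt_bit then pc.+1 else pc + k
  | _ => pc.+1
  end.

(** Jumps are cut at [size p], so that program counters fit in the ordinals of [mstate]; the value
    [size p] means that the program has ended. *)
Definition stepG (p : seq instr) (c : nat * st) : nat * st :=
  if c.1 < size p then
    let i := nth InR p c.1 in
    (minn (size p) (exec_pc i c.1 c.2), exec_st i c.2)
  else c.

(** A register holding [n] is a tape that is blank but for a mark [n] cells to the left of the head:
    increments and decrements are moves, and the test for zero looks for the mark. *)
Definition ctr (n : nat) : int -> msym :=
  fun z => if (z == - n%:Z)%R then mark else None.

Section Compile.
Variables p1 p2 : seq instr.

Definition max_reg (p : seq instr) : nat := foldr (fun i => maxn (ireg i)) 0 p.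

Definition nr : nat := maxn (max_reg p1) (max_reg p2).

(** [None] is the initial state, in which the marks of the counters are written; then come [p1], the
    subroutine [M] on the word left on the work tape, and [p2]. *)
Definition mstate : finType :=
  option (('I_(size p1).+1 + state M) + 'I_(size p2).+1)%type.

Definition mtapes := nr + (tapes M).+1.

Definition iact (i : instr) (k : nat) (a : msym) : msym * move :=
  match i with
  | Inc r => (a, if k == r.+1 then MoveR else Stay)
  | Dec r => (a, if (k == r.+1) && (a != mark) then MoveL else Stay)
  | InR => (a, if k == 0 then MoveR else Stay)
  | InL => (a, if k == 0 then MoveL else Stay)
  | Fin b => (if k == 0 then Some (inl b) else a, Stay)
  | WPut b => if k == nr.+1 then (Some (inl b), MoveR) else (a, Stay)
  | WL => (a, if k == nr.+1 then MoveL else Stay)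
  | WR => (a, if k == nr.+1 then MoveR else Stay)
  | _ => (a, Stay)
  end.

Definition ipc (i : instr) (pc : nat) (sc : nat -> msym) : nat :=
  match i with
  | Jz r k => if sc r.+1 == mark then pc + k else pc.+1
  | Jb k => pc - k
  | Jin o k => if sc 0 == omap inl o then pc.+1 else pc + k
  | Jw k => if sc nr.+1 == tt_bit then pc.+1 else pc + k
  | _ => pc.+1
  end.

Definition mdelta (q : mstate) (sc : {ffun 'I_mtapes.+1 -> msym}) :
    mstate * {ffun 'I_mtapes.+1 -> msym * move} :=
  let noop := [ffun i => (sc i, Stay)] in
  let prog (p : seq instr) pc :=
    let i := nth InR p pc in
    (minn (size p) (ipc i pc (fun k => sc (inord k))),
     [ffun k : 'I_mtapes.+1 => iact i k (sc k)]) in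
  match q with
  | None => (Some (inl (inl ord0)),
             [ffun k : 'I_mtapes.+1 =>
               if (0 < k <= nr) then (mark, Stay) else (sc k, Stay)])
  | Some (inl (inl pc)) =>
      if pc < size p1 then
        let: (pc', a) := prog p1 pc in (Some (inl (inl (inord pc'))), a)
      else (Some (inl (inr (start M))), noop)
  | Some (inl (inr q)) =>
      if halting q then (Some (inr ord0), noop) else
      let qa := delta q [ffun j : 'I_(tapes M).+1 => prj (sc (inord (nr.+1 + j)))] in
      (Some (inl (inr qa.1)),
       [ffun k : 'I_mtapes.+1 =>
         if nr < k then
           let am := qa.2 (inord (k - nr.+1)) in (emb am.1, am.2)
         else (sc k, Stay)])
  | Some (inr pc) =>
      let: (pc', a) := prog p2 pc in (Some (inr (inord pc')), a)
  end.

Definition mhalt (q : mstate) : bool :=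
  if q is Some (inr pc) then pc == size p2 :> nat else false.

Definition mach : TM :=
  {| tapes := mtapes; state := mstate; aux := maux; start := None;
     halting := mhalt; delta := mdelta |}.

(* [wts j] is the content of the [j]-th tape of the subroutine, the [0]-th being
   the work tape. *)
Definition tps (s : st) (wts : nat -> int -> msym) (k : nat) : int -> msym :=
  if k == 0 then it s else if k <= nr then ctr (rg s k.-1) else
  if k == nr.+1 then wt s else wts (k - nr.+1).

Lemma act_id (f : int -> msym) : act f (f 0) Stay = f.
Proof.
by apply/funext => z; rewrite /act addr0; case: eqP => [->|].
Qed.

Lemma act_mv (f : int -> msym) m : act f (f 0) m = mv m f.
Proof.
by apply/funext => z; rewrite /act /mv; case: eqP => [->|].
Qed.

Lemma mv0 (f : int -> msym) : mv Stay f = f.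
Proof. by apply/funext => z; rewrite /mv addr0. Qed.

Lemma ctr0 n : (ctr n 0 == mark) = (n == 0).
Proof. by rewrite /ctr; case: n. Qed.

Lemma ctrS n : mv MoveR (ctr n) = ctr n.+1.
Proof.
apply/funext => z; rewrite /mv /ctr /=.
by congr (if _ then _ else _); apply/eqP/eqP; lia.
Qed.

Lemma ctrP n : mv MoveL (ctr n.+1) = ctr n.
Proof.
apply/funext => z; rewrite /mv /ctr /=.
by congr (if _ then _ else _); apply/eqP/eqP; lia.
Qed.

Lemma iact_tps i s wts k : ireg i <= nr ->
  act (tps s wts k) (iact i k (tps s wts k 0)).1 (iact i k (tps s wts k 0)).2
  = tps (exec_st i s) wts k.
Proof.
rewrite /tps; case: i => [r|r|r j|j|||o j|b|b|||j] /= lr;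
  (have [k0|k0] := posnP k; first by subst k; rewrite /= ?act_id ?act_mv);
  rewrite ?(gtn_eqF k0) ?act_mv ?mv0 //.
- have [ek|nk] /= := eqVneq k r.+1; first by rewrite ek lr /= eqxx ctrS.
  rewrite mv0 (_ : k.-1 == r = false) //; apply/negbTE/eqP; move/eqP: nk; lia.
- have [ek|nk] /= := eqVneq k r.+1; last first.
    rewrite mv0 (_ : k.-1 == r = false) //.
    by apply/negbTE/eqP; move/eqP: nk; lia.
  rewrite ek lr /= eqxx ctr0; case: (rg s r) => [|n] /=; first exact: mv0.
  by rewrite ctrP.
- have [ek|nk] := eqVneq k nr.+1; first by rewrite ek ltnn.
  by rewrite act_id.
- have [ek|nk] := eqVneq k nr.+1; first by rewrite ek ltnn.
  by rewrite mv0.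
- have [ek|nk] := eqVneq k nr.+1; first by rewrite ek ltnn.
  by rewrite mv0.
Qed.

Lemma ipc_exec i pc s wts : ireg i <= nr ->
  ipc i pc (fun k => tps s wts k 0) = exec_pc i pc s.
Proof.
rewrite /tps; case: i => //= [r j lr|j _].
  by rewrite lr ctr0.
by rewrite ltnn eqxx.
Qed.

Definition fc (q : mstate) (s : st) wts : fconfig mach :=
  (q, fun k : 'I_mtapes.+1 => tps s wts k).

Lemma ireg_max p pc : ireg (nth InR p pc) <= max_reg p.
Proof.
elim: p pc => [|i p IH] [|pc] //=; first exact: leq_maxl.
by apply: leq_trans (IH pc) _; apply: leq_maxr.
Qed.

Lemma ireg1 pc : ireg (nth InR p1 pc) <= nr.
Proof. exact: leq_trans (ireg_max _ _) (leq_maxl _ _). Qed.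

Lemma ireg2 pc : ireg (nth InR p2 pc) <= nr.
Proof. exact: leq_trans (ireg_max _ _) (leq_maxr _ _). Qed.

Lemma eq_ipc i pc (f g : nat -> msym) : ireg i <= nr ->
  (forall k, k <= nr.+1 -> f k = g k) -> ipc i pc f = ipc i pc g.
Proof.
by move=> li fg; case: i li => //= *; rewrite fg //; lia.
Qed.

Definition scan (f : 'I_mtapes.+1 -> int -> msym) :
  {ffun 'I_mtapes.+1 -> msym} := [ffun i => f i 0].

Lemma scan_inord s wts k : k <= nr.+1 ->
  scan (fun k : 'I_mtapes.+1 => tps s wts k) (inord k) = tps s wts k 0.
Proof.
by move=> lk; rewrite ffunE inordK //; move: lk; rewrite /mtapes; lia.
Qed.

Definition q1 (pc : nat) : mstate := Some (inl (inl (inord pc))).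
Definition q2 (pc : nat) : mstate := Some (inr (inord pc)).

Lemma fstep1 pc s wts : pc < size p1 ->
  fstep (fc (q1 pc) s wts) =
  let c := stepG p1 (pc, s) in fc (q1 c.1) c.2 wts.
Proof.
move=> lpc; rewrite /fstep /=.
rewrite inordK ?ltnS ?(ltnW lpc) // lpc /stepG /= lpc /= /fc; congr pair.
  rewrite /q1; do 4 f_equal; rewrite -(ipc_exec _ s wts (ireg1 pc)).
  by congr (minn _ _); apply: eq_ipc (ireg1 pc) _ => k; apply: scan_inord.
apply/funext => k; rewrite !ffunE.
exact: iact_tps (ireg1 pc).
Qed.

Lemma fstep2 pc s wts : pc < size p2 ->
  fstep (fc (q2 pc) s wts) =
  let c := stepG p2 (pc, s) in fc (q2 c.1) c.2 wts.
Proof.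
move=> lpc; rewrite /fstep /=.
rewrite inordK ?ltnS ?(ltnW lpc) // ltn_eqF //= /stepG /= lpc /= /fc; congr pair.
  rewrite /q2; do 3 f_equal; rewrite -(ipc_exec _ s wts (ireg2 pc)).
  by congr (minn _ _); apply: eq_ipc (ireg2 pc) _ => k; apply: scan_inord.
apply/funext => k; rewrite !ffunE.
exact: iact_tps (ireg2 pc).
Qed.

Lemma iter_stepG_end p n s : iter n (stepG p) (size p, s) = (size p, s).
Proof. by elim: n => //= n ->; rewrite /stepG ltnn. Qed.

Lemma stepG_le p c : c.1 <= size p -> (stepG p c).1 <= size p.
Proof. by rewrite /stepG; case: ifP => // _ _ /=; apply: geq_minl. Qed.

Lemma run_phase (q : nat -> mstate) p n pc s s' wts :
  (forall pc s, pc < size p -> fstep (fc (q pc) s wts) =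
     let c := stepG p (pc, s) in fc (q c.1) c.2 wts) ->
  pc <= size p -> iter n (stepG p) (pc, s) = (size p, s') ->
  exists2 k, k <= n &
    iter k (@fstep mach) (fc (q pc) s wts) = fc (q (size p)) s' wts.
Proof.
move=> qE; elim: n pc s => [|n IH] pc s lpc.
  by move=> [-> ->]; exists 0.
have [lt|ge] := ltnP pc (size p); last first.
  have -> : pc = size p by apply/eqP; rewrite eqn_leq lpc.
  by rewrite iter_stepG_end => -[<-]; exists 0.
rewrite iterSr [stepG p _]surjective_pairing => /IH[|k lk Ek].
  exact: stepG_le.
by exists k.+1 => //; rewrite iterSr qE.
Qed.

Definition fcM (s : st) (c : fconfig M) : fconfig mach :=
  fc (Some (inl (inr c.1))) (St (rg s) (it s) (emb \o c.2 ord0))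
     (fun j => emb \o c.2 (inord j)).

Lemma act_emb (f : int -> symbol (aux M)) a m :
  emb \o act f a m = act (emb \o f) (emb a) m.
Proof. by apply/funext => z; rewrite /act /=; case: ifP. Qed.

Lemma fstepM s c : ~~ halting c.1 -> fstep (fcM s c) = fcM s (fstep c).
Proof.
move=> nh; rewrite /fstep /= (negbTE nh) /=.
set sc1 := [ffun _ => prj _].
have -> : sc1 = [ffun i => c.2 i 0].
  apply/ffunP => j; rewrite !ffunE inordK; last first.
    by have := ltn_ord j; rewrite /mtapes; lia.
  rewrite /tps /= ltnNge leq_addr /= -{2}[nr.+1]addn0 eqn_add2l addKn.
  case: eqP => [j0|_] /=; rewrite embK //; last by rewrite inord_val.
  by congr (c.2 _ _); apply/val_inj.
rewrite /fcM /fc /=; congr pair; apply/funext => k; rewrite !ffunE /tps /=.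
have [k0|k0] := posnP k; first by rewrite k0 act_id.
have [lk|lk] := leqP k nr; first by rewrite act_id.
case: eqP => [ek|nk] /=; last by rewrite act_emb.
by rewrite act_emb ek subnn (_ : inord 0 = ord0) //; apply/val_inj; rewrite /= inordK.
Qed.

Lemma run_sub s c n : halting (iter n (@fstep M) c).1 ->
  exists2 k, k <= n & iter k (@fstep mach) (fcM s c) = fcM s (iter n (@fstep M) c).
Proof.
elim: n c => [|n IH] c hc; first by exists 0.
have [h|nh] := boolP (halting c.1).
  by exists 0 => //; rewrite (@fstep_halt M).
have [|k lk Ek] := IH (fstep c); first by rewrite -iterSr.
by exists k.+1 => //; rewrite iterSr fstepM // Ek -iterSr.
Qed.

Lemma outs_emb (f : int -> symbol (aux M)) s : outs f s -> outs (emb \o f) s.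
Proof.
move=> [h1 h2]; split=> [k /h1 /= -> //|b].
by have := h2 b; rewrite /=; case: (f _) => [[]|] // b' h [e]; case: h; rewrite e.
Qed.

Lemma emb_inp y : emb \o inp _ y = inp _ y.
Proof.
apply/funext => -[k|k] //=; elim: y k => [|b y IH] [|k] //=.
Qed.

(** The 3 extra steps write the marks and pass from [p1] to [M] and from [M] to [p2]. Only the
    output is known of the tape left by [M], hence [p2] has to work for every [w] that carries
    [z]. *)
Lemma mach_outputs x y z o n1 n2 t s1 :
  iter n1 (stepG p1) (0, St (fun=> 0) (inp _ x) (blank _)) = (size p1, s1) ->
  wt s1 = inp _ y -> outputs_within M t y z ->
  (forall w, outs w z -> exists n s3, [/\ n <= n2,
     iter n (stepG p2) (0, St (rg s1) (it s1) w) = (size p2, s3) &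
     outs (it s3) o]) ->
  outputs_within mach (n1 + t + n2 + 3) x o.
Proof.
move=> run1 wt1 /outputs_withinP[hM oM] run2; apply/outputs_withinP.
pose wts0 (j : nat) := blank maux.
have step0 : fstep (finit mach x) =
    fc (q1 0) (St (fun=> 0) (inp _ x) (blank _)) wts0.
  rewrite /fstep /= /fc /q1; congr pair.
    by do 3 f_equal; apply/val_inj; rewrite /= inordK.
  apply/funext => k; rewrite !ffunE /tps /=.
  have [k0|k0] := posnP k.
    by rewrite (_ : k == ord0) ?act_id //; apply/eqP/val_inj.
  rewrite (_ : k == ord0 = false) /=; last first.
    by apply/negbTE/eqP => k1; rewrite k1 in k0.
  case: ifP => lk /=; last first.
    by rewrite act_id; case: ifP.
  apply/funext => u; rewrite /act /ctr addr0 oppr0.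
  by case: eqP => // ->.
have [k1 lk1 E1] := run_phase (fun pc s => @fstep1 pc s wts0) (leq0n _) run1.
have step1 : fstep (fc (q1 (size p1)) s1 wts0) = fcM s1 (finit M y).
  rewrite /fstep /= inordK // ltnn /fcM /fc /=; congr pair.
  apply/funext => k; rewrite !ffunE act_id /tps /=.
  case: (posnP k) => // k0; case: leqP => // lk; case: eqP => [ek|nk].
    by rewrite emb_inp.
  rewrite /wts0 (_ : inord _ == ord0 = false); last first.
    apply/negbTE/eqP => /(congr1 val); rewrite /= inordK; first lia.
    by have lt : @nat_of_ord mtapes.+1 k < (nr + (tapes M).+1).+1 := ltn_ord k; lia.
  by apply/funext.
have [k2 lk2 E2] := run_sub s1 hM.
set cM := iter t _ _ in hM oM E2.
have step2 : fstep (fcM s1 cM) =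
    fc (q2 0) (St (rg s1) (it s1) (emb \o cM.2 ord0)) (fun j => emb \o cM.2 (inord j)).
  rewrite /fstep /= hM /fcM /fc /= /q2; congr pair.
    by do 2 f_equal; apply/val_inj; rewrite /= inordK.
  by apply/funext => k; rewrite !ffunE act_id.
have [n [s3 [ln run3 o3]]] := run2 _ (outs_emb oM).
pose wts3 j := emb \o cM.2 (inord j).
have [k3 lk3 E3] := run_phase (fun pc s => @fstep2 pc s wts3) (leq0n _) run3.
have E : iter (k3 + 1 + k2 + 1 + k1 + 1) (@fstep mach) (finit mach x) =
    fc (q2 (size p2)) s3 wts3.
  by do 5 rewrite iterD; rewrite /= step0 E1 step1 E2 step2 E3.
have hE : @halting mach (fc (q2 (size p2)) s3 wts3).1.
  by rewrite /= inordK.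
have -> : n1 + t + n2 + 3 = (n1 + t + n2 - (k1 + k2 + k3)) + (k3 + 1 + k2 + 1 + k1 + 1).
  by move: lk1 lk2 lk3 ln; lia.
by rewrite iterD E fstep_halt.
Qed.

End Compile.
End Machine.

Section Runs.
Variable M : TM.
Notation st := (st M).
Implicit Types (s : st) (C : seq instr).

Lemma st_ext s s' : rg s =1 rg s' -> it s = it s' -> wt s = wt s' -> s = s'.
Proof. by case: s s' => r i w [r' i' w'] /= /funext -> -> ->. Qed.

(** The context is arbitrary, which lets blocks be concatenated and nested. Chaining runs requires
    the exact number of steps; [runsB] keeps only a bound. *)
Definition runs C s s' n := forall pre post,
  iter n (stepG (pre ++ C ++ post)) (size pre, s) = (size pre + size C, s').

Definition runsB C s s' (B : nat) := exists2 n, n <= B & runs C s s' n.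

Lemma runsB_le C s s' B B' : B <= B' -> runsB C s s' B -> runsB C s s' B'.
Proof. by move=> le [n nB h]; exists n => //; apply: leq_trans le. Qed.

Lemma runsB_nil s B : runsB [::] s s B.
Proof. by exists 0 => // pre post; rewrite addn0. Qed.

Lemma runsB_cat C1 C2 s1 s2 s3 B1 B2 :
  runsB C1 s1 s2 B1 -> runsB C2 s2 s3 B2 -> runsB (C1 ++ C2) s1 s3 (B1 + B2).
Proof.
move=> [n1 l1 r1] [n2 l2 r2]; exists (n1 + n2); first exact: leq_add.
move=> pre post; rewrite addnC iterD -catA r1.
by have := r2 (pre ++ C1) post; rewrite -catA !size_cat addnA.
Qed.

Lemma step_at pre i post s :
  stepG (pre ++ i :: post) (size pre, s) =
  (minn (size (pre ++ i :: post)) (exec_pc i (size pre) s), exec_st i s).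
Proof.
by rewrite /stepG /= size_cat /= addnS ltnS leq_addr nth_cat ltnn subnn.
Qed.

Lemma runsB_instr i s : (forall pc, exec_pc i pc s = pc.+1) ->
  runsB [:: i] s (exec_st i s) 1.
Proof.
move=> hi; exists 1 => // pre post /=.
by rewrite step_at hi addn1 (minn_idPr _) // size_cat /= addnS ltnS leq_addr.
Qed.

Definition loopc r C := Jz r (size C + 3) :: Dec r :: C ++ [:: Jb (size C + 2)].

Lemma loopc_iter r C s s' n k pre post :
  rg s r = k.+1 -> runs C (setr s r k) s' n ->
  iter (1 + (n + (1 + 1))) (stepG (pre ++ loopc r C ++ post)) (size pre, s)
  = (size pre, s').
Proof.
move=> rk run; rewrite !iterD.
have -> : iter 1 (stepG (pre ++ loopc r C ++ post)) (size pre, s) = ((size pre).+1, s).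
  rewrite /= step_at /= rk /= (minn_idPr _) // size_cat /= addnS ltnS leq_addr.
  done.
have E1 : pre ++ loopc r C ++ post = (rcons pre (Jz r (size C + 3))) ++ Dec r :: C ++ [:: Jb (size C + 2)] ++ post.
  by rewrite cat_rcons /= -catA.
have -> : iter 1 (stepG (pre ++ loopc r C ++ post)) ((size pre).+1, s) =
          ((size pre).+2, setr s r k).
  rewrite E1 -(size_rcons pre (Jz r (size C + 3))) /= step_at /= rk /=.
  by rewrite (minn_idPr _) // !size_cat /= size_rcons; lia.
have E2 : pre ++ loopc r C ++ post = (pre ++ [:: Jz r (size C + 3); Dec r]) ++ C ++ [:: Jb (size C + 2)] ++ post.
  by rewrite -!catA /= -!catA.
have := run (pre ++ [:: Jz r (size C + 3); Dec r]) ([:: Jb (size C + 2)] ++ post).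
rewrite -E2 size_cat [size [:: _; _]]/= addn2 => ->.
have E3 : pre ++ loopc r C ++ post = (pre ++ [:: Jz r (size C + 3), Dec r & C]) ++ Jb (size C + 2) :: post.
  by rewrite -!catA /= -!catA.
have -> : (size pre).+2 + size C = size (pre ++ [:: Jz r (size C + 3), Dec r & C]).
  by rewrite size_cat /=; lia.
rewrite E3 /= step_at /= size_cat /=; congr pair.
by rewrite size_cat /=; lia.
Qed.

Lemma loopc_exit r C s : rg s r = 0 -> runs (loopc r C) s s 1.
Proof.
move=> r0 pre post; rewrite /= step_at /= r0 eqxx; congr pair.
by rewrite !size_cat /= !size_cat /=; lia.
Qed.

(** [S i] is the state after [i] turns, and the body starts with [r] already decremented. A turn
    costs 3 steps besides [C], and the last test costs 1. *)
Lemma runsB_loop r C k (S : nat -> st) B :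
  (forall i, i <= k -> rg (S i) r = k - i) ->
  (forall i, i < k -> runsB C (setr (S i) r (k - i.+1)) (S i.+1) B) ->
  runsB (loopc r C) (S 0) (S k) (k * (B + 3) + 1).
Proof.
elim: k S => [|k IH] S hr hC.
  by exists 1 => //; apply: loopc_exit; rewrite hr.
have [||n nB run] := IH (S \o succn).
- by move=> i lik; rewrite /= hr.
- by move=> i lik; rewrite /= -subSS; apply: hC.
have [n0 n0B run0] := hC 0 isT.
exists (n + (1 + (n0 + (1 + 1)))); first by rewrite mulSn; lia.
move=> pre post; rewrite iterD (loopc_iter (k := k) _ _ _ (s' := S 1)) //.
  by rewrite hr.
by rewrite subn1 in run0.
Qed.

Definition ifin o C := Jin o (size C).+1 :: C.
Definition ifw C := Jw (size C).+1 :: C.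

Lemma runsB_ifin o C s s' B : (it s 0 == omap inl o -> runsB C s s' B) ->
  (it s 0 != omap inl o -> s' = s) -> runsB (ifin o C) s s' B.+1.
Proof.
move=> h1 h0; have [r1|rn] := boolP (it s 0 == omap inl o); last first.
  exists 1 => // pre post; rewrite /= step_at /= (negbTE rn) h0 //; congr pair.
  by rewrite !size_cat /= !size_cat; lia.
have [n nB run] := h1 r1; exists (n + 1); first by rewrite addn1.
move=> pre post; rewrite iterD /= step_at /= r1.
have E : pre ++ Jin o (size C).+1 :: C ++ post = (rcons pre (Jin o (size C).+1)) ++ C ++ post.
  by rewrite cat_rcons.
rewrite (minn_idPr _); last by rewrite size_cat /=; lia.
rewrite E -(size_rcons pre (Jin o (size C).+1)) run size_rcons; congr pair; lia.
Qed.

Lemma runsB_ifw C s s' B : (wt s 0 == tt_bit M -> runsB C s s' B) ->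
  (wt s 0 != tt_bit M -> s' = s) -> runsB (ifw C) s s' B.+1.
Proof.
move=> h1 h0; have [r1|rn] := boolP (wt s 0 == tt_bit M); last first.
  exists 1 => // pre post; rewrite /= step_at /= (negbTE rn) h0 //; congr pair.
  by rewrite !size_cat /= !size_cat; lia.
have [n nB run] := h1 r1; exists (n + 1); first by rewrite addn1.
move=> pre post; rewrite iterD /= step_at /= r1.
have E : pre ++ Jw (size C).+1 :: C ++ post = (rcons pre (Jw (size C).+1)) ++ C ++ post.
  by rewrite cat_rcons.
rewrite (minn_idPr _); last by rewrite size_cat /=; lia.
rewrite E -(size_rcons pre (Jw (size C).+1)) run size_rcons; congr pair; lia.
Qed.

Lemma runsB_inc r s B : 0 < B -> runsB [:: Inc r] s (setr s r (rg s r).+1) B.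
Proof. by move=> B0; apply: (runsB_le B0); exact: runsB_instr. Qed.

Lemma runsB_eq C s s1 s2 B : s1 = s2 -> runsB C s s1 B -> runsB C s s2 B.
Proof. by move->. Qed.

End Runs.

Ltac st_eq :=
  apply: st_ext => //= ?; repeat (case: eqP => //= ?); intros; subst;
  try first [lia | congruence].

(** * Polynomially bounded and computable functions *)

(* The functions computed by programs: of the input word and of a list of registers.
   Registers are counters, hence their values, and not their lengths, are counted
   as sizes. *)
Definition fn := seq bool -> seq nat -> nat.

(** The summand 2 makes the base at least 2: constants, and the doubling caused by a sum, are then
    absorbed in the exponent. *)
Definition sz : fn := fun x e => size x + sumn e + 2.

Definition PB (f : fn) := exists c, forall x e, f x e <= sz x e ^ c.

Lemma sz_gt1 x e : 1 < sz x e.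
Proof. by rewrite /sz addn2. Qed.

Lemma PB_le (f g : fn) : PB g -> (forall x e, f x e <= g x e) -> PB f.
Proof. by move=> [c hc] h; exists c => x e; apply: leq_trans (h _ _) _. Qed.

Lemma PB_sz : PB sz.
Proof. by exists 1 => x e; rewrite expn1. Qed.

Lemma PB_const n : PB (fun _ _ => n).
Proof.
exists n => x e; apply: leq_trans (ltnW (ltn_expl n (ltnSn 1))) _.
by case: n => // n; rewrite leq_exp2r // sz_gt1.
Qed.

Lemma leq_expn2W S a b : 1 < S -> a <= b -> S ^ a <= S ^ b.
Proof. by move=> s1 ab; apply: leq_pexp2l => //; apply: ltnW. Qed.

Lemma PB_add f g : PB f -> PB g -> PB (fun x e => f x e + g x e).
Proof.
move=> [c hc] [d hd]; exists (c + d).+1 => x e; have s1 := sz_gt1 x e.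
apply: (@leq_trans (2 * sz x e ^ (c + d))); last by rewrite expnS leq_mul2r s1 orbT.
rewrite mul2n -addnn leq_add //.
  by apply: leq_trans (hc x e) (leq_expn2W s1 (leq_addr _ _)).
by apply: leq_trans (hd x e) (leq_expn2W s1 (leq_addl _ _)).
Qed.

Lemma PB_mul f g : PB f -> PB g -> PB (fun x e => f x e * g x e).
Proof.
by move=> [c hc] [d hd]; exists (c + d) => x e; rewrite expnD leq_mul.
Qed.

Lemma PB_size : PB (fun x _ => size x).
Proof. by apply: (PB_le PB_sz) => x e; rewrite /sz -addnA leq_addr. Qed.

Lemma sz_cons x v e : sz x (v :: e) = v + sz x e.
Proof. by rewrite /sz /=; lia. Qed.

Lemma sz_behead x e : sz x (behead e) <= sz x e.
Proof. by case: e => //= v e; rewrite sz_cons leq_addl. Qed.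

Lemma leq_nth_sz x e i : nth 0 e i <= sz x e.
Proof.
elim: e i => [|v e IH] [|i] //=; rewrite sz_cons; first exact: leq_addr.
by apply: leq_trans (IH i) (leq_addl _ _).
Qed.

Lemma PB_nth i : PB (fun _ e => nth 0 e i).
Proof. by apply: (PB_le PB_sz) => x e; apply: leq_nth_sz. Qed.

Lemma PB_comp (E : seq bool -> seq nat -> seq nat) f :
  PB (fun x e => sz x (E x e)) -> PB f -> PB (fun x e => f x (E x e)).
Proof.
move=> [c hc] [d hd]; exists (c * d) => x e; rewrite expnM.
by apply: leq_trans (hd x _) _; case: d {hd} => // d; rewrite leq_exp2r.
Qed.

Lemma PB_weak f : PB f -> PB (fun x e => f x (behead e)).
Proof.
by apply: PB_comp; apply: (PB_le PB_sz) => x e; apply: sz_behead.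
Qed.

Lemma PB_exp f n : PB f -> PB (fun x e => f x e ^ n).
Proof.
move=> hf; elim: n => [|n IH]; first by apply: (PB_le (PB_const 1)).
by apply: (PB_le (PB_mul hf IH)) => x e; rewrite expnS.
Qed.

Section Comp.
Variable M : TM.
Notation st := (st M).
Notation runsB := (@runsB M).

(** Calling convention: the arguments are in registers below [t], all the registers from [t] on are
    0, and at the end only register [t] has changed. In particular the input head is back in its
    place. *)
Definition Comp (f : fn) : Prop := PB f /\
  forall loc t, all (fun r => r < t) loc -> exists C (T : fn), PB T /\
    forall x (s : st), it s = inp _ x -> (forall r, t <= r -> rg s r = 0) ->
    let e := [seq rg s r | r <- loc] in
    runsB C s (setr s t (f x e)) (T x e).

Lemma eq_Comp f g : (forall x e, f x e = g x e) -> Comp f -> Comp g.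
Proof. by move=> fg; have -> : f = g by do 2 apply/funext => ?. Qed.

Lemma Comp_PB f : Comp f -> PB f. Proof. by case. Qed.

Lemma setr_id (s : st) r v : rg s r = v -> setr s r v = s.
Proof. by move=> e; apply: st_ext => //= k; case: eqP => // ->. Qed.

Lemma runsB_move a b (s : st) : a != b -> rg s b = 0 ->
  runsB (loopc a [:: Inc b]) s (setr (setr s b (rg s a)) a 0) (rg s a * 4 + 1).
Proof.
move=> ab b0; pose S i := setr (setr s b i) a (rg s a - i).
have := @runsB_loop M a [:: Inc b] (rg s a) S 1.
have -> : S 0 = s.
  by rewrite /S subn0 [setr s b 0]setr_id ?setr_id.
have -> : S (rg s a) = setr (setr s b (rg s a)) a 0 by rewrite /S subnn.
apply=> [i _|i li]; first by rewrite /= eqxx.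
apply: runsB_eq (runsB_inc _ _ _) => //.
by st_eq.
Qed.

Lemma runsB_clear a (s : st) : runsB (loopc a [::]) s (setr s a 0) (rg s a * 3 + 1).
Proof.
pose S i := setr s a (rg s a - i).
have := @runsB_loop M a [::] (rg s a) S 0.
have -> : S 0 = s by rewrite /S subn0 setr_id.
have -> : S (rg s a) = setr s a 0 by rewrite /S subnn.
apply=> [i _|i li]; first by rewrite /= eqxx.
by apply: runsB_eq (runsB_nil _ _); apply: st_ext => //= k; case: eqP.
Qed.

(** A loop empties the register that it counts down, so the value is copied twice and the second
    copy restores [l]. *)
Lemma runsB_copy l t (s : st) : l < t -> (forall r, t <= r -> rg s r = 0) ->
  runsB (loopc l [:: Inc t; Inc t.+1] ++ loopc t.+1 [:: Inc l])
    s (setr s t (rg s l)) (rg s l * 9 + 2).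
Proof.
move=> lt z; set k := rg s l.
pose S i := setr (setr (setr s t i) t.+1 i) l (k - i).
apply: runsB_le (runsB_cat (s2 := S k) (B1 := k * (2 + 3) + 1) (B2 := k * 4 + 1) _ _).
  by lia.
- have := @runsB_loop M l [:: Inc t; Inc t.+1] k S 2.
  have -> : S 0 = s.
    by rewrite /S subn0; st_eq; rewrite ?z //; lia.
  apply=> [i _|i li]; first by rewrite /= eqxx.
  apply: (runsB_cat (B1 := 1) (B2 := 1) (C1 := [:: _])); first exact: runsB_inc.
  apply: runsB_eq (runsB_inc _ _ _) => //.
  by st_eq.
- apply: runsB_le (runsB_eq _ (runsB_move _ _)) => /=; first 2 last.
  + by apply/eqP; lia.
  + by rewrite eqxx subnn.
  + by rewrite !eqxx; case: eqP; lia.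
  + by st_eq; rewrite ?z //; lia.
Qed.

Lemma eq_loc (s s' : st) loc t : all (fun r => r < t) loc ->
  (forall r, r < t -> rg s' r = rg s r) ->
  [seq rg s' r | r <- loc] = [seq rg s r | r <- loc].
Proof. by move=> /allP hl h; apply/eq_in_map => r /hl /h. Qed.

Lemma all_ltW loc t t' : t <= t' -> all (fun r => r < t) loc ->
  all (fun r => r < t') loc.
Proof. by move=> tt' /allP h; apply/allP => r /h /leq_trans; apply. Qed.

Lemma Comp_zero : Comp (fun _ _ => 0).
Proof.
split=> [|loc t ht]; first exact: PB_const.
exists [::], (fun _ _ => 0); split=> [|x s _ z]; first exact: PB_const.
by rewrite setr_id ?z //; apply: runsB_nil.
Qed.

Lemma Comp_succ f : Comp f -> Comp (fun x e => (f x e).+1).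
Proof.
move=> [pf cf]; split=> [|loc t ht].
  by apply: (PB_le (PB_add pf (PB_const 1))) => x e; rewrite addn1.
have [C [T [pT hC]]] := cf loc t ht.
exists (C ++ [:: Inc t]), (fun x e => T x e + 1); split.
  exact: PB_add pT (PB_const 1).
move=> x s sx z e; apply: runsB_cat (hC x s sx z) _.
by apply: runsB_eq (runsB_inc _ _ _) => //; st_eq.
Qed.

Lemma Comp_var i : Comp (fun _ e => nth 0 e i).
Proof.
split=> [|loc t ht]; first exact: PB_nth.
have [li|ge] := ltnP i (size loc); last first.
  exists [::], (fun _ _ => 0); split=> [|x s _ z]; first exact: PB_const.
  by rewrite /= nth_default ?size_map // setr_id ?z //; apply: runsB_nil.
set l := nth 0 loc i.
exists (loopc l [:: Inc t; Inc t.+1] ++ loopc t.+1 [:: Inc l]).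
exists (fun x e => nth 0 e i * 9 + 2); split.
  exact: PB_add (PB_mul (PB_nth i) (PB_const 9)) (PB_const 2).
move=> x s _ z; rewrite /= (nth_map 0) // -/l.
by apply: runsB_copy => //; apply: (allP ht); apply: mem_nth.
Qed.

(** Iterating a polynomially bounded function may break all polynomial bounds, hence the bound [B]
    on the intermediate values. Register [t] is the accumulator, [t.+1] the number of turns left,
    [t.+2] the index and [t.+3] the new value. *)
Lemma Comp_rec n a g (B : fn) : Comp n -> Comp a -> Comp g -> PB B ->
  (forall x e i, i <= n x e ->
     iteri i (fun j acc => g x [:: acc, j & e]) (a x e) <= B x e) ->
  Comp (fun x e => iteri (n x e) (fun j acc => g x [:: acc, j & e]) (a x e)).
Proof.
move=> [pn cn] [pa ca] [pg cg] pB hB; split=> [|loc t ht].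
  by apply: (PB_le pB) => x e; apply: hB.
have [Ca [Ta [pTa ha]]] := ca loc t ht.
have [Cn [Tn [pTn hn]]] := cn loc t.+1 (all_ltW (leqnSn t) ht).
have ht3 : all (fun r => r < t.+3) [:: t, t.+2 & loc].
  by rewrite /= !ltnS leqnn /= (ltnW (leqnSn _)) //=; apply: all_ltW ht; lia.
have [Cg [Tg [pTg hg]]] := cg [:: t, t.+2 & loc] t.+3 ht3.
have [c hc] := pTg.
pose Tb : fn := fun x e => (B x e + n x e + sz x e) ^ c + B x e * 7 + 3.
have pTb : PB Tb.
  apply: PB_add (PB_add (PB_exp _ _) (PB_mul pB (PB_const _))) (PB_const _).
  exact: PB_add (PB_add pB pn) PB_sz.
exists (Ca ++ Cn ++ loopc t.+1 (Cg ++ loopc t [::] ++ loopc t.+3 [:: Inc t]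
   ++ [:: Inc t.+2]) ++ loopc t.+2 [::]).
exists (fun x e => Ta x e + (Tn x e + ((n x e * (Tb x e + 3) + 1) +
  (n x e * 3 + 1)))); split.
  apply: PB_add pTa (PB_add pTn (PB_add (PB_add (PB_mul pn _) _) _)).
  - exact: PB_add pTb (PB_const _).
  - exact: PB_const.
  - exact: PB_add (PB_mul pn (PB_const _)) (PB_const _).
move=> x s sx z; set e := map _ _; apply: runsB_cat (ha x s sx z) _.
rewrite -/e; set s1 := setr _ _ _.
have el (s' : st) : (forall r, r < t -> rg s' r = rg s r) ->
    [seq rg s' r | r <- loc] = e by apply: (@eq_loc s s' loc t).
have e1 : [seq rg s1 r | r <- loc] = e.
  by apply: el => r rt; rewrite /= ltn_eqF.
have := hn x s1 sx; rewrite e1 => h; apply: runsB_cat (h _) _ => {h}.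
  by move=> r tr /=; rewrite gtn_eqF // z // ltnW.
set k := n x e.
pose R i := iteri i (fun j acc => g x [:: acc, j & e]) (a x e).
pose S i := setr (setr (setr s t (R i)) t.+1 (k - i)) t.+2 i.
have -> : setr s1 t.+1 k = S 0.
  by rewrite /S subn0; st_eq; rewrite z //; lia.
apply: (runsB_cat (s2 := S k)); last first.
  apply: runsB_le (runsB_eq _ (runsB_clear _ _)) => /=; first by rewrite eqxx.
  by rewrite /S -/k subnn; st_eq; rewrite ?z //; lia.
apply: runsB_loop => i li; first by rewrite /= eqxx ltn_eqF.
have sxi : it (setr (S i) t.+1 (k - i.+1)) = inp _ x by [].
have := hg x _ sxi.
have -> : [seq rg (setr (S i) t.+1 (k - i.+1)) r | r <- [:: t, t.+2 & loc]]
   = [:: R i, i & e].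
  rewrite /= !eqxx; congr [:: _, _ & _].
  - by repeat (case: eqP; first by lia); move=> *; rewrite ?eqxx.
  - by case: eqP => //; lia.
  - by apply: (el (setr (S i) t.+1 (k - i.+1))) => r rt /=; repeat (case: eqP; first by lia).
move=> h; have hRi : R i <= B x e by apply: hB; apply: ltnW.
have hRi1 : R i.+1 <= B x e by apply: hB.
apply: (@runsB_le _ _ _ _ (Tg x [:: R i, i & e] + ((R i * 3 + 1) +
   ((R i.+1 * 4 + 1) + 1)))).
  suff : Tg x [:: R i, i & e] <= (B x e + n x e + sz x e) ^ c by rewrite /Tb; lia.
  apply: leq_trans (hc _ _) _; case: c {hc pTb Tb} => // c.
  by rewrite leq_exp2r // !sz_cons addnA leq_add2r leq_add // ltnW.
apply: runsB_cat (h _) _ => {h}.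
  by move=> r tr /=; repeat (case: eqP; first by lia); rewrite z //; lia.
rewrite -[g x _]/(R i.+1); apply: runsB_cat.
  apply: runsB_le (runsB_clear _ _) => /=.
  by repeat (case: eqP; first by lia); lia.
apply: (@runsB_cat _ _ _ _ (setr (setr (setr s t (R i.+1)) t.+1 (k - i.+1)) t.+2 i)).
  apply: runsB_le (runsB_eq _ (runsB_move _ _)) => /=; last 2 first.
  - by apply/eqP; lia.
  - by rewrite eqxx.
  - by case: eqP => [|_]; [lia|rewrite eqxx].
  - by st_eq; rewrite z //; lia.
by apply: runsB_eq (runsB_inc _ _ _) => //; rewrite /S; st_eq.
Qed.

Lemma inp_addS x (i : nat) : mv MoveR (fun z => inp (maux M) x (z + i%:Z)%R)
  = (fun z => inp (maux M) x (z + i.+1%:Z)%R).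
Proof. by apply/funext => z; rewrite /mv /=; congr inp; lia. Qed.

Lemma inp_addP x (i : nat) : mv MoveL (fun z => inp (maux M) x (z + i.+1%:Z)%R)
  = (fun z => inp (maux M) x (z + i%:Z)%R).
Proof. by apply/funext => z; rewrite /mv /=; congr inp; lia. Qed.

Lemma inp_at0 x : (fun z => inp (maux M) x (z + 0%:Z)%R) = inp (maux M) x.
Proof. by apply/funext => z; rewrite addr0. Qed.

Lemma inp_nth x (i : nat) :
  inp (maux M) x i = if i < size x then Some (inl (nth false x i)) else None.
Proof.
rewrite /inp; case: ltnP => h; first by rewrite (nth_map false).
by rewrite nth_default // size_map.
Qed.

Lemma runsB_right a b x (s : st) : a != b -> it s = inp _ x -> rg s b = 0 ->
  runsB (loopc a [:: InR; Inc b]) s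
    (St (fun r => if r == a then 0 else if r == b then rg s a else rg s r)
        (fun z => inp _ x (z + (rg s a)%:Z)%R) (wt s)) (rg s a * 5 + 1).
Proof.
move=> ab sx b0; set k := rg s a.
pose S i := St (fun r => if r == a then k - i else if r == b then i else rg s r)
   (fun z => inp _ x (z + i%:Z)%R) (wt s).
have := @runsB_loop M a [:: InR; Inc b] k S 2.
have -> : S 0 = s.
  by rewrite /S subn0 inp_at0 -sx; st_eq.
have -> : S k = St (fun r => if r == a then 0 else if r == b then k else rg s r)
   (fun z => inp _ x (z + k%:Z)%R) (wt s) by rewrite /S subnn.
apply=> [i _|i li]; first by rewrite /= eqxx.
apply: (@runsB_cat M [:: InR] [:: Inc b] _ _ _ 1 1).
  by apply: runsB_instr.
apply: runsB_eq (runsB_inc _ _ _) => //=.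
by rewrite inp_addS; st_eq.
Qed.

Lemma runsB_left a x k (s : st) : it s = (fun z => inp _ x (z + k%:Z)%R) ->
  rg s a = k ->
  runsB (loopc a [:: InL]) s
    (St (fun r => if r == a then 0 else rg s r) (inp _ x) (wt s)) (k * 4 + 1).
Proof.
move=> sx ak.
pose S i := St (fun r => if r == a then k - i else rg s r)
   (fun z => inp (maux M) x (z + (k - i)%:Z)%R) (wt s).
have := @runsB_loop M a [:: InL] k S 1.
have -> : S 0 = s by rewrite /S subn0 -sx; st_eq.
have -> : S k = St (fun r => if r == a then 0 else rg s r) (inp _ x) (wt s).
  by rewrite /S subnn inp_at0.
apply=> [i _|i li]; first by rewrite /= eqxx.
have -> : S i.+1 = exec_st InL (setr (S i) a (k - i.+1)).
  by rewrite /S /= (_ : k - i = (k - i.+1).+1) ?inp_addP; [st_eq|lia].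
by apply: runsB_instr.
Qed.

Lemma Comp_inbit a : Comp a -> Comp (fun x e => nth false x (a x e)).
Proof.
move=> [pa ca]; split=> [|loc t ht].
  by apply: (PB_le (PB_const 1)) => x e; case: nth.
have [C [T [pT hC]]] := ca loc t ht.
exists (C ++ loopc t [:: InR; Inc t.+1] ++ ifin (Some true) [:: Inc t] ++
   loopc t.+1 [:: InL]).
exists (fun x e => T x e + ((a x e * 5 + 1) + (2 + (a x e * 4 + 1)))); split.
  apply: PB_add pT (PB_add (PB_add _ _) (PB_add _ (PB_add _ _)));
  by [exact: PB_const | exact: PB_mul pa (PB_const _)].
move=> x s sx z e; apply: runsB_cat (hC x s sx z) _; rewrite -/e.
set k := a x e.
apply: (runsB_cat (s2 := St (fun r => if r == t then 0 else if r == t.+1 then k else rg s r)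
   (fun u => inp _ x (u + k%:Z)%R) (wt s))).
  have h := @runsB_right t t.+1 x (setr s t k).
  apply: runsB_le (runsB_eq _ (h _ _ _)) => //=.
  - by rewrite eqxx.
  - by rewrite eqxx; st_eq.
  - by apply/eqP; lia.
  - by rewrite gtn_eqF // z // leqnSn.
have kx : inp (maux M) x (0 + k%:Z)%R == Some (inl true) = nth false x k.
  rewrite add0r inp_nth; case: ltnP => h; first by apply/eqP/idP => [[]|->].
  by rewrite nth_default.
apply: (runsB_cat (s2 := St (fun r => if r == t then (nth false x k : nat) else if r == t.+1 then k else rg s r)
   (fun u => inp _ x (u + k%:Z)%R) (wt s))).
  apply: (@runsB_ifin _ _ _ _ _ 1); rewrite /= kx.
    move=> ->; apply: runsB_eq (runsB_inc _ _ _) => //=.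
    by rewrite eqxx; st_eq.
  by move=> /negbTE ->.
apply: runsB_eq (@runsB_left t.+1 x k _ _ _) => //=; last first.
  by rewrite eqxx gtn_eqF.
by st_eq; rewrite z //; lia.
Qed.

Lemma step_in pre C post j (s : st) : j < size C ->
  stepG (pre ++ C ++ post) (size pre + j, s) =
  (minn (size pre + (size C + size post)) (exec_pc (nth InR C j) (size pre + j) s),
   exec_st (nth InR C j) s).
Proof.
move=> jC; rewrite /stepG /= !size_cat ltn_add2l ltn_addr //.
by rewrite nth_cat ltnNge leq_addr /= addKn nth_cat jC.
Qed.

Lemma Comp_size : Comp (fun x _ => size x).
Proof.
split=> [|loc t ht]; first exact: PB_size.
(* Register [t.+1] is 0, so that [Jz t.+1 5] is an unconditional exit from the search for the first
   blank; [t.+2] records the way back. *)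
pose C := [:: Jin None 2; Jz t.+1 5; InR; Inc t; Inc t.+2; Jb 5].
exists (C ++ loopc t.+2 [:: InL]).
exists (fun x _ => (size x * 5 + 2) + (size x * 4 + 1)); split.
  by apply: PB_add; apply: PB_add (PB_mul PB_size (PB_const _)) (PB_const _).
move=> x s sx z e.
pose S i := St (fun r => if r == t then i else if r == t.+2 then i else rg s r)
  (fun z => inp (maux M) x (z + i%:Z)%R) (wt s).
apply: (runsB_cat (s2 := S (size x))); last first.
  apply: runsB_eq (@runsB_left t.+2 x (size x) _ _ _) => //=; last first.
    by rewrite eqxx gtn_eqF // ltnW.
  by st_eq; rewrite z //; lia.
exists (size x * 5 + 2) => // pre post.
have S0 : S 0 = s by rewrite /S inp_at0 -sx; st_eq; rewrite z //; lia.
have it0 i : it (S i) 0 = if i < size x then Some (inl (nth false x i)) else None.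
  by rewrite -inp_nth /S /it add0r.
pose G := @stepG M (pre ++ C ++ post).
have G0 i : G (size pre, S i) = (size pre + (if i < size x then 2 else 1), S i).
  rewrite -[X in G (X, _)]addn0 /G step_in //.
  rewrite -[exec_pc _ _ _]/(if it (S i) 0 == None then (size pre + 0).+1
    else size pre + 0 + 2) it0.
  rewrite -[size C]/6; case: (i < size x); congr pair; rewrite /=; lia.
have G1 : G (size pre + 1, S (size x)) = (size pre + 6, S (size x)).
  have r1 : rg (S (size x)) t.+1 = 0 by rewrite /= gtn_eqF // ltn_eqF // z.
  rewrite /G step_in // -[exec_pc _ _ _]/(if rg (S (size x)) t.+1 == 0
    then size pre + 1 + 5 else (size pre + 1).+1) r1 -[size C]/6.
  by congr pair; rewrite /=; lia.
have Gj j s' : 1 < j < 5 -> G (size pre + j, s') =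
    (size pre + j.+1, exec_st (nth InR C j) s').
  move=> /andP[j1 j5]; rewrite /G step_in; last exact: ltnW.
  by case: j j1 j5 => [|[|[|[|[|]]]]] // _ _; rewrite -[size C]/6; congr pair;
     rewrite /=; lia.
have G5 s' : G (size pre + 5, s') = (size pre, s').
  by rewrite /G step_in // -[size C]/6; congr pair; rewrite /=; lia.
have GA i : i < size x -> iter 5 G (size pre, S i) = (size pre, S i.+1).
  move=> ix; do 4 rewrite iterSr; rewrite G0 ix !Gj //= G5; congr pair.
  by rewrite /S inp_addS; clear; st_eq.
have GB i : i <= size x -> iter (i * 5) G (size pre, s) = (size pre, S i).
  elim: i => [|i IH] ix; first by rewrite -S0.
  by rewrite mulSn iterD IH ?GA // ltnW.
by rewrite -/G addnC iterD GB // iterSr G0 ltnn /= G1.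
Qed.

End Comp.

Section Arith.
Variable M : TM.
Notation Comp := (@Comp M).
Implicit Types (a b n : fn) (c d : seq bool -> seq nat -> bool).

Lemma Comp_weak f : Comp f -> Comp (fun x e => f x (behead e)).
Proof.
move=> [pf cf]; split=> [|loc t ht]; first exact: PB_weak.
have ht' : all (fun r => r < t) (behead loc).
  by apply/allP => r /mem_behead /(allP ht).
have [C [T [pT hC]]] := cf _ t ht'.
exists C, (fun x e => T x (behead e)); split; first exact: PB_weak.
by move=> x s sx z /=; rewrite -?map_behead ?behead_map; apply: hC.
Qed.

Lemma Comp_weak2 f : Comp f -> Comp (fun x e => f x (behead (behead e))).
Proof. by move=> /Comp_weak/Comp_weak. Qed.

Lemma Comp_var1 i : Comp (fun _ e => nth 0 (behead e) i).
Proof. exact: (Comp_weak (Comp_var _ _)). Qed.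

Lemma Comp_var2 i : Comp (fun _ e => nth 0 (behead (behead e)) i).
Proof. exact: (Comp_weak (Comp_var1 _)). Qed.

Lemma Comp_const (k : nat) : Comp (fun _ _ => k).
Proof. by elim: k => [|k IH]; [exact: Comp_zero|exact: (Comp_succ IH)]. Qed.

Lemma Comp_iteri n a (G : seq bool -> seq nat -> nat -> nat -> nat) (B : fn) :
  Comp n -> Comp a ->
  Comp (fun x e => G x (behead (behead e)) (nth 0 e 1) (nth 0 e 0)) -> PB B ->
  (forall x e i, i <= n x e -> iteri i (G x e) (a x e) <= B x e) ->
  Comp (fun x e => iteri (n x e) (G x e) (a x e)).
Proof. by move=> hn ha hG pB hB; apply: (Comp_rec hn ha hG pB). Qed.

Lemma Comp_add a b : Comp a -> Comp b -> Comp (fun x e => a x e + b x e).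
Proof.
move=> ha hb.
have E x e i : iteri i (fun _ acc => acc.+1) (a x e) = a x e + i.
  by elim: i => [|i /= ->]; rewrite ?addn0 ?addnS.
apply: (eq_Comp (f := fun x e => iteri (b x e) (fun _ acc => acc.+1) (a x e))).
  by move=> x e; rewrite E.
apply: (Comp_iteri (G := fun _ _ _ acc => acc.+1)
  (B := fun x e => a x e + b x e)) => //.
- exact: Comp_succ (Comp_var _ _).
- exact: PB_add (Comp_PB ha) (Comp_PB hb).
- by move=> x e i li; rewrite E leq_add2l.
Qed.

Lemma Comp_mul a b : Comp a -> Comp b -> Comp (fun x e => a x e * b x e).
Proof.
move=> ha hb.
have E x e i : iteri i (fun _ acc => acc + a x e) 0 = a x e * i.
  by elim: i => [|i /= ->]; rewrite ?muln0 ?mulnS // addnC.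
apply: (eq_Comp (f := fun x e => iteri (b x e) (fun _ acc => acc + a x e) 0)).
  by move=> x e; rewrite E.
apply: (Comp_iteri (G := fun x e _ acc => acc + a x e) (a := fun _ _ => 0)
  (B := fun x e => a x e * b x e)) => //.
- exact: Comp_zero.
- exact: Comp_add (Comp_var _ _) (Comp_weak2 ha).
- exact: PB_mul (Comp_PB ha) (Comp_PB hb).
- by move=> x e i li; rewrite E leq_mul2l li orbT.
Qed.

Lemma Comp_pred a : Comp a -> Comp (fun x e => (a x e).-1).
Proof.
move=> ha; apply: (eq_Comp (f := fun x e => iteri (a x e) (fun j _ => j) 0)).
  by move=> x e; case: (a x e).
apply: (Comp_iteri (G := fun _ _ j _ => j) (a := fun _ _ => 0)
  (B := a)) => //.
- exact: Comp_zero.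
- exact: Comp_var.
- exact: Comp_PB ha.
- by move=> x e [|i] //= /ltnW.
Qed.

Lemma Comp_sub a b : Comp a -> Comp b -> Comp (fun x e => a x e - b x e).
Proof.
move=> ha hb.
have E x e i : iteri i (fun _ acc => acc.-1) (a x e) = a x e - i.
  by elim: i => [|i /= ->]; rewrite ?subn0 ?subnS.
apply: (eq_Comp (f := fun x e => iteri (b x e) (fun _ acc => acc.-1) (a x e))).
  by move=> x e; rewrite E.
apply: (Comp_iteri (G := fun _ _ _ acc => acc.-1) (B := a)) => //.
- exact: Comp_pred (Comp_var _ _).
- exact: Comp_PB ha.
- by move=> x e i li; rewrite E leq_subr.
Qed.

Lemma Comp_if c a b : Comp (fun x e => c x e) -> Comp a -> Comp b ->
  Comp (fun x e => if c x e then a x e else b x e).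
Proof.
move=> hc ha hb; apply: (eq_Comp (f := fun x e =>
   iteri (c x e) (fun _ _ => a x e) (b x e))); first by move=> x e; case: (c x e).
apply: (Comp_iteri (G := fun x e _ _ => a x e)
  (B := fun x e => a x e + b x e)) => //.
- exact: Comp_weak2.
- exact: PB_add (Comp_PB ha) (Comp_PB hb).
- by move=> x e [|i] _ /=; [apply: leq_addl|apply: leq_addr].
Qed.

Lemma Comp_eq0 a : Comp a -> Comp (fun x e => a x e == 0).
Proof.
move=> ha; apply: (eq_Comp (f := fun x e => iteri (a x e) (fun _ _ => 0) 1)).
  by move=> x e; case: (a x e).
apply: (Comp_iteri (G := fun _ _ _ _ => 0) (a := fun _ _ => 1)
   (B := fun _ _ => 1)) => //; try exact: Comp_const.
- exact: PB_const.
- by move=> x e [].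
Qed.

Lemma Comp_leq a b : Comp a -> Comp b -> Comp (fun x e => a x e <= b x e).
Proof. by move=> ha hb; apply: Comp_eq0; apply: Comp_sub. Qed.

Lemma Comp_and c d : Comp (fun x e => c x e) -> Comp (fun x e => d x e) ->
  Comp (fun x e => c x e && d x e).
Proof.
move=> hc hd; apply: eq_Comp (Comp_mul hc hd) => x e.
by case: (c x e); case: (d x e).
Qed.

Lemma Comp_not c : Comp (fun x e => c x e) -> Comp (fun x e => ~~ c x e).
Proof. by move=> hc; apply: eq_Comp (Comp_eq0 hc) => x e; case: (c x e). Qed.

Lemma Comp_or c d : Comp (fun x e => c x e) -> Comp (fun x e => d x e) ->
  Comp (fun x e => c x e || d x e).
Proof.
move=> hc hd; apply: eq_Comp (Comp_not (Comp_and (Comp_not hc) (Comp_not hd))).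
by move=> x e; case: (c x e); case: (d x e).
Qed.

Lemma Comp_imp c d : Comp (fun x e => c x e) -> Comp (fun x e => d x e) ->
  Comp (fun x e => c x e ==> d x e).
Proof.
move=> hc hd; apply: eq_Comp (Comp_or (Comp_not hc) hd).
by move=> x e; case: (c x e).
Qed.

Lemma Comp_eqn a b : Comp a -> Comp b -> Comp (fun x e => a x e == b x e).
Proof.
move=> ha hb; apply: eq_Comp (Comp_and (Comp_leq ha hb) (Comp_leq hb ha)) => x e.
by rewrite eqn_leq.
Qed.

Lemma Comp_minn a b : Comp a -> Comp b -> Comp (fun x e => minn (a x e) (b x e)).
Proof.
move=> ha hb; apply: eq_Comp (Comp_if (Comp_leq (Comp_succ ha) hb) ha hb) => x e.
by rewrite /minn; case: ifP.
Qed.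

Lemma Comp_sum n (F : seq bool -> seq nat -> nat -> nat) : Comp n ->
  Comp (fun x e => F x (behead e) (nth 0 e 0)) ->
  Comp (fun x e => \sum_(i < n x e) F x e i).
Proof.
move=> hn hF.
have E x e i : iteri i (fun j acc => acc + F x e j) 0 = \sum_(j < i) F x e j.
  by elim: i => [|i /= ->]; rewrite ?big_ord0 ?big_ord_recr.
apply: (eq_Comp (f := fun x e => iteri (n x e) (fun j acc => acc + F x e j) 0)).
  by move=> x e; rewrite E.
have [c hc] := Comp_PB hF.
apply: (Comp_iteri (G := fun x e j acc => acc + F x e j) (a := fun _ _ => 0)
  (B := fun x e => n x e * (n x e + sz x e) ^ c)) => //.
- exact: Comp_zero.
- apply: Comp_add (Comp_var _ _) _.
  have := Comp_weak hF; apply: eq_Comp => x e.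
  by rewrite nth_behead.
- exact: PB_mul (Comp_PB hn) (PB_exp _ (PB_add (Comp_PB hn) PB_sz)).
- move=> x e i li; rewrite E.
  apply: (@leq_trans (\sum_(j < i) (n x e + sz x e) ^ c)); last first.
    by rewrite sum_nat_const card_ord leq_mul2r li orbT.
  apply: leq_sum => j _; apply: leq_trans (hc x (val j :: e)) _.
  case: c {hc} => // c; rewrite leq_exp2r // sz_cons leq_add2r.
  by apply: leq_trans (ltnW (ltn_ord j)) li.
Qed.

Lemma Comp_div a b : Comp a -> Comp b -> Comp (fun x e => a x e %/ b x e).
Proof.
move=> ha hb; apply: (eq_Comp (f := fun x e => if b x e == 0 then 0 else
   \sum_(i < a x e) (i.+1 * b x e <= a x e))).
  move=> x e; case: (b x e) => [|b'] /=; first by rewrite divn0.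
  set m := a x e; have dm : m %/ b'.+1 <= m by apply: leq_div.
  have E i : i <= m -> \sum_(j < i) (j.+1 * b'.+1 <= m) = minn i (m %/ b'.+1).
    elim: i => [|i IH] li; first by rewrite big_ord0 min0n.
    rewrite big_ord_recr /= IH; last exact: ltnW.
    by rewrite -leq_divRL //; lia.
  by rewrite E //; apply/minn_idPr.
apply: Comp_if (Comp_eq0 hb) (Comp_const 0) _.
apply: (Comp_sum (F := fun x e i => i.+1 * b x e <= a x e)) => //.
apply: Comp_leq _ (Comp_weak ha).
exact: Comp_mul (Comp_succ (Comp_var _ _)) (Comp_weak hb).
Qed.

Lemma Comp_mod a b : Comp a -> Comp b -> Comp (fun x e => a x e %% b x e).
Proof.
move=> ha hb; apply: eq_Comp (Comp_sub ha (Comp_mul (Comp_div ha hb) hb)) => x e.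
by rewrite {1}(divn_eq (a x e) (b x e)) addKn.
Qed.

Lemma Comp_table (f : nat -> nat) k a : Comp a ->
  Comp (fun x e => if a x e < k then f (a x e) else 0).
Proof.
move=> ha; elim: k => [|k IH]; first exact: Comp_const.
apply: eq_Comp (Comp_if (Comp_eqn ha (Comp_const k)) (Comp_const (f k)) IH) => x e.
by case: eqP => [->|nk]; rewrite ?ltnSn // ltnS [in RHS]leq_eqVlt (introF eqP nk).
Qed.

(** With a positive base, a power that has reached the cap stays there, so capping after every
    multiplication is harmless. In this form powers, which have no polynomial bound, become
    computable. *)
Lemma iter_minn_expn (b B i : nat) : iter i (fun y => minn (y * b) B) (minn 1 B) = minn (b ^ i) B.
Proof.
elim: i => [|i IH] //=; rewrite {}IH expnSr.
have [//|/ltnW le] := leqP (b ^ i) B.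
case: b le => [|b] le; first by rewrite !muln0.
have -> : minn (B * b.+1) B = B by apply/minn_idPr; rewrite leq_pmulr.
by apply/esym/minn_idPr; apply: leq_trans le _; rewrite leq_pmulr.
Qed.

Lemma Comp_minexp a b n : Comp a -> Comp b -> Comp n ->
  Comp (fun x e => minn (a x e ^ b x e) (n x e)).
Proof.
move=> ha hb hn; apply: (eq_Comp (f := fun x e => iteri (b x e)
   (fun _ y => minn (y * a x e) (n x e)) (minn 1 (n x e)))).
  move=> x e; rewrite -iter_minn_expn; elim: (b x e) => //= k ->; by [].
apply: (Comp_iteri (G := fun x e _ y => minn (y * a x e) (n x e)) (B := n)
   (a := fun x e => minn 1 (n x e))) => //.
- exact: Comp_minn (Comp_const 1) hn.
- apply: Comp_minn _ (Comp_weak2 hn).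
  exact: Comp_mul (Comp_var _ _) (Comp_weak2 ha).
- exact: Comp_PB hn.
- by move=> x e [|i] _ /=; apply: geq_minr.
Qed.

Lemma Comp_minfact a n : Comp a -> Comp n ->
  Comp (fun x e => minn (a x e)`! (n x e)).
Proof.
move=> ha hn; apply: (eq_Comp (f := fun x e => iteri (a x e)
   (fun j y => minn (y * j.+1) (n x e)) (minn 1 (n x e)))).
  move=> x e; elim: (a x e) => //= k ->; rewrite factS [k.+1 * _]mulnC.
  set N := n x e; have [//|/ltnW le] := leqP (k`!) N.
  have -> : minn (N * k.+1) N = N by apply/minn_idPr; rewrite leq_pmulr.
  by apply/esym/minn_idPr; apply: leq_trans le _; rewrite leq_pmulr.
apply: (Comp_iteri (G := fun x e j y => minn (y * j.+1) (n x e)) (B := n)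
   (a := fun x e => minn 1 (n x e))) => //.
- exact: Comp_minn (Comp_const 1) hn.
- apply: Comp_minn _ (Comp_weak2 hn).
  exact: Comp_mul (Comp_var _ _) (Comp_succ (Comp_var _ _)).
- exact: Comp_PB hn.
- by move=> x e [|i] _ /=; apply: geq_minr.
Qed.

Lemma Comp_expc a k : Comp a -> Comp (fun x e => a x e ^ k).
Proof.
move=> ha; elim: k => [|k IH]; first exact: Comp_const.
by apply: eq_Comp (Comp_mul ha IH) => x e; rewrite expnS.
Qed.

End Arith.

Ltac comp1 := first
  [ assumption | exact: Comp_var | exact: Comp_var1 | exact: Comp_var2
  | exact: Comp_const | exact: Comp_size
  | match goal with H : Comp _ ?a |- _ =>
      first [exact: (Comp_weak H) | exact: (Comp_weak2 H)
            | exact: (Comp_weak (Comp_weak2 H)) | exact: (Comp_weak2 (Comp_weak2 H)) ] end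
  | apply: Comp_and | apply: Comp_or | apply: Comp_not | apply: Comp_imp
  | apply: Comp_eqn | apply: Comp_leq
  | apply: Comp_add | apply: Comp_mul | apply: Comp_sub | apply: Comp_div
  | apply: Comp_mod | apply: Comp_succ | apply: Comp_pred | apply: Comp_if
  | apply: Comp_minexp | apply: Comp_minn | apply: Comp_expc ].
Ltac comp := repeat comp1.

(** * Monotone formulas as power domination instances *)

(* The nodes of the [W]-ary tree are numbered in breadth-first order, as in a
   heap: the root is 0, and [up 0 = 0]. *)
Definition child (W a c : nat) := (a * W + c).+1.
Definition up (W a : nat) := a.-1 %/ W.
Definition ci (W a : nat) := a.-1 %% W.

Lemma upK W a c : c < W -> up W (child W a c) = a.
Proof. by move=> cW; rewrite /up /= divnMDl ?divn_small ?addn0 //; lia. Qed.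

Lemma ciK W a c : c < W -> ci W (child W a c) = c.
Proof. by move=> cW; rewrite /ci /= modnMDl modn_small. Qed.

Lemma childK W a : a != 0 -> child W (up W a) (ci W a) = a.
Proof. by case: a => // a _; rewrite /child /up /ci /= -divn_eq. Qed.

Lemma up_lt W a : a != 0 -> up W a < a.
Proof. by case: a => // a _; rewrite /up /= ltnS leq_div. Qed.

Lemma up0 W : up W 0 = 0. Proof. exact: div0n. Qed.

Section Graph.
Variables (W Z R I : nat) (act : nat -> nat -> bool)
  (mem : nat -> nat -> nat -> bool) (lab : nat -> nat).

(* The value of the formula whose gates are given by [act] and [mem], and whose
   leaf [a >= Z] is the input [lab a]: a node is true if one of its active gates
   has only true inputs. *)
Inductive ev (X : pred nat) : nat -> Prop :=
  | ev_leaf a : Z <= a -> X (lab a) -> ev X a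
  | ev_gate a g : a < Z -> g < W -> act a g ->
      (forall c, c < W -> mem a g c -> ev X (child W a c)) -> ev X a.

(* Node 0 is a hub, nodes 1, ..., [I] are the inputs, and node [enc r a i] is the
   [i]-th node attached to the tree node [a] in the [r]-th copy of the formula:
   the node that carries the value of [a] ([i = 0]), the relays that push the
   value of the parent of [a] down to [a] ([i = 1, 3]), a pendant node that
   prevents the flow from [a] to its relay ([i = 2]), and the gate [i - 4]. *)
Definition nM := Z * W + 1.
Definition nN := (I + R * nM * (W + 4)).+1.
Definition enc r a i := (I + ((r * nM + a) * (W + 4) + i)).+1.
Definition idx v := (v.-1 - I) %% (W + 4).
Definition adr v := ((v.-1 - I) %/ (W + 4)) %% nM.
Definition cp v := ((v.-1 - I) %/ (W + 4)) %/ nM.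

(** The hub is meant to be selected. It then dominates everything but the value nodes and, away from
    the root, the nodes of index 1 and 2; the root has no parent to reach these two from. *)
Definition hubadj v := (v <= I) || (2 < idx v) || (adr v == 0) && (0 < idx v).

(** A gate is dominated by the hub and adjacent to [a] and to its own inputs, so that it forces [a]
    once the inputs are reached: a conjunction. The gates of one node together form a
    disjunction. *)
Definition gateadj a g b :=
  [&& a < Z, act a g & (b == a) || [&& b != 0, up W b == a & mem a g (ci W b)]].

(** The nodes 3 and 1 of [a] form a path from the value of [up W a] to the value of [a]. It is
    passable downwards, as 3 is dominated by the hub; upwards, the value node of [a] has both 1 and
    the pendant 2 to reach and forces neither. *)
Definition cadj a i b j :=
  [|| [&& i == 1, j == 0, a != 0 & b == a],
      [&& i == 2, j == 0, a != 0 & b == a],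
      [&& i == 3, a != 0 & (j == 1) && (b == a) || (j == 0) && (b == up W a)]
    | [&& 3 < i, j == 0 & gateadj a (i - 4) b]].

Definition adj0 u v :=
  if u == 0 then (v != 0) && hubadj v else
  if u <= I then [&& I < v, idx v == 0, Z <= adr v & lab (adr v) == u.-1] else
  [&& I < v, cp u == cp v & cadj (adr u) (idx u) (adr v) (idx v)].

Definition adj u v := adj0 u v || adj0 v u.

Hypotheses (W0 : 0 < W) (Z0 : 0 < Z) (labI : forall a, Z <= a -> lab a < I).

Let M0 : 0 < nM. Proof. by rewrite /nM addn1. Qed.
Let W4 : 0 < W + 4. Proof. by rewrite addn4. Qed.

Lemma idx_enc r a i : i < W + 4 -> idx (enc r a i) = i.
Proof. by move=> h; rewrite /idx /= addKn modnMDl modn_small. Qed.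

Lemma adr_enc r a i : a < nM -> i < W + 4 -> adr (enc r a i) = a.
Proof.
move=> ha h; rewrite /adr /= addKn divnMDl // (divn_small h) addn0.
by rewrite modnMDl modn_small.
Qed.

Lemma cp_enc r a i : a < nM -> i < W + 4 -> cp (enc r a i) = r.
Proof.
move=> ha h; rewrite /cp /= addKn divnMDl // (divn_small h) addn0.
by rewrite divnMDl // divn_small // addn0.
Qed.

Lemma enc_gt r a i : I < enc r a i.
Proof. by rewrite ltnS leq_addr. Qed.

Lemma enc_lt r a i : r < R -> a < nM -> i < W + 4 -> enc r a i < nN.
Proof.
move=> hr ha hi; rewrite ltnS ltn_add2l.
have : (r * nM + a).+1 * (W + 4) <= R * nM * (W + 4).
  by rewrite leq_mul2r (leq_trans _ (_ : r.+1 * nM <= _)) ?orbT //;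
    rewrite ?leq_mul2r ?hr ?orbT // mulSn; lia.
by rewrite mulSn; lia.
Qed.

Lemma decE v : I < v -> v < nN ->
  [/\ v = enc (cp v) (adr v) (idx v), cp v < R, adr v < nM & idx v < W + 4].
Proof.
case: v => // v; rewrite ltnS => Iv; rewrite ltnS => vN.
rewrite /enc /cp /adr /idx /= -!divn_eq subnKC // !ltn_mod; split=> //.
by rewrite ltn_divLR // ltn_divLR //; lia.
Qed.

Lemma adj_sym : symmetric adj.
Proof. by move=> u v; rewrite /adj orbC. Qed.

Lemma adj_irr : irreflexive adj.
Proof.
move=> u; rewrite /adj orbb /adj0; case: eqP => [-> //|_].
case: leqP => // _; rewrite eqxx /cadj /gateadj.
by case: (idx u) => [|[|[|[|i]]]] //=; rewrite ?andbF.
Qed.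

Definition graph : rel 'I_nN := fun u v => adj u v.

Lemma graph_simple : simple_graph graph.
Proof.
by split; [move=> u v; apply: adj_sym | move=> u; apply: adj_irr].
Qed.

Lemma up_leM a : a < nM -> up W a < nM.
Proof.
move=> h; have [->|a0] := eqVneq a 0; first by rewrite up0.
exact: ltn_trans (up_lt W a0) h.
Qed.

Lemma child_ltM a c : a < Z -> c < W -> child W a c < nM.
Proof.
move=> aZ cW; rewrite /child /nM addn1 ltnS.
have : a.+1 * W <= Z * W by rewrite leq_mul2r aZ orbT.
by rewrite mulSn; lia.
Qed.

Section Closure.
Variables (X : pred nat) (touched : pred nat).
Hypothesis ev0 : ~ ev X 0.

(** Gates also push marks backwards, from their output to a last missing input. This does no harm
    because everything below a true node counts as marked. *)
Definition mk a := exists j, ev X (iter j (up W) a).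

Lemma mk_up a : mk (up W a) -> mk a.
Proof. by move=> [j h]; exists j.+1; rewrite iterSr. Qed.

Lemma mk_ev a : ev X a -> mk a. Proof. by exists 0. Qed.

Lemma mk_case a : mk a -> ~ mk (up W a) -> ev X a.
Proof.
move=> [[|j] h] nm //; case: nm; exists j; by rewrite iterSr in h.
Qed.

Lemma mk0 : ~ mk 0.
Proof.
move=> [j]; have -> : iter j (up W) 0 = 0 by elim: j => //= j ->; apply: up0.
exact: ev0.
Qed.

(** A copy that contains a selected node is given up and counts as marked entirely. In the other
    copies the nodes 1 and 2 of [a] wait for the parent of [a], even if [a] is true: this is what
    blocks the upward flow. *)
Definition unmarked v :=
  [/\ I < v, ~~ touched (cp v) &
   (idx v = 0 /\ ~ mk (adr v)) \/
   [/\ 0 < idx v < 3, adr v != 0 & ~ mk (up W (adr v))]].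

Lemma unmarked_enc r a i : a < nM -> i < W + 4 -> ~~ touched r ->
  (i = 0 /\ ~ mk a) \/ [/\ 0 < i < 3, a != 0 & ~ mk (up W a)] ->
  unmarked (enc r a i).
Proof.
by move=> ha hi hr h; split; rewrite ?enc_gt ?cp_enc ?idx_enc ?adr_enc.
Qed.

(** A marked node with an unmarked neighbour has a second one, and so forces nothing. The pairs are
    the same leaf in two copies for an input, the parent's value and node 1 for a relay 3, nodes 1
    and 2 for a value node, and the output with a missing input for a gate. *)
Lemma unmarked_twin v w : v < nN -> w < nN ->
  (forall r, exists r', [/\ r' != r, r' < R & ~~ touched r']) ->
  ~ unmarked v -> (0 < v <= I -> ~ X v.-1) -> adj v w -> unmarked w ->
  exists w', [/\ w' < nN, w' != w, adj v w' & unmarked w'].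
Proof.
move=> vN wN two uv vX avw uw; have [Iw tw cw] := uw.
have [Ew rw aw iw] := decE Iw wN.
move: (cp w) (adr w) (idx w) tw cw Ew rw aw iw => r b j tr cw Ew rR bM jW.
have Iw0 : w != 0 by rewrite Ew.
have Inw : (w <= I) = false by rewrite leqNgt Iw.
have idw : idx w = j by rewrite Ew idx_enc.
have adw : adr w = b by rewrite Ew adr_enc.
have cpw : cp w = r by rewrite Ew cp_enc.
have [v0|v0] := eqVneq v 0.
  move: avw; rewrite v0 /adj /adj0 eqxx Iw0 (negbTE Iw0) Inw ltn0 /= orbF.
  rewrite /hubadj Inw idw adw /=; case: cw => [[-> _]|[/andP[j0 j3] b0 _]].
    by rewrite andbF.
  by rewrite (negbTE b0) leqNgt j3.
have [vI|Iv] := leqP v I.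
  move: avw; rewrite /adj /adj0 (negbTE v0) (negbTE Iw0) Inw vI Iw [I < v]ltnNge vI.
  rewrite /= orbF idw adw => /and3P[/eqP j0 Zb /eqP lb].
  have [r' [rr' r'R tr']] := two r.
  have W40 : 0 < W + 4 by [].
  exists (enc r' b 0); split.
  - exact: enc_lt.
  - by apply: contra rr' => /eqP e; rewrite -(cp_enc r' bM W40) e cpw.
  - by rewrite /adj /adj0 ?(negbTE v0) ?vI enc_gt idx_enc // adr_enc // Zb lb !eqxx.
  - apply: unmarked_enc => //; left; split=> //.
    by case: cw => [[]|[]] //; rewrite j0.
have [Ev rv av iv] := decE Iv vN.
move: (cp v) (adr v) (idx v) Ev rv av iv => r1 a i Ev r1R aM iW.
have idv : idx v = i by rewrite Ev idx_enc.
have adv : adr v = a by rewrite Ev adr_enc.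
have cpv : cp v = r1 by rewrite Ev cp_enc.
have Inv : (v <= I) = false by rewrite leqNgt Iv.
move: avw; rewrite {1}/adj {1 2}/adj0 (negbTE v0) (negbTE Iw0) Inv Inw Iv Iw /=.
rewrite cpv cpw idv idw adv adw eq_sym -andb_orr => /andP[/eqP er].
move: Ev cpv => + _; rewrite -{r1 r1R}er => Ev.
have adjE b' j' : b' < nM -> j' < W + 4 -> cadj a i b' j' || cadj b' j' a i ->
    adj v (enc r b' j').
  move=> hb hj h; rewrite /adj /adj0 (negbTE v0) Inv enc_gt cp_enc // adr_enc //.
  rewrite idx_enc // idv adv Ev cp_enc // eqxx /= enc_gt.
  by rewrite [(enc r b' j') <= I]leqNgt enc_gt.
have new b' j' : b' < nM -> j' < W + 4 -> (b' != b) || (j' != j) ->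
    cadj a i b' j' || cadj b' j' a i ->
    (j' = 0 /\ ~ mk b') \/ [/\ 0 < j' < 3, b' != 0 & ~ mk (up W b')] ->
    exists w', [/\ w' < nN, w' != w, adj v w' & unmarked w'].
  move=> hb hj ne ad un; exists (enc r b' j'); split=> //.
  - exact: enc_lt.
  - apply: contraTN ne => /eqP e; rewrite negb_or !negbK.
    by rewrite -adw -e adr_enc // eqxx -idw -e idx_enc /=.
  - exact: adjE.
  - exact: unmarked_enc.
have umv : ~~ touched r -> (i = 0 /\ ~ mk a) \/ [/\ 0 < i < 3, a != 0 & ~ mk (up W a)] -> False.
  by move=> h1 h2; apply: uv; rewrite Ev; apply: unmarked_enc.
have {}umv := umv tr.
clear idw adw cpw idv adv adjE.
have W41 k : k < 4 -> k < W + 4 by move=> h; apply: leq_trans h (leq_addl _ _).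
case/orP.
- case/or4P => [/and4P[/eqP i1 /eqP j0 a0 /eqP ba]|/and4P[/eqP i1 /eqP j0 a0 /eqP ba]|
    /and3P[/eqP i3 a0 hj]|/and3P[i4 /eqP j0 /and3P[aZ aact hb]]].
  + case: umv; right; split=> //; first by rewrite i1.
    by case: cw => [[_ nb]|[]]; [rewrite -ba => /mk_up | rewrite j0].
  + case: umv; right; split=> //; first by rewrite i1.
    by case: cw => [[_ nb]|[]]; [rewrite -ba => /mk_up | rewrite j0].
  + case/orP: hj => /andP[/eqP j1 /eqP ba]; subst j b.
      case: cw => [[]|[_ _ nm]] //.
      apply: (new (up W a) 0); rewrite ?up_leM ?W41 //.
      - by apply/orP; right.
      - by rewrite /cadj i3 a0 !eqxx /= ?orbT.
      - by left.
    case: cw => [[_ nm]|[]] //.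
    apply: (new a 1); rewrite ?W41 //.
    - by apply/orP; right.
    - by rewrite /cadj i3 a0 !eqxx /= ?orbT.
    - by right.
  + subst j; case: cw => [[_ nb]|[]] //.
    (* Marks pass to children, so [a] is unmarked whether [w] is the output or an input of the gate.
       Then [a] is false, and some input of the gate is unmarked. *)
    have nma : ~ mk a.
      case/orP: hb => [/eqP <- //|/and3P[b0 /eqP <- _]].
      by move=> /mk_up.
    have [c [cW cm nc]] : exists c, [/\ c < W, mem a (i - 4) c & ~ mk (child W a c)].
      apply: contrapT => nex; apply: (nma); apply: mk_ev.
      apply: (@ev_gate _ a (i - 4)) => //; first by move: iW i4; lia.
      move=> c cW cm; apply: mk_case; rewrite ?upK //.
      by apply: contrapT => nc; apply: (nex); exists c.
    have [bE|nE] := eqVneq b a.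
      apply: (new (child W a c) 0); rewrite ?W41 // ?child_ltM //; last by left.
        by rewrite bE; apply/orP; left; apply/eqP; rewrite /child; nia.
      by rewrite /cadj i4 /gateadj aZ aact /= upK // ciK // eqxx cm !orbT.
    apply: (new a 0); rewrite ?W41 //; last by left.
      by rewrite eq_sym nE.
    by rewrite /cadj i4 /gateadj aZ aact /= eqxx !orbT.
- case/or4P => [/and4P[/eqP j1 /eqP i0 b0 /eqP ab]|/and4P[/eqP j1 /eqP i0 b0 /eqP ab]|
    /and3P[/eqP j3 b0 hj]|/and3P[j4 _ _]].
  + subst; case: cw => [[]|[_ _ nm]] //.
    apply: (new b 2); rewrite ?W41 //.
    - by apply/orP; right.
    - by rewrite /cadj b0 !eqxx /= ?orbT.
    - by right.
  + subst; case: cw => [[]|[_ _ nm]] //.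
    apply: (new b 1); rewrite ?W41 //.
    - by apply/orP; right.
    - by rewrite /cadj b0 !eqxx /= ?orbT.
    - by right.
  + by case: cw => [[]|[]] //; rewrite j3.
  + by case: cw => [[j0]|[/andP[_ j3]]]; move: j4; lia.
Qed.

End Closure.

Lemma adj_hub w : I < w -> adj 0 w = hubadj w.
Proof. by case: w => // w Iw; rewrite /adj /adj0 /= leqNgt Iw ?ltn0 ?orbF. Qed.

Lemma adj_in v w : 0 < v <= I -> I < w ->
  adj v w = [&& idx w == 0, Z <= adr w & lab (adr w) == v.-1].
Proof.
case: v w => // v [|w] // /= vI Iw.
by rewrite /adj /adj0 /= vI Iw [w < I]leqNgt Iw [I < v.+1]ltnNge vI /= orbF.
Qed.

Lemma adj_cp v w : I < v -> I < w -> adj v w =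
  (cp v == cp w) && (cadj (adr v) (idx v) (adr w) (idx w) ||
                     cadj (adr w) (idx w) (adr v) (idx v)).
Proof.
case: v w => // v [|w] // Iv Iw; rewrite /adj /adj0 /=.
by rewrite [v < I]leqNgt [w < I]leqNgt Iv Iw /= [cp w.+1 == _]eq_sym andb_orr.
Qed.

Lemma input_marked (X touched : pred nat) v w :
  0 < v <= I -> I < w -> X v.-1 -> adj v w -> ~ unmarked X touched w.
Proof.
move=> vI Iw Xv; rewrite adj_in // => /and3P[/eqP i0 Zw /eqP lw] [_ _].
case=> [[_]|[]]; last by rewrite i0.
by case; apply: mk_ev; apply: ev_leaf; rewrite ?lw.
Qed.

Lemma hub_marked (X touched : pred nat) w :
  I < w -> adj 0 w -> ~ unmarked X touched w.
Proof.
move=> Iw; rewrite adj_hub // /hubadj leqNgt Iw /= => h [_ _].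
case=> [[i0 _]|[i3 a0 _]]; move: h; first by rewrite i0 andbF.
by rewrite (negbTE a0); lia.
Qed.

(** If the root is false, the marked nodes contain what [S] dominates and are closed under
    propagation, yet they miss the root of an untouched copy. Two copies have to be untouched so
    that every leaf has a twin. *)
Theorem graph_sound (S : {set 'I_nN}) :
  power_dominates graph S -> #|S| + 2 <= R ->
  ev (fun y => inord y.+1 \in S) 0.
Proof.
move=> pdS SR; apply: contrapT => ev0; set X := (fun _ => _) in ev0.
pose tl := [seq cp (nat_of_ord v) | v <- enum S].
have two r : exists r', [/\ r' != r, r' < R & r' \notin tl].
  apply: contrapT => nex.
  suff : size (iota 0 R) <= size (r :: tl).
    rewrite size_iota /= size_map -cardE => h.
    by move: (leq_trans SR h); rewrite addn2 ltnn.
  apply: uniq_leq_size (iota_uniq _ _) _ => r'; rewrite mem_iota /= => r'R.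
  rewrite inE; apply: contrapT => /negP; rewrite negb_or => /andP[h1 h2].
  by apply: nex; exists r'.
pose um (v : nat) := unmarked X (fun r => r \in tl) v.
have umS (v : 'I_nN) : v \in S -> ~ um v.
  by move=> vS [_ /negP[]]; apply/mapP; exists v; rewrite ?mem_enum.
pose Q := [set v : 'I_nN | `[< ~ um v >]].
have XS (v : 'I_nN) : 0 < v <= I -> X v.-1 = (v \in S).
  by move=> /andP[v0 vI]; rewrite /X prednK // inord_val.
have ltE (v : 'I_nN) : v \in S -> I < v -> cp v \in tl.
  by move=> vS _; apply/mapP; exists v; rewrite ?mem_enum.
have sDQ : dominated graph S \subset Q.
  apply/subsetP => w; rewrite !inE => h; apply/asboolP => uw; have [Iw tw _] := uw.
  case/orP: h => [wS|/bigcupP[v vS]]; first exact: umS uw.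
  rewrite inE /graph => avw; have [v0|v0] := posnP v.
    by rewrite v0 in avw; apply: hub_marked uw.
  have [vI|Iv] := leqP v I.
    have hv : 0 < v <= I by rewrite v0.
    by apply: (input_marked hv _ _ avw uw); rewrite ?XS.
  move: avw; rewrite adj_cp // => /andP[/eqP ec _].
  by move: tw; rewrite -ec /=; apply/negP/negPn; apply: ltE.
have sQQ : propagate graph Q \subset Q.
  apply/subsetP => w; rewrite !inE => /orP[//|/exists_inP[v]].
  rewrite inE => /asboolP uv /eqP nvQ; apply/asboolP => uw.
  have : w \in neighbors graph v :\: Q by rewrite nvQ set11.
  rewrite !inE => /andP[_ avw]; have [Iw _ _] := uw.
  have [|w' [w'N nw' avw' uw']] :=
    unmarked_twin (ltn_ord v) (ltn_ord w) two uv _ avw uw.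
    by move=> hv Xv; apply: (input_marked hv Iw Xv avw uw).
  have : Ordinal w'N \in neighbors graph v :\: Q.
    by rewrite !inE /graph /= avw' andbT; apply/asboolP => /(_ uw').
  by rewrite nvQ inE => /eqP e; move: nw'; rewrite -e eqxx.
have : [set: 'I_nN] \subset Q.
  by rewrite -(eqP pdS); apply: power_dominated_min.
have [r [_ rR tr]] := two 0.
have rN : enc r 0 0 < nN by apply: enc_lt.
move=> /subsetP/(_ (Ordinal rN)); rewrite inE => /(_ isT).
rewrite inE => /asboolP; apply; apply: unmarked_enc => //.
by left; split=> //; apply: mk0.
Qed.

Section Complete.
Variables (X : pred nat).
Hypothesis ev0 : ev X 0.

Definition solution : {set 'I_nN} :=
  [set v : 'I_nN | (v == 0 :> nat) || (v <= I) && X v.-1].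

Let P := power_dominated graph solution.

Lemma dominated_power (V : finType) (e : rel V) S :
  dominated e S \subset power_dominated e S.
Proof.
rewrite /power_dominated; elim: #|V| => //= n IH.
by apply: subset_trans IH _; apply: subsetUl.
Qed.

Lemma power_closed (v w : 'I_nN) : v \in P -> graph v w ->
  (forall u : 'I_nN, graph v u -> u != w -> u \in P) -> w \in P.
Proof.
move=> vP vw h; apply: contraT => wP; case/negP: (wP); rewrite /P -power_dominatedP -/P.
rewrite !inE; apply/orP; right; apply/exists_inP; exists v => //.
apply/eqP/setP => u; rewrite !inE; have [->|nu] := eqVneq u w.
  by rewrite wP.
by apply/andP => -[uP /h]; rewrite nu (negbTE uP) => /(_ isT).
Qed.

Lemma hub_in v (vN : v < nN) : v = 0 -> Ordinal vN \in P.
Proof.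
move=> v0; apply: (subsetP (dominated_power _ _)).
by rewrite !inE /= (introT eqP v0).
Qed.

Let nN0 : 0 < nN. Proof. by []. Qed.

Lemma hubadj_in (v : 'I_nN) : (v <= I) || hubadj v -> v \in P.
Proof.
move=> h; have [v0|v0] := eqVneq (v : nat) 0.
  by rewrite (_ : v = Ordinal nN0) ?hub_in //; apply/val_inj.
apply: (subsetP (dominated_power _ _)); rewrite !inE; apply/orP; right.
apply/bigcupP; exists (Ordinal nN0); first by rewrite inE.
rewrite inE /graph /adj /adj0 /= v0.
by case/orP: h => [vI|->] //; rewrite /hubadj vI.
Qed.

Definition inP r a i := forall N : enc r a i < nN, Ordinal N \in P.

Lemma inP_hub r a i : a < nM -> i < W + 4 -> 2 < i \/ a = 0 /\ 0 < i -> inP r a i.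
Proof.
move=> aM iW h N; apply: hubadj_in; rewrite /= /hubadj idx_enc // adr_enc //.
by case: h => [->|[-> ->]]; rewrite ?eqxx ?orbT.
Qed.

Let W41 k : k < 4 -> k < W + 4.
Proof. by move=> h; apply: leq_trans h (leq_addl _ _). Qed.

Lemma inP_force r a i b j : r < R -> a < nM -> i < W + 4 -> b < nM -> j < W + 4 ->
  inP r a i -> cadj a i b j || cadj b j a i ->
  (forall b' j', b' < nM -> j' <= 2 -> cadj a i b' j' || cadj b' j' a i ->
     (b', j') != (b, j) -> inP r b' j') ->
  inP r b j.
Proof.
move=> rR aM iW bM jW hv ad h N.
have aN := enc_lt rR aM iW.
apply: (power_closed (hv aN)).
  by rewrite /graph /= adj_cp ?enc_gt // !cp_enc // !adr_enc // !idx_enc // eqxx.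
move=> u gu nu; have [uI|Iu] := leqP u I; first by apply: hubadj_in; rewrite uI.
have [Eu ru au iu] := decE Iu (ltn_ord u).
have [i2|i2] := leqP (idx u) 2; last first.
  by apply: hubadj_in; rewrite /hubadj i2 !orbT.
move: gu; rewrite /graph /= adj_cp ?enc_gt // cp_enc // adr_enc // idx_enc //.
move=> /andP[/eqP er ac].
have N' : enc r (adr u) (idx u) < nN by apply: enc_lt.
have -> : u = Ordinal N' by apply/val_inj; rewrite /= er.
apply: h => //; apply: contra nu => /eqP[ea ei]; apply/eqP/val_inj.
by rewrite /= Eu -er ea ei.
Qed.

Lemma ev_inP a r : ev X a -> a < nM -> r < R -> inP r a 0.
Proof.
move=> h; elim: h => {a} [a Za Xa|a g aZ gW ag _ IH] aM rR.
  move=> N; apply: (subsetP (dominated_power _ _)); rewrite !inE.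
  apply/orP; right; apply/bigcupP.
  have lN : (lab a).+1 < nN by rewrite /nN ltnS ltn_addr // labI.
  exists (Ordinal lN); first by rewrite inE /= Xa andbT labI.
  rewrite inE /graph /= adj_in ?enc_gt ?idx_enc ?adr_enc ?Za ?eqxx //=.
  exact: labI.
have gW4 : g + 4 < W + 4 by rewrite ltn_add2r.
apply: (@inP_force r a (g + 4)) => //.
- by apply: inP_hub => //; left; rewrite addn4.
- rewrite /cadj /gateadj addnK aZ ag !eqxx /=; by rewrite addn4 !orbT.
move=> b j bM j2 ad ne; have {}ad : cadj a (g + 4) b j.
  by case/orP: ad => //; rewrite /cadj addn4 /= !andbF.
move: ad; rewrite /cadj addnK addn4 /= => /andP[/eqP j0].
rewrite /gateadj aZ ag /= => /orP[/eqP ba|/and3P[b0 /eqP ub bm]].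
  by move: ne; rewrite ba j0 eqxx.
rewrite j0; have := IH (ci W b); rewrite -ub childK // => /(_ _ _ bM rR); apply.
  by rewrite /ci ltn_mod.
by rewrite ub.
Qed.

(** The root is true, and from it the relays mark every tree node, true or false; each value node is
    then left with only its pendant node to force. *)
Lemma down_inP r a : r < R -> a < nM -> [/\ inP r a 0, inP r a 1 & inP r a 2].
Proof.
move=> rR; elim/ltn_ind: a => a IH aM; have [a0|a0] := eqVneq a 0.
  split; [|by apply: inP_hub; rewrite ?W41 //; right..].
  by rewrite a0; apply: ev_inP.
have [p0 _ _] := IH _ (up_lt W a0) (up_leM aM).
have s1 : inP r a 1.
  apply: (@inP_force r a 3); rewrite ?W41 //.
  - by apply: inP_hub; rewrite ?W41 //; left.
  - by rewrite /cadj a0 !eqxx /= ?orbT.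
  move=> b j bM j2; rewrite /cadj a0 /= !andbF /= !orbF.
  by case/orP => /andP[/eqP-> /eqP->] //; rewrite eqxx.
have p1 : inP r a 0.
  apply: (@inP_force r a 1); rewrite ?W41 //.
  - by rewrite /cadj a0 !eqxx /= ?orbT.
  move=> b j bM j2; rewrite /cadj a0 /= !andbF /= ?orbF.
  case/orP => [/andP[/eqP-> /eqP->]|]; first by rewrite eqxx.
  by case: j j2 => [|[|[|j]]] //=; rewrite ?andbF.
split=> //.
apply: (@inP_force r a 0); rewrite ?W41 //.
- by rewrite /cadj a0 !eqxx /= ?orbT.
move=> b j bM j2; rewrite /cadj /= ?andbF /= ?orbF.
case: j j2 => [|[|[|j]]] //= _; rewrite ?andbF ?orbF //.
- by move=> /andP[_ /eqP <-].
- by move=> /andP[_ /eqP <-]; rewrite eqxx.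
Qed.

Theorem graph_complete : power_dominates graph solution.
Proof.
rewrite /power_dominates -subTset; apply/subsetP => v _.
have [vI|Iv] := leqP v I; first by apply: hubadj_in; rewrite vI.
have [Ev rR aM iW] := decE Iv (ltn_ord v).
have N : enc (cp v) (adr v) (idx v) < nN by apply: enc_lt.
have -> : v = Ordinal N by apply/val_inj.
have [h0 h1 h2] := down_inP rR aM.
have [i2|i2] := leqP (idx v) 2; last by apply: inP_hub => //; left.
by case: (idx v) i2 N => [|[|[|i]]].
Qed.

End Complete.
End Graph.

(** * Positional notation *)

(** Points, tests, views and inputs are numbers whose digits are their components, so that the whole
    construction is arithmetic that programs can carry out. *)
Definition dig B x i := x %/ B ^ i %% B.
Definition num B n (d : nat -> nat) := \sum_(i < n) d i * B ^ i.

Lemma num_recr B n d : num B n.+1 d = num B n d + d n * B ^ n.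
Proof. by rewrite /num big_ord_recr. Qed.

Lemma num_lt B n d : (forall i, i < n -> d i < B) -> num B n d < B ^ n.
Proof.
elim: n => [|n IH] h; first by rewrite /num big_ord0.
rewrite num_recr expnS; have {}IH : num B n d < B ^ n.
  by apply: IH => i /ltnW; apply: h.
have : (d n).+1 * B ^ n <= B * B ^ n by rewrite leq_mul2r h ?orbT.
by rewrite mulSn; lia.
Qed.

Lemma dig_num B n d i : (forall i, i < n -> d i < B) -> i < n ->
  dig B (num B n d) i = d i.
Proof.
elim: n => // n IH h; rewrite ltnS => lin.
have hn : forall i, i < n -> d i < B by move=> j /ltnW; apply: h.
have B0 : 0 < B by apply: leq_ltn_trans (h n (ltnSn n)).
rewrite /dig num_recr; move: lin; rewrite leq_eqVlt => /orP[/eqP->|lin].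
  by rewrite addnC divnMDl ?expn_gt0 ?B0 // divn_small ?num_lt // addn0 modn_small ?h.
have -> : B ^ n = B ^ (n - i).-1 * B * B ^ i.
  by rewrite -expnSr -expnD prednK ?subn_gt0 // subnK // ltnW.
rewrite mulnA addnC divnMDl ?expn_gt0 ?B0 // mulnA modnMDl.
exact: IH.
Qed.

Lemma num_dig B x n : 0 < B -> num B n (dig B x) = x %% B ^ n.
Proof.
move=> B0; elim: n => [|n IH]; first by rewrite /num big_ord0 modn1.
rewrite num_recr IH /dig.
have E := divn_eq x (B ^ n); set a := x %/ B ^ n in E *; set r := x %% B ^ n in E *.
have lr : r < B ^ n by rewrite ltn_mod expn_gt0 B0.
have lm : a %% B < B by rewrite ltn_mod.
rewrite {1}E {2}(divn_eq a B) mulnDl -mulnA -expnS -addnA modnMDl [RHS]modn_small.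
  by rewrite addnC.
have : (a %% B).+1 * B ^ n <= B * B ^ n by rewrite leq_mul2r lm orbT.
by rewrite mulSn expnS; lia.
Qed.

Lemma num_digK B x n : 0 < B -> x < B ^ n -> num B n (dig B x) = x.
Proof. by move=> B0 lx; rewrite num_dig // modn_small. Qed.

Lemma eq_num B n d d' : (forall i, i < n -> d i = d' i) -> num B n d = num B n d'.
Proof. by move=> h; apply: eq_bigr => i _; rewrite h. Qed.

Lemma block_lt a b l t : l < a -> t < b -> l * b + t < a * b.
Proof.
move=> la tb; have : l.+1 * b <= a * b by rewrite leq_mul2r la orbT.
by rewrite mulSn; lia.
Qed.

Lemma count_iota (Y : pred nat) n : count Y (iota 0 n) = \sum_(x < n) Y x.
Proof.
elim: n => [|n IH]; first by rewrite big_ord0.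
rewrite big_ord_recr -IH [X in _ = X]/=.
by rewrite -[X in iota 0 X](addn1 n) iotaD count_cat /= addn0.
Qed.

Lemma count_block (Y : pred nat) a b :
  count Y (iota 0 (a * b)) =
  \sum_(x < a) count (fun v => Y (x * b + v)) (iota 0 b).
Proof.
elim: a => [|a IH]; first by rewrite big_ord0.
rewrite big_ord_recr /= mulSnr iotaD count_cat IH add0n; congr (_ + _).
by rewrite -{1}[a * b]addn0 iotaDl count_map.
Qed.

(** * Finite differences *)

Section Diff.
Variable A : comNzRingType.
Implicit Types u : nat -> A.
Local Open Scope ring_scope.

(** Degree less than [n] in the sense of finite differences, which needs no division in the ring. *)
Fixpoint deg_lt (n : nat) (u : nat -> A) : Prop :=
  if n is n'.+1 then deg_lt n' (fun t => u t.+1 - u t) else forall t, u t = 0.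

Lemma eq_deg_lt n u v : u =1 v -> deg_lt n u -> deg_lt n v.
Proof. by move=> /funext->. Qed.

Lemma deg_ltD n u v : deg_lt n u -> deg_lt n v -> deg_lt n (fun t => u t + v t).
Proof.
elim: n u v => [|n IH] u v /= hu hv; first by move=> t; rewrite hu hv addr0.
by apply: eq_deg_lt (IH _ _ hu hv) => t; rewrite opprD addrACA.
Qed.

Lemma deg_lt0 n : deg_lt n (fun=> 0).
Proof. by elim: n => //= n; apply: eq_deg_lt => t; rewrite subrr. Qed.

Lemma deg_ltS n u : deg_lt n u -> deg_lt n.+1 u.
Proof.
elim: n u => [|n IH] u; last exact: IH.
by move=> h t /=; rewrite !h subrr.
Qed.

Lemma deg_ltZ n c u : deg_lt n u -> deg_lt n (fun t => c * u t).
Proof.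
elim: n u => [|n IH] u /= h; first by move=> t; rewrite h mulr0.
by apply: eq_deg_lt (IH _ h) => t; rewrite mulrBr.
Qed.

(** Discrete Leibniz rule: the difference of [(a + b t) u(t)] is [(a + b t)] times that of [u], plus
    [b u(t + 1)]. *)
Lemma deg_lt_mul n a b u : deg_lt n u ->
  deg_lt n.+1 (fun t => (a + b * t%:R) * u t).
Proof.
elim: n u => [|n IH] u h.
  by apply: eq_deg_lt (deg_lt0 1) => t; rewrite h mulr0.
have h1 : deg_lt n.+1 (fun t => u t.+1).
  apply: eq_deg_lt (deg_ltD h (deg_ltS (h : deg_lt n _))) => t.
  by rewrite addrC subrK.
rewrite /=; apply: eq_deg_lt (deg_ltD (IH _ h) (deg_ltZ b h1)) => t.
by rewrite -natr1; ring.
Qed.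

Lemma deg_lt_sum I (r : seq I) n (F : I -> nat -> A) :
  (forall i, deg_lt n (F i)) -> deg_lt n (fun t => \sum_(i <- r) F i t).
Proof.
move=> h; elim: r => [|i r IH].
  by apply: eq_deg_lt (deg_lt0 n) => t; rewrite big_nil.
by apply: eq_deg_lt (deg_ltD (h i) IH) => t; rewrite big_cons.
Qed.

Lemma deg_lt_prod n (a b : nat -> A) :
  deg_lt n.+1 (fun t => \prod_(i < n) (a i + b i * t%:R)).
Proof.
elim: n => [|n IH].
  by move=> t; rewrite !big_ord0 subrr.
apply: eq_deg_lt (deg_lt_mul (a n) (b n) IH) => t.
by rewrite big_ord_recr /= mulrC.
Qed.

(** Up to sign, the [n]-th difference of [u] at 0. *)
Definition altsum n u := \sum_(t < n.+1) (-1) ^+ t * 'C(n, t)%:R * u t.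

Lemma altsumS n u : altsum n.+1 u = - altsum n (fun t => u t.+1 - u t).
Proof.
rewrite /altsum big_ord_recl /= expr0 bin0 !mul1r.
under eq_bigr => t _ do rewrite /bump /= add1n binS natrD mulrDr mulrDl.
rewrite big_split /= addrA.
have -> : u 0%N + \sum_(i < n.+1) (-1) ^+ i.+1 * 'C(n, i.+1)%:R * u i.+1 = altsum n u.
  rewrite big_ord_recr /= bin_small // mulr0 mul0r addr0 /altsum big_ord_recl.
  by rewrite /= expr0 bin0 !mul1r.
rewrite /altsum -sumrN -big_split /=; apply: eq_bigr => t _.
by rewrite exprS; ring.
Qed.

Lemma altsum0 n u : deg_lt n u -> altsum n u = 0.
Proof.
elim: n u => [|n IH] u h; first by rewrite /altsum big_ord_recl big_ord0 h mulr0 addr0.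
by rewrite altsumS IH ?oppr0.
Qed.

Lemma prod_eq0 n (f : 'I_n -> A) i : f i = 0 -> \prod_j f j = 0.
Proof. by move=> fi; rewrite (bigD1 i) //= fi mul0r. Qed.

Lemma sum_single n (f : 'I_n -> A) i : (forall j, j != i -> f j = 0) ->
  \sum_j f j = f i.
Proof. by move=> h; rewrite (bigD1 i) //= big1 ?addr0. Qed.

End Diff.

(** * Testing multilinear encodings over Z/q *)

Section Code.
Variable m : nat.

(* [q] need not be prime: only 1, ..., [m + 1] have to be invertible modulo [q]. *)
Definition q := (m.+1)`!.+1.
(** An (m+1)-st difference involves m + 2 consecutive points. *)
Definition D := m.+2.
Definition npt := q ^ m.

Definition pt x h t := num q m (fun i => (dig q x i + t * dig q h i) %% q).

(* A test consists of three lines of (Z/q)^m, given by a point and a direction; a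
   view of it assigns values to the first [D] points of each line. *)
Definition tx tau l := dig npt tau l.
Definition th tau l := dig npt tau (l + 3).
(** Atom [x * q + v] gives the value [v] to the point [x]. Digit [l * D + t] of the view [b] is the
    value at point number [t] of line [l]. *)
Definition tatom tau b j :=
  pt (tx tau (j %/ D)) (th tau (j %/ D)) (j %% D) * q + dig q b j.

(* The [m + 1]-st difference of [b] vanishes modulo [q], with its negative terms
   moved to the right-hand side. *)
Definition altchk (b : nat -> nat) :=
  \sum_(t < D) (if odd t then 0 else 'C(m.+1, t) * b t)
  == \sum_(t < D) (if odd t then 'C(m.+1, t) * b t else 0) %[mod q].

Definition isq x := all (fun i => dig q x i <= 1) (iota 0 m).
Definition ix x := num 2 m (dig q x).
Definition cpt v := num q m (dig 2 v).

Variable chk : nat -> nat -> nat -> nat -> nat -> nat -> bool.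

Definition valid tau b :=
  all (fun l => altchk (fun t => dig q b (l * D + t))) (iota 0 3) &&
  (all (fun l => isq (tx tau l)) (iota 0 3) ==>
   chk (ix (tx tau 0)) (ix (tx tau 1)) (ix (tx tau 2))
       (dig q b 0) (dig q b D) (dig q b (2 * D))).

Definition Sat := exists w : nat -> nat, (forall v, w v < q) /\
  forall v0 v1 v2, v0 < 2 ^ m -> v1 < 2 ^ m -> v2 < 2 ^ m ->
    chk v0 v1 v2 (w v0) (w v1) (w v2).

Definition NT := npt ^ 6.
Definition NB := q ^ (3 * D).
Definition NV := npt * q.

Definition Csat (Y : pred nat) := forall tau, tau < NT ->
  exists b, [/\ b < NB, valid tau b &
    forall j, j < 3 * D -> Y (tatom tau b j)].

Lemma q_gt1 : 1 < q. Proof. by rewrite /q ltnS fact_gt0. Qed.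
Lemma q_gt0 : 0 < q. Proof. by []. Qed.
Lemma npt_gt0 : 0 < npt. Proof. by rewrite expn_gt0 q_gt0. Qed.
Lemma NV_gt0 : 0 < NV. Proof. by rewrite muln_gt0 npt_gt0. Qed.
Hint Resolve q_gt0 npt_gt0 : core.

Lemma dig_lt B x i : 0 < B -> dig B x i < B.
Proof. by move=> B0; rewrite ltn_mod. Qed.

Lemma pt_lt x h t : pt x h t < npt.
Proof. by apply: num_lt => i _; rewrite ltn_mod. Qed.

Lemma dig_pt x h t i : i < m -> dig q (pt x h t) i = (dig q x i + t * dig q h i) %% q.
Proof. by move=> lim; rewrite dig_num // => j _; rewrite ltn_mod. Qed.

Lemma pt0 x h : x < npt -> pt x h 0 = x.
Proof.
move=> lx; rewrite -[RHS](@num_digK q x m) //; apply: eq_num => i _.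
by rewrite mul0n addn0 modn_small ?dig_lt.
Qed.

Lemma dig_inj x y : x < npt -> y < npt -> (forall i, i < m -> dig q x i = dig q y i) -> x = y.
Proof.
by move=> lx ly h; rewrite -(@num_digK q x m) // -(@num_digK q y m) //; apply: eq_num.
Qed.

Lemma coprime_q t : 0 < t <= m.+1 -> coprime t q.
Proof.
move=> lt; have /dvdnP[k e] : t %| (m.+1)`! by apply: dvdn_fact.
by rewrite /coprime /q -addn1 e gcdnMDl gcdn1.
Qed.

(** [t] is invertible modulo [q]. For fixed [t], each point is thus hit by at most one direction, as
    the union bound in [good_dir] requires. *)
Lemma pt_inj x h h' t : 0 < t <= m.+1 -> h < npt -> h' < npt ->
  pt x h t = pt x h' t -> h = h'.
Proof.
move=> lt lh lh' e; apply: dig_inj => // i lim.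
have : dig q (pt x h t) i = dig q (pt x h' t) i by rewrite e.
rewrite !dig_pt // => /eqP; rewrite eqn_modDl => {}e.
wlog le : h h' lh lh' e / dig q h i <= dig q h' i.
  move=> H; have [/H->//|/ltnW/H->//] := leqP (dig q h i) (dig q h' i).
  by rewrite eq_sym.
move: e; rewrite eq_sym eqn_mod_dvd ?leq_mul2l ?le ?orbT // -mulnBr.
rewrite Gauss_dvdr; last by rewrite coprime_sym coprime_q.
have [/eqP|pos /dvdn_leq] := posnP (dig q h' i - dig q h i).
  by rewrite subn_eq0 => le' _; apply/eqP; rewrite eqn_leq le le'.
by move=> /(_ pos); have := dig_lt h' i q_gt0; lia.
Qed.

Lemma altchkE b : altchk b =
  (b 0 + \sum_(t < m.+1) (if odd t.+1 then 0 else 'C(m.+1, t.+1) * b t.+1)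
   == \sum_(t < m.+1) (if odd t.+1 then 'C(m.+1, t.+1) * b t.+1 else 0) %[mod q]).
Proof.
have RE (F : nat -> nat) : \sum_(t < D) F t = F 0 + \sum_(t < m.+1) F t.+1.
  by rewrite [LHS]big_ord_recl; congr (_ + _); apply: eq_bigr => i _; rewrite lift0.
rewrite /altchk (RE (fun t => if odd t then 0 else 'C(m.+1, t) * b t)).
rewrite (RE (fun t => if odd t then 'C(m.+1, t) * b t else 0)).
by rewrite /= bin0 mul1n add0n.
Qed.

(** [b 0] has coefficient 1 in the difference, so the other points determine it modulo [q]. *)
Lemma altchk_inj b b' : (forall t, 0 < t < D -> b t = b' t) -> b 0 < q -> b' 0 < q ->
  altchk b -> altchk b' -> b 0 = b' 0.
Proof.
move=> e lb lb'; rewrite !altchkE.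
set S1 := \sum_(t < _) _; set S2 := \sum_(t < _) _.
set S1' := \sum_(t < _) _; set S2' := \sum_(t < _) _.
have -> : S1' = S1.
  by apply: eq_bigr => t _; rewrite e //= ltnS ltn_ord.
have -> : S2' = S2.
  by apply: eq_bigr => t _; rewrite e //= ltnS ltn_ord.
move=> /eqP h /eqP h'; have /eqP : b 0 + S1 = b' 0 + S1 %[mod q] by rewrite h h'.
by rewrite eqn_modDr => /eqP; rewrite !modn_small.
Qed.

Lemma altchkP (b : nat -> nat) : altchk b <->
  altsum m.+1 (fun t => (b t)%:R : 'Z_q)%R = 0%R.
Proof.
rewrite /altchk; set E := \sum_(t < _) _; set O := \sum_(t < _) _.
have -> : altsum m.+1 (fun t => (b t)%:R : 'Z_q)%R = (E%:R - O%:R)%R.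
  rewrite /E /O !natr_sum -sumrB /altsum; apply: eq_bigr => t _.
  rewrite -signr_odd; case: (odd t) => /=.
    by rewrite expr1 sub0r natrM mulN1r mulNr.
  by rewrite expr0 subr0 natrM mul1r.
have natE k l : (k == l %[mod q]) <-> (k%:R = l%:R :> 'Z_q)%R.
  split=> [/eqP h|/(congr1 val)]; last by rewrite /= !val_Zp_nat ?q_gt1 // => ->.
  by apply/val_inj; rewrite /= !val_Zp_nat ?q_gt1.
rewrite natE; split=> [->|/eqP]; first by rewrite subrr.
by rewrite subr_eq0 => /eqP.
Qed.

Lemma dig_cpt v i : i < m -> dig q (cpt v) i = dig 2 v i.
Proof.
by move=> lim; rewrite dig_num // => j _; apply: leq_trans (dig_lt _ _ _) q_gt1.
Qed.

Lemma cpt_lt v : cpt v < npt.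
Proof. by apply: num_lt => j _; apply: leq_trans (dig_lt _ _ _) q_gt1. Qed.

Lemma isq_cpt v : isq (cpt v).
Proof.
apply/allP => i; rewrite mem_iota /= => lim; rewrite dig_cpt //.
by rewrite -ltnS dig_lt.
Qed.

Lemma ix_cpt v : v < 2 ^ m -> ix (cpt v) = v.
Proof.
move=> lv; rewrite -[RHS](@num_digK 2 v m) //; apply: eq_num => i lim.
exact: dig_cpt.
Qed.

Lemma cpt_ix x : x < npt -> isq x -> cpt (ix x) = x.
Proof.
move=> lx /allP h; have h1 i : i < m -> dig q x i < 2.
  by move=> lim; rewrite ltnS h // mem_iota.
apply: dig_inj (cpt_lt _) lx _ => i lim; rewrite dig_cpt // dig_num //.
Qed.

Lemma ix_lt x : isq x -> ix x < 2 ^ m.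
Proof.
by move=> /allP h; apply: num_lt => i lim; rewrite ltnS h // mem_iota.
Qed.

(** The quotient is [npt / (m + 1)] rounded up, so that [K1] is at least [(1 + 1/(m+1)) npt]. *)
Definition K1 := npt + (npt + m) %/ m.+1.

Lemma K1_le : K1 <= NV.
Proof.
rewrite /K1 /NV; have q1 := q_gt1; have P0 := npt_gt0.
have : (npt + m) %/ m.+1 <= npt by rewrite -ltnS ltn_divLR // mulSn mulnS; lia.
by move: q1; nia.
Qed.

Section Soundness.
Variable Y : pred nat.
Hypotheses (Yok : Csat Y) (Ysmall : count Y (iota 0 NV) < K1).

Let cnt x := count (fun v => Y (x * q + v)) (iota 0 q).

Lemma test_exists (x h : nat -> nat) : (forall l, x l < npt) -> (forall l, h l < npt) ->
  exists tau, [/\ tau < NT, forall l, l < 3 -> tx tau l = x l &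
                  forall l, l < 3 -> th tau l = h l].
Proof.
move=> hx hh; exists (num npt 6 (fun l => if l < 3 then x l else h (l - 3))).
have H i : i < 6 -> (if i < 3 then x i else h (i - 3)) < npt by case: ifP.
split; first exact: num_lt.
  by move=> l l3; rewrite /tx dig_num ?l3 //; lia.
move=> l l3; rewrite /th dig_num //; last by lia.
by rewrite ltnNge leq_addl /= addnK.
Qed.

Lemma cnt_gt0 x : x < npt -> 0 < cnt x.
Proof.
move=> lx; have [tau [tN htx _]] := @test_exists (fun=> x) (fun=> 0) (fun=> lx) (fun=> npt_gt0).
have [b [_ _ /(_ 0 isT)]] := Yok tN.
rewrite /tatom div0n mod0n htx // pt0 // => hY.
rewrite /cnt -has_count; apply/hasP; exists (dig q b 0) => //.
by rewrite mem_iota dig_lt.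
Qed.

Let Bad := [set x : 'I_npt | 1 < cnt x].

(** Every point starts a line of some test, thus has an atom in [Y], and bad points have at least
    two: [npt + #|Bad|] is at most the number of atoms in [Y], which is below [K1]. *)
Lemma Bad_small : #|Bad| * m.+1 < npt.
Proof.
have : npt + #|Bad| <= count Y (iota 0 NV).
  rewrite /NV count_block.
  have -> : npt + #|Bad| = \sum_(x < npt) (1 + (1 < cnt x)).
    rewrite big_split /= sum1_card card_ord; congr (_ + _).
    rewrite -sum1_card big_mkcond; apply: eq_bigr => x _.
    by rewrite inE; case: (1 < cnt x).
  apply: leq_sum => x _; rewrite -/(cnt x).
  by have := cnt_gt0 (ltn_ord x); case: (ltnP 1 (cnt x)).
move/leq_ltn_trans => /(_ _ Ysmall); rewrite /K1 ltn_add2l => h.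
suff : (#|Bad|).+1 * m.+1 <= npt + m by rewrite mulSn; lia.
by rewrite -leq_divRL.
Qed.

(** Union bound: each of the [m + 1] positions [t] spoils at most [#|Bad|] directions, and
    [(m + 1) #|Bad| < npt]. *)
Lemma good_dir x : exists h, h < npt /\
  forall t, 0 < t <= m.+1 -> cnt (pt x h t) <= 1.
Proof.
apply: contrapT => nex.
pose g t (h : 'I_npt) : 'I_npt := Ordinal (pt_lt x h t).
have gI t : 0 < t <= m.+1 -> injective (g t).
  move=> lt h h' /(congr1 val) /= e; apply/val_inj.
  exact: pt_inj lt (ltn_ord h) (ltn_ord h') e.
have : npt <= \sum_(t < m.+1) #|g t.+1 @^-1: Bad|.
  rewrite -{1}[npt]card_ord -sum1_card.
  under [X in _ <= X]eq_bigr => t _ do rewrite -sum1_card big_mkcond /=.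
  rewrite exchange_big /=; apply: leq_sum => h _.
  have [t [lt ht]] : exists t, t < m.+1 /\ 1 < cnt (pt x h t.+1).
    apply: contrapT => nt; apply: nex; exists h; split=> // t /andP[t0 lt].
    rewrite leqNgt; apply/negP => ht; apply: nt; exists t.-1.
    by rewrite prednK.
  by rewrite (bigD1 (Ordinal lt)) //= !inE /= ht.
rewrite (eq_bigr (fun=> #|Bad|)); last first.
  by move=> t _; apply: card_preimset; apply: gI; rewrite /= ltnS -ltnS ltn_ord.
by rewrite sum_nat_const card_ord mulnC leqNgt Bad_small.
Qed.

Definition dir x := find (fun h => all (fun t => cnt (pt x h t.+1) <= 1) (iota 0 m.+1)) (iota 0 npt).

Lemma dirP x : dir x < npt /\ forall t, 0 < t <= m.+1 -> cnt (pt x (dir x) t) <= 1.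
Proof.
have [h [hN ht]] := good_dir x.
have hs : has (fun h => all (fun t => cnt (pt x h t.+1) <= 1) (iota 0 m.+1)) (iota 0 npt).
  apply/hasP; exists h; first by rewrite mem_iota.
  by apply/allP => t; rewrite mem_iota /= => lt; apply: ht.
have dN : dir x < npt by rewrite -[X in _ < X](size_iota 0) -has_find.
split=> // -[//|t] /= lt; have := nth_find 0 hs.
by rewrite -/(dir x) nth_iota // add0n => /allP; apply; rewrite mem_iota.
Qed.

Definition value x := find (fun v => Y (x * q + v)) (iota 0 q).

Lemma valueP x v : cnt x <= 1 -> v < q -> Y (x * q + v) -> v = value x.
Proof.
move=> c1 vq hv; pose p v := Y (x * q + v).
have hs : has p (iota 0 q) by apply/hasP; exists v; rewrite ?mem_iota.
have lv : value x < q by rewrite -[X in _ < X](size_iota 0) -has_find.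
have pv : p (value x) by have := nth_find 0 hs; rewrite nth_iota.
have : 1 >= size (filter p (iota 0 q)) by rewrite size_filter.
have : v \in filter p (iota 0 q) by rewrite mem_filter mem_iota /= vq andbT.
have : value x \in filter p (iota 0 q) by rewrite mem_filter mem_iota /= lv pv.
case: (filter p _) => [|a [|a' l]]; [by []| |by move=> _ _].
by rewrite !inE => /eqP-> /eqP->.
Qed.

Definition line x v t := if t is 0 then v else value (pt x (dir x) t).

(** The value that fits the unique values on the good line through [x]. A failed search returns [q],
    which the remainder turns into 0. *)
Definition decode x : nat :=
  find (fun v => altchk (line x v)) (iota 0 q) %% q.

Lemma eq_altchk b b' : (forall t, t < D -> b t = b' t) -> altchk b = altchk b'.
Proof.
move=> e; rewrite /altchk.
have -> : \sum_(t < D) (if odd t then 0 else 'C(m.+1, t) * b t) =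
          \sum_(t < D) (if odd t then 0 else 'C(m.+1, t) * b' t).
  by apply: eq_bigr => t _; rewrite e.
have -> // : \sum_(t < D) (if odd t then 'C(m.+1, t) * b t else 0) =
          \sum_(t < D) (if odd t then 'C(m.+1, t) * b' t else 0).
by apply: eq_bigr => t _; rewrite e.
Qed.

(** Along the good direction the other points have only one atom in [Y], so every accepted view
    agrees with [line] there and is then forced at [x]. This makes the decoded assignment
    independent of the test. *)
Lemma decodeP x (b : nat -> nat) : (forall t, b t < q) ->
  (forall t, t < D -> Y (pt x (dir x) t * q + b t)) -> altchk b -> b 0 = decode x.
Proof.
move=> bq bY bok.
have e t : 0 < t < D -> b t = line x (b 0) t.
  case: t => // t; rewrite [t.+1 < D]ltnS => /andP[_ lt].
  by apply: valueP; rewrite ?bY //; have [_] := dirP x; apply.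
have ok0 : altchk (line x (b 0)).
  by rewrite -(@eq_altchk b) // => -[|t] lt //; apply: e.
pose p v := altchk (line x v).
have hs : has p (iota 0 q) by apply/hasP; exists (b 0); rewrite ?mem_iota ?bq.
have lv : find p (iota 0 q) < q by rewrite -[X in _ < X](size_iota 0) -has_find.
have := nth_find 0 hs; rewrite nth_iota // add0n => okf.
rewrite /decode -/p modn_small //.
by apply: (altchk_inj (b' := line x (find p (iota 0 q)))); rewrite // => -[|t] lt //; apply: e.
Qed.

(** For three variables, consider the test whose lines start at their points in the good directions:
    the view that passes it begins its three lines with the decoded values, and satisfies the
    constraint. *)
Theorem pcp_sound : Sat.
Proof.
exists (fun v => decode (cpt v)); split; first by move=> v; rewrite ltn_mod.
move=> v0 v1 v2 l0 l1 l2; pose v l := nth 0 [:: v0; v1; v2] l.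
have lv l : l < 3 -> v l < 2 ^ m by case: l => [|[|[|]]].
have [tau [tN htx hth]] := @test_exists (fun l => cpt (v l)) (fun l => dir (cpt (v l)))
  (fun l => cpt_lt _) (fun l => (dirP _).1).
have [b [_ /andP[/allP bok chkb] bY]] := Yok tN.
have dE l : l < 3 -> dig q b (l * D) = decode (cpt (v l)).
  move=> l3; rewrite -[l * D]addn0.
  apply: (@decodeP _ (fun t => dig q b (l * D + t))) => [t|t lt|].
  - exact: dig_lt.
  - have := bY (l * D + t); rewrite /tatom divnMDl // divn_small // addn0.
    rewrite modnMDl modn_small // htx // hth //; apply.
    exact: block_lt.
  - by apply: bok; rewrite mem_iota.
have := dE 0 isT; have := dE 1 isT; have := dE 2 isT.
rewrite mul0n mul1n /= => d2 d1 d0; rewrite -d0 -d1 -d2.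
have hq : all (fun l => isq (tx tau l)) (iota 0 3).
  by apply/allP => l; rewrite mem_iota /= => l3; rewrite htx // isq_cpt.
by have := implyP chkb hq; rewrite !htx // /v /= !ix_cpt.
Qed.

End Soundness.

Section Completeness.
Variable w : nat -> nat.
Hypotheses (wq : forall v, w v < q) (wok : forall v0 v1 v2,
  v0 < 2 ^ m -> v1 < 2 ^ m -> v2 < 2 ^ m -> chk v0 v1 v2 (w v0) (w v1) (w v2)).

(* The multilinear extension of the assignment [w] from {0,1}^m to (Z/q)^m. *)
Definition mlez x : 'Z_q := (\sum_(v < 2 ^ m) (w v)%:R *
  \prod_(i < m) (if dig 2 v i == 1%N then (dig q x i)%:R else 1 - (dig q x i)%:R))%R.
Definition mle x : nat := mlez x.

Lemma mle_lt x : mle x < q.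
Proof. by have := ltn_ord (mlez x); rewrite [X in _ < X](Zp_cast q_gt1). Qed.

Lemma natZq k : ((k %% q)%:R = k%:R :> 'Z_q)%R.
Proof. by apply/val_inj; rewrite /= !val_Zp_nat ?q_gt1 // modn_mod. Qed.

(** Along a line each of the [m] factors is affine in [t], so the restriction has degree at most
    [m]. *)
Lemma mle_line x h : altchk (fun t => mle (pt x h t)).
Proof.
apply/altchkP; apply: altsum0.
have E t : ((mle (pt x h t))%:R = mlez (pt x h t) :> 'Z_q)%R by rewrite natr_Zp.
rewrite (funext E) /mlez; apply: deg_lt_sum => v; apply: deg_ltZ.
pose a i : 'Z_q := (if dig 2 v i == 1%N then (dig q x i)%:R else 1 - (dig q x i)%:R)%R.
pose b i : 'Z_q := (if dig 2 v i == 1%N then (dig q h i)%:R else - (dig q h i)%:R)%R.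
apply: eq_deg_lt (deg_lt_prod m a b) => t; apply: eq_bigr => i _.
rewrite dig_pt // natZq natrD natrM /a /b; case: eqP => _; first by rewrite mulrC.
by rewrite opprD addrA mulNr mulrC.
Qed.

Lemma mle_cube x : x < npt -> isq x -> mle x = w (ix x).
Proof.
move=> lx hx; suff E : mlez x = ((w (ix x))%:R)%R.
  by rewrite /mle E val_Zp_nat ?q_gt1 // modn_small.
pose F (v : 'I_(2 ^ m)) : 'Z_q := ((w v)%:R * \prod_(i < m)
  (if dig 2 v i == 1%N then (dig q x i)%:R else 1 - (dig q x i)%:R))%R.
have F0 v : v != Ordinal (ix_lt hx) -> F v = 0%R.
  move=> nv; have [i ni] : exists i : 'I_m, dig 2 v i != dig q x i.
    apply: contrapT => h; case/eqP: nv; apply/val_inj => /=.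
    rewrite -[LHS](@num_digK 2 v m) //; apply: eq_num => i lim.
    by apply/eqP/negPn/negP => n; apply: h; exists (Ordinal lim).
  rewrite /F (@prod_eq0 _ _ _ i) ?mulr0 //.
  have := allP hx i; rewrite mem_iota ltn_ord => /(_ isT).
  have := @dig_lt 2 v i isT; move: ni.
  by case: (dig 2 v i) => [|[|]] //; case: (dig q x i) => [|[|]] // _ _ _; rewrite subrr.
rewrite -[LHS]/(\sum_v F v)%R (sum_single F0) /F big1 ?mulr1 // => i _.
have -> : dig 2 (Ordinal (ix_lt hx)) i = dig q x i.
  by rewrite -[RHS](congr1 (fun y => dig q y i) (cpt_ix lx hx)) dig_cpt.
have := allP hx i; rewrite mem_iota ltn_ord => /(_ isT).
by case: (dig q x i) => [|[|]] // _; rewrite subr0.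
Qed.

Definition honest y := (y < NV) && (y %% q == mle (y %/ q)).

Lemma honest_atom x : x < npt -> honest (x * q + mle x).
Proof.
move=> lx; rewrite /honest modnMDl modn_small ?mle_lt // divnMDl //.
by rewrite divn_small ?mle_lt // addn0 eqxx andbT; apply: block_lt; rewrite ?mle_lt.
Qed.

Lemma honest_count : count honest (iota 0 NV) = npt.
Proof.
rewrite /NV count_block -[RHS]card_ord -sum1_card; apply: eq_bigr => x _.
rewrite -[RHS](_ : (mle x \in iota 0 q) = 1 :> nat); last by rewrite mem_iota mle_lt.
rewrite -(count_uniq_mem _ (iota_uniq 0 q)); apply: eq_in_count => v.
rewrite mem_iota /= => lv; rewrite /honest modnMDl modn_small //.
rewrite divnMDl // divn_small // addn0 andb_idl //= => _.
exact: block_lt.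
Qed.

Theorem pcp_complete : Csat honest.
Proof.
move=> tau _; pose d j := mle (pt (tx tau (j %/ D)) (th tau (j %/ D)) (j %% D)).
have dl j : j < 3 * D -> d j < q by move=> _; apply: mle_lt.
exists (num q (3 * D) d); split; first exact: num_lt.
  have dE l t : l < 3 -> t < D ->
      dig q (num q (3 * D) d) (l * D + t) = mle (pt (tx tau l) (th tau l) t).
    move=> l3 lt; rewrite dig_num // /d; last first.
      exact: block_lt.
    by rewrite divnMDl // divn_small // addn0 modnMDl modn_small.
  apply/andP; split.
    apply/allP => l; rewrite mem_iota /= => l3.
    rewrite (@eq_altchk _ (fun t => mle (pt (tx tau l) (th tau l) t))); first exact: mle_line.
    by move=> t lt; apply: dE.
  apply/implyP => /allP hq.
  have h l : l < 3 -> dig q (num q (3 * D) d) (l * D) = w (ix (tx tau l)) /\ ix (tx tau l) < 2 ^ m.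
    move=> l3; have iq : isq (tx tau l) by apply: hq; rewrite mem_iota.
    rewrite -[l * D]addn0 dE // pt0 ?dig_lt // mle_cube ?dig_lt //.
    by split=> //; apply: ix_lt.
  have [h0 i0] := h 0 isT; have [h1 i1] := h 1 isT; have [h2 i2] := h 2 isT.
  by rewrite mul0n in h0; rewrite mul1n in h1; rewrite h0 h1 h2; apply: wok.
move=> j lj; rewrite /tatom dig_num //; apply: honest_atom; exact: pt_lt.
Qed.

End Completeness.

End Code.

(** * Composing the formula with itself *)

Section Compose.
Variables (m k : nat) (chk : nat -> nat -> nat -> nat -> nat -> nat -> bool).

Notation D := (D m). Notation NV := (NV m). Notation NT := (NT m).
Notation NB := (NB m). Notation npt := (npt m). Notation K1 := (K1 m).

(** One arity for both kinds of nodes: it suffices for the [NT] tests below a conjunction and for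
    the [NB] views of [3 * D] atoms below a disjunction. *)
Definition aW := NT + NB * (3 * D).
Notation W := aW.

(** The number of nodes of depth less than [n], which is also the number of the first node of depth
    [n]. *)
Definition zc n := \sum_(i < n) W ^ i.
Definition aZ := zc (2 * k).
(** The depth, capped at [2 * k]: the [j]-th ancestor differs from the root exactly for the [j]
    below the depth. *)
Definition dep a := \sum_(j < 2 * k) (iter j (up W) a != 0).

(* Nodes of even depth are conjunctions over all the tests; a node of odd depth is
   the disjunction over the valid views of the test given by its position. *)
Definition gact a g := if odd (dep a) then (g < NB) && valid m chk (ci W a) g else g == 0.
Definition gmem a g c := if odd (dep a) then c %/ (3 * D) == g else c < NT.

(** A node two levels below a conjunction stands for an atom: the position of its parent is the
    test, and its own position gives the view and the place in it. *)
Definition atomof z :=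
  tatom m (ci W (up W z)) (ci W z %/ (3 * D)) (ci W z %% (3 * D)) %% NV.

(** The label lists the atoms on the path in base [NV] and forgets tests and views, so that all the
    leaves with the same atoms share one input. *)
Fixpoint plab i z :=
  if i is i'.+1 then plab i' (up W (up W z)) * NV + atomof z else 0.

Definition lev d a := zc d <= a < zc d.+1.

Let W0 : 0 < W. Proof. by rewrite /aW ltn_addr // expn_gt0 npt_gt0. Qed.
Let NV0 : 0 < NV := NV_gt0 m.
Let D30 : 0 < 3 * D. Proof. by []. Qed.

Lemma zcS n : zc n.+1 = (W * zc n).+1.
Proof.
rewrite /zc big_ord_recl expn0 add1n big_distrr; congr S.
by apply: eq_bigr => i _; rewrite lift0 expnS.
Qed.

Lemma zc_le n n' : n <= n' -> zc n <= zc n'.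
Proof.
move=> /subnKC <-; elim: (n' - n) => [|j IH]; first by rewrite addn0.
by rewrite addnS; apply: leq_trans IH _; rewrite /zc big_ord_recr leq_addr.
Qed.

Lemma lev0 : lev 0 0.
Proof. by rewrite /lev zcS /zc big_ord0. Qed.

Lemma lev_child d a c : c < W -> lev d a -> lev d.+1 (child W a c).
Proof.
move=> cW /andP[h1 h2]; rewrite /lev [zc d.+2]zcS {1}zcS /child !ltnS.
have : W * a.+1 <= W * zc d.+1 by rewrite leq_mul2l h2 orbT.
have : W * zc d <= W * a by rewrite leq_mul2l h1 orbT.
by rewrite mulnS; lia.
Qed.

Lemma lev_up d a : lev d.+1 a -> a != 0 /\ lev d (up W a).
Proof.
rewrite /lev [zc d.+2]zcS {1}zcS => /andP[]; case: a => // a; rewrite !ltnS => h1 h2.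
by split=> //; rewrite /up /= leq_divRL // mulnC h1 /= ltn_divLR // mulnC.
Qed.

Lemma depE d a : d <= 2 * k -> lev d a -> dep a = d.
Proof.
rewrite /dep => dk la; rewrite -[RHS](minn_idPr dk).
elim: (2 * k) d a {dk} la => [|n IH] d a la; first by rewrite big_ord0 min0n.
case: d la => [|d] la.
  have -> : a = 0 by move: la; rewrite /lev zcS /zc big_ord0 muln0; lia.
  rewrite minn0; apply: big1 => j _.
  have -> // : iter j (up W) 0 = 0 by elim: (j : nat) => //= i ->; apply: up0.
have [a0 la'] := lev_up la; rewrite big_ord_recl /= a0 minnSS -(IH d _ la').
by congr (_ + _); apply: eq_bigr => j _; rewrite -iterSr.
Qed.

Lemma lev_ltZ d a : d < 2 * k -> lev d a -> a < aZ.
Proof. by move=> dk /andP[_ h]; apply: leq_trans h (zc_le _). Qed.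

Lemma lev_geZ a : lev (2 * k) a -> aZ <= a.
Proof. by case/andP. Qed.

Lemma leqNTW c : c < NT -> c < W.
Proof. by move=> h; rewrite /aW ltn_addr. Qed.

Lemma leqNBW c : c < NB * (3 * D) -> c < W.
Proof. by move=> h; rewrite /aW ltn_addl. Qed.

Lemma tatom_lt tau b j : tatom m tau b j < NV.
Proof. by apply: block_lt; rewrite ?pt_lt ?dig_lt ?q_gt0. Qed.

Lemma plab_child i z tau c : tau < W -> c < W ->
  plab i.+1 (child W (child W z tau) c) =
  plab i z * NV + tatom m tau (c %/ (3 * D)) (c %% (3 * D)).
Proof.
by move=> tW cW; rewrite /= /atomof !upK // !ciK // modn_small // tatom_lt.
Qed.

Lemma plab_lt i z : plab i z < NV ^ i.
Proof.
elim: i z => [|i IH] z //=; rewrite expnSr; apply: block_lt; first exact: IH.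
by rewrite ltn_mod.
Qed.

Notation ev := (ev W aZ gact gmem (plab k)).

Section Lower.
Variable X : pred nat.
Hypothesis noSat : ~ Sat m chk.

(** An input is a list of [k] atoms; [p] prescribes the first [k - j] and leaves the last [j]
    free. *)
Definition cpre p j := count (fun y => X y && (y %/ NV ^ j == p)) (iota 0 (NV ^ k)).

Lemma cpreS p j : cpre p j.+1 = \sum_(v < NV) cpre (p * NV + v) j.
Proof.
rewrite /cpre; elim: (iota _ _) => [|y s IH] /=; first by rewrite big1.
rewrite big_split /= IH; congr (_ + _).
have [Xy|_] := boolP (X y); last by rewrite big1.
rewrite expnSr divnMA /=; set u := y %/ _.
have [<-|np] := eqVneq (u %/ NV) p.
  have lv : u %% NV < NV by rewrite ltn_mod.
  rewrite (bigD1 (Ordinal lv)) //= -divn_eq eqxx big1 // => v nv.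
  apply/eqP; rewrite eqb0; apply: contra nv => /eqP e; apply/eqP/val_inj => /=.
  by rewrite e modnMDl modn_small.
rewrite big1 // => v _; apply/eqP; rewrite eqb0; apply: contra np => /eqP ->.
by rewrite divnMDl // divn_small // addn0.
Qed.

(** In the step to [j.+1], call an atom heavy if at least [K1 ^ j] true inputs continue [plab i z]
    followed by it. By induction on the grandchildren of the true node [z], the heavy atoms pass all
    the tests; hence there are at least [K1] of them, and the counts multiply. *)
Lemma ev_lower j i z : i + j = k -> lev (2 * i) z -> ev X z ->
  K1 ^ j <= cpre (plab i z) j.
Proof.
elim: j i z => [|j IH] i z ek lz evz.
  rewrite addn0 in ek; rewrite ek in lz *; have Zz := lev_geZ lz.
  case: evz Zz lz => [a _ Xa|a g aZ' _ _ _]; last by rewrite leqNgt aZ'.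
  move=> _ _; rewrite -has_count; apply/hasP; exists (plab k a).
    by rewrite mem_iota plab_lt.
  by rewrite Xa expn0 divn1 eqxx.
have lt2 : 2 * i < 2 * k by move: ek; lia.
have zZ := lev_ltZ lt2 lz.
have hz tau : tau < NT -> ev X (child W z tau).
  case: evz zZ lz => [a Za _|a g _ _ ga H] zZ lz; first by rewrite leqNgt zZ in Za.
  move: ga H; rewrite /gact /gmem (depE (ltnW lt2) lz) oddM /= => _ H tN.
  by apply: H => //; apply: leqNTW.
pose Y v := K1 ^ j <= cpre (plab i z * NV + v) j.
have Yok : Csat m chk Y.
  move=> tau tN; have tW := leqNTW tN; have lt3 : 2 * i + 1 < 2 * k by lia.
  have lz1 : lev (2 * i + 1) (child W z tau) by rewrite addn1; apply: lev_child.
  have := hz _ tN; have := lev_ltZ lt3 lz1; set a := child W z tau.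
  have aE : a = child W z tau by []; move: a aE => a aE aZ' eva.
  case: eva aE aZ' => {a} [a Za _|a g _ _ ga H] aE aZ'.
    by rewrite leqNgt aZ' in Za.
  move: ga H; rewrite /gact /gmem (depE (d := 2 * i + 1)) ?(ltnW lt3) //; last first.
    by rewrite aE.
  rewrite addn1 /= oddM /= => /andP[gB gv] H; exists g; split=> //.
    by rewrite -(ciK z tW) -aE.
  move=> c c3; have cW : g * (3 * D) + c < W by apply/leqNBW/block_lt.
  have := H _ cW; rewrite divnMDl // divn_small // addn0 eqxx => /(_ isT) h.
  have lz2 : lev (2 * i.+1) (child W a (g * (3 * D) + c)).
    rewrite (_ : 2 * i.+1 = (2 * i).+2); last by lia.
    by rewrite aE; do 2 apply: lev_child => //.
  have := IH i.+1 _ _ lz2 h; rewrite -ek addSnnS => /(_ erefl).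
  by rewrite aE plab_child // divnMDl // divn_small // addn0 modnMDl modn_small.
have K1Y : K1 <= count Y (iota 0 NV).
  by rewrite leqNgt; apply/negP => /(pcp_sound Yok).
rewrite cpreS expnS; apply: leq_trans (_ : count Y (iota 0 NV) * K1 ^ j <= _).
  by rewrite leq_mul2r K1Y orbT.
rewrite count_iota big_distrl /=; apply: leq_sum => v _.
by case hY: (Y v); rewrite ?mul0n ?mul1n.
Qed.

Lemma composed_lower : ev X 0 -> K1 ^ k <= count X (iota 0 (NV ^ k)).
Proof.
move=> h; apply: leq_trans (ev_lower (i := 0) _ lev0 h) _ => //.
by apply: sub_count => y /andP[].
Qed.

End Lower.

Section Upper.
Variable w : nat -> nat.
Hypotheses (wq : forall v, w v < q m) (wok : forall v0 v1 v2,
  v0 < 2 ^ m -> v1 < 2 ^ m -> v2 < 2 ^ m -> chk v0 v1 v2 (w v0) (w v1) (w v2)).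

Fixpoint hon i y :=
  if i is i'.+1 then hon i' (y %/ NV) && honest m w (y %% NV) else true.

Lemma count_hon i : count (hon i) (iota 0 (NV ^ i)) = npt ^ i.
Proof.
elim: i => //= i IH; rewrite expnSr count_block expnSr -IH count_iota.
rewrite big_distrl /=; apply: eq_bigr => x _; rewrite -(honest_count m w).
transitivity (count (fun v => hon i x && honest m w v) (iota 0 NV)).
  apply: eq_in_count => v; rewrite mem_iota /= => lv.
  by rewrite divnMDl // divn_small // addn0 modnMDl modn_small.
by case: (hon i x); rewrite /= ?mul1n // count_pred0.
Qed.

Lemma honest_lt y : honest m w y -> y < NV.
Proof. by case/andP. Qed.

Lemma ev_upper j i z : i + j = k -> lev (2 * i) z -> hon i (plab i z) ->
  ev (hon k) z.
Proof.
elim: j i z => [|j IH] i z ek lz hz.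
  by rewrite addn0 in ek; rewrite ek in lz hz; apply: ev_leaf => //; apply: lev_geZ.
have lt2 : 2 * i < 2 * k by move: ek; lia.
have lt3 : (2 * i).+1 < 2 * k by move: ek; lia.
apply: (@ev_gate _ _ _ _ _ _ _ 0) => //; first exact: lev_ltZ lt2 lz.
  by rewrite /gact (depE (ltnW lt2) lz) oddM.
move=> tau tW; rewrite /gmem (depE (ltnW lt2) lz) oddM /= => tN.
have lz1 := lev_child tW lz.
have [b [bN bv bY]] := pcp_complete wq wok tN.
have bW : b < W by apply: leqNBW; apply: leq_trans bN _; rewrite leq_pmulr.
apply: (@ev_gate _ _ _ _ _ _ _ b) => //; first exact: lev_ltZ lt3 lz1.
  by rewrite /gact (depE (ltnW lt3) lz1) /= oddM /= bN ciK.
move=> c cW; rewrite /gmem (depE (ltnW lt3) lz1) /= oddM /= => /eqP cb.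
apply: (IH i.+1); first by rewrite -ek addSnnS.
  rewrite (_ : 2 * i.+1 = (2 * i).+2); last by lia.
  exact: lev_child.
rewrite plab_child //= divnMDl // modnMDl cb.
have hh := bY (c %% (3 * D)) (ltn_pmod _ D30).
have tl := honest_lt hh.
by rewrite (divn_small tl) (modn_small tl) addn0 hz hh.
Qed.

Lemma composed_upper : ev (hon k) 0.
Proof. by apply: (@ev_upper k 0) => //; apply: lev0. Qed.

End Upper.

(* At most [NV ^ k] nodes miss two of the copies. *)
Definition nR := NV ^ k + 2.
Definition nodes := nN W aZ nR (NV ^ k).
Definition Gr : rel 'I_nodes := @graph W aZ nR (NV ^ k) gact gmem (plab k).

Hypothesis k0 : 0 < k.

Lemma aZ_gt0 : 0 < aZ.
Proof. by apply: (lev_ltZ (d := 0)) lev0; rewrite muln_gt0. Qed.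

Lemma Gr_simple : simple_graph Gr.
Proof. exact: graph_simple. Qed.

Lemma pds_opt_le (V : finType) (e : rel V) (S : {set V}) :
  power_dominates e S -> pds_opt e <= #|S|.
Proof.
move=> pS; rewrite /pds_opt; case: arg_minnP => [|S' _]; last exact.
exact: power_dominates_setT.
Qed.

(** The honest inputs number [npt ^ k], and the successor accounts for the hub. *)
Theorem reduction_yes : Sat m chk -> pds_opt Gr <= (npt ^ k).+1.
Proof.
move=> [w [wq wok]].
have labI a : aZ <= a -> plab k a < NV ^ k by move=> _; apply: plab_lt.
have pd : power_dominates Gr _ := graph_complete nR W0 aZ_gt0 labI (composed_upper wq wok).
apply: leq_trans (pds_opt_le pd) _; rewrite -(count_hon w k) -size_filter.
rewrite -[X in _ <= X.+1](size_map succn) cardE -(size_map (@nat_of_ord _)).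
apply: (@uniq_leq_size _ _ (0 :: [seq y.+1 | y <- filter (hon w k) (iota 0 (NV ^ k))])).
  by rewrite map_inj_uniq ?enum_uniq //; apply: ord_inj.
move=> y /mapP[v]; rewrite mem_enum inE => hv ->.
rewrite inE; case: (nat_of_ord v) hv => // y' /= /andP[yI hy].
by rewrite mem_map ?mem_filter ?mem_iota ?hy //; apply: succn_inj.
Qed.

Theorem reduction_no (S : {set 'I_nodes}) : ~ Sat m chk ->
  power_dominates Gr S -> K1 ^ k <= #|S|.
Proof.
move=> nS pS; rewrite leqNgt; apply/negP => lS.
have lR : #|S| + 2 <= nR.
  rewrite /nR leq_add2r; apply: leq_trans (ltnW lS) _.
  by rewrite leq_exp2r // K1_le.
have := composed_lower nS (graph_sound W0 aZ_gt0 pS lR).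
suff : count (fun y => inord y.+1 \in S) (iota 0 (NV ^ k)) <= #|S|.
  by move=> h /leq_trans/(_ h); rewrite leqNgt lS.
rewrite -size_filter cardE -(size_map (fun y => inord y.+1 : 'I_nodes)).
have lN y : y < NV ^ k -> y.+1 < nodes.
  by move=> ly; rewrite /nodes /nN ltnS ltn_addr.
apply: uniq_leq_size.
  rewrite map_inj_in_uniq ?filter_uniq ?iota_uniq // => y z.
  rewrite !mem_filter !mem_iota /= => /andP[_ ly] /andP[_ lz].
  by move=> /(congr1 val); rewrite /= !inordK ?lN // => -[].
move=> v /mapP[y]; rewrite mem_filter => /andP[hy _] ->.
by rewrite mem_enum.
Qed.

End Compose.

(** * Computations as constraint satisfaction problems *)

Lemma size_pair_code x y : size (pair_code x y) = (size x).*2 + 2 + size y.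
Proof.
rewrite /pair_code size_cat /= -addnA; congr (_ + _).
by elim: x => //= b x ->.
Qed.

(** The part of [pair_code x y] that does not depend on [y]: each bit of [x] twice, then the
    separator 01. *)
Definition prefix_bit (x : seq bool) (j : nat) : bool :=
  if j < (size x).*2 then nth false x (j %/ 2) else j == (size x).*2.+1.

Lemma nth_pair_code x y j : nth false (pair_code x y) j =
  if j < (size x).*2 + 2 then prefix_bit x j else nth false y (j - ((size x).*2 + 2)).
Proof.
rewrite /pair_code /prefix_bit nth_cat.
have -> : size (flatten [seq [:: b; b] | b <- x]) = (size x).*2.
  by elim: x => //= b x ->.
case: ltnP => h.
  rewrite ltn_addr //; elim: x j h => //= b x IH [|[|j]] //.
  rewrite doubleS !ltnS => /IH h.
  by rewrite [LHS]h -[j.+2]addn2 divnDr // addn1.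
case: ltnP => h2; last first.
  have -> : j - (size x).*2 = (j - ((size x).*2 + 2)).+2 by lia.
  by [].
have [->|->] : j = (size x).*2 \/ j = (size x).*2.+1 by lia.
  by rewrite subnn /= ltn_eqF.
by rewrite subSnn /= eqxx.
Qed.

Section CookLevin.
Variables (V : TM) (T YB : nat).

(* What can be seen at a given time at a given distance from the heads. *)
Definition obs : finType := (state V * {ffun 'I_(tapes V).+1 -> symbol (aux V)})%type.

Definition obs0 : obs := (start V, [ffun => None]).
Definition dec (w : nat) : obs := nth obs0 (enum obs) w.
Definition cod (o : obs) : nat := index o (enum obs).
Definition nobs := #|obs|.

Lemma codK : cancel cod dec.
Proof. by move=> o; rewrite /dec nth_index // mem_enum. Qed.

Lemma cod_lt o : cod o < nobs.
Proof. by rewrite /nobs cardE index_mem mem_enum. Qed.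

Lemma dec_min w : dec (minn w nobs) = dec w.
Proof.
have [lw|le] := leqP w nobs; first by [].
by rewrite /dec !nth_default // -cardE // ltnW.
Qed.

Definition is_bit (a : symbol (aux V)) := if a is Some (inl _) then true else false.

(** Classes 0, 1 and 2 prescribe a blank, a 0 and a 1; a cell of class 3 may hold a bit of the
    witness or be blank, as the length of the witness is not known. *)
Definition ini_ok (cl : nat) (o : obs) : bool :=
  (o.1 == start V) && [forall i, if i == ord0 then
     match cl with
     | 0 => o.2 i == None
     | 1 => o.2 i == Some (inl false)
     | 2 => o.2 i == Some (inl true)
     | _ => (o.2 i == None) || is_bit (o.2 i)
     end else o.2 i == None].

Definition blank_ok (o : obs) : bool := o.2 ord0 == None.

Definition trans_of (o : obs) : state V * {ffun 'I_(tapes V).+1 -> symbol (aux V) * move} :=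
  if halting o.1 then (o.1, [ffun i => (o.2 i, Stay)]) else delta o.1 o.2.

(** One more than the shift, which is [p1.+1 - p2] when cell [p1] moves to place [p2]. *)
Definition move_code (mv : move) : nat :=
  match mv with MoveL => 0 | Stay => 1 | MoveR => 2 end.

(* [o0] is the observation at the heads, and [o1] the one at the cell whose content
   moves to the place of [o2] for the tapes whose move has code [d]. *)
Definition step_ok (z : bool) (d : nat) (o0 o1 o2 : obs) : bool :=
  (o2.1 == (trans_of o0).1) && [forall i, (move_code ((trans_of o0).2 i).2 == d) ==>
     (o2.2 i == if z then ((trans_of o0).2 i).1 else o1.2 i)].

Definition acc_ok (o : obs) : bool := halting o.1 && (o.2 ord0 == Some (inl true)).
Definition nxt_ok (o : obs) : bool := ~~ is_bit (o.2 ord0).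

(** After [t] steps, the [t] outermost cells on either side may depend on what was outside the
    window. With [T + 1] cells on each side of the head, the two cells that tell the output are
    still known at time [T]. *)
Definition wd := (T.+1).*2.+1.
Definition mid := T.+1.

Definition class (x : seq bool) (p : nat) : nat :=
  if p < mid then 0 else
  let j := p - mid in
  if j < (size x).*2 + 2 then (if prefix_bit x j then 2 else 1) else
  if j < (size x).*2 + 2 + YB then 3 else 0.

(* The variable [t * wd + p] is the observation at time [t] and position [p - mid]. *)
Definition chk (x : seq bool) (v0 v1 v2 w0 w1 w2 : nat) : bool :=
  let t0 := v0 %/ wd in let p0 := v0 %% wd in
  let t1 := v1 %/ wd in let p1 := v1 %% wd in
  let t2 := v2 %/ wd in let p2 := v2 %% wd in
  [&& (t0 == 0) ==> ini_ok (class x p0) (dec w0),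
      [&& t0 == 0, t1 == 0, p1 == p0.+1, mid + ((size x).*2 + 2) <= p0 & blank_ok (dec w0)]
        ==> blank_ok (dec w1),
      [&& t0 == t1, t2 == t1.+1, t2 <= T, p0 == mid, p1 <= p2.+1 & p2 <= p1.+1]
        ==> step_ok (p1 == mid) (p1.+1 - p2) (dec w0) (dec w1) (dec w2),
      (t0 == T) && (p0 == mid) ==> acc_ok (dec w0)
    & (t0 == T) && (p0 == mid.+1) ==> nxt_ok (dec w0)].

Definition obs_at (c : fconfig V) (z : int) : obs := (c.1, [ffun i => c.2 i z]).

Definition zpos (p : nat) : int := (p%:Z - mid%:Z)%R.

Lemma fstep_next (c : fconfig V) z :
  obs_at (fstep c) z = ((trans_of (obs_at c 0)).1,
    [ffun i => act (c.2 i) ((trans_of (obs_at c 0)).2 i).1 ((trans_of (obs_at c 0)).2 i).2 z]).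
Proof.
rewrite /obs_at /fstep /trans_of /=; case: ifP => h /=; congr pair.
  by apply/ffunP => i; rewrite !ffunE /act addr0; case: eqP => [->|].
Qed.

Lemma move_zpos mv p1 p2 : p1 <= p2.+1 -> p2 <= p1.+1 ->
  move_code mv = p1.+1 - p2 -> zpos p1 = (zpos p2 + shift mv)%R.
Proof. by rewrite /zpos; case: mv => /=; lia. Qed.

Lemma zpos_eq0 p : (zpos p == 0%R) = (p == mid).
Proof. by rewrite /zpos subr_eq0. Qed.

Section Run.
Variables (x y : seq bool).
Notation z0 := (pair_code x y).
Let conf t := iter t (@fstep V) (finit V z0).

Hypothesis yYB : size y <= YB.

Let szz : size z0 = (size x).*2 + 2 + size y := size_pair_code x y.

Lemma conf0_at p : obs_at (conf 0) (zpos p) =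
  (start V, [ffun i => if (i == ord0) && (mid <= p) && (p - mid < size z0)
                       then Some (inl (nth false z0 (p - mid))) else None]).
Proof.
rewrite /conf /obs_at /=; congr pair; apply/ffunP => i; rewrite !ffunE.
case: (i == ord0) => //=; rewrite /zpos.
have [le|lt] := leqP mid p.
  rewrite (_ : (p%:Z - mid%:Z)%R = Posz (p - mid)); last by lia.
  rewrite /inp; case: ltnP => h; first by rewrite (nth_map false).
  by rewrite nth_default // size_map.
have [k ->] : exists k, (p%:Z - mid%:Z)%R = Negz k by exists (mid - p).-1; lia.
by [].
Qed.

Lemma conf_ini p : ini_ok (class x p) (obs_at (conf 0) (zpos p)).
Proof.
rewrite conf0_at /ini_ok /= eqxx /=; apply/forallP => i; rewrite ffunE.
case: eqP => //= _; rewrite /class; have [lt|le] := ltnP p mid.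
  by [].
rewrite szz nth_pair_code; set j := p - mid.
case: ltnP => h1.
  by rewrite ltn_addr //; case: prefix_bit.
case: (ltnP j ((size x).*2 + 2 + size y)) => h2; case: ltnP => h3 //=.
by move: h2 h3 yYB; lia.
Qed.

Definition run_code v :=
  if v %/ wd <= T then cod (obs_at (conf (v %/ wd)) (zpos (v %% wd))) else cod obs0.

Lemma run_code_lt v : run_code v < nobs.
Proof. by rewrite /run_code; case: ifP => _; apply: cod_lt. Qed.

Hypothesis acc : halting (conf T).1 /\ outs ((conf T).2 ord0) [:: true].

Lemma chk_run v0 v1 v2 : chk x v0 v1 v2 (run_code v0) (run_code v1) (run_code v2).
Proof.
rewrite /chk /run_code; set t0 := v0 %/ wd; set t1 := v1 %/ wd; set t2 := v2 %/ wd.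
set p0 := v0 %% wd; set p1 := v1 %% wd; set p2 := v2 %% wd.
apply/and5P; split; apply/implyP.
- by move=> /eqP ->; rewrite leq0n codK; apply: conf_ini.
- move=> /and5P[/eqP-> /eqP-> /eqP-> le]; rewrite !leq0n !codK.
  rewrite /blank_ok !conf0_at /= !ffunE /=; rewrite (leq_trans (leq_addr _ _) le).
  rewrite (leq_trans (leq_trans (leq_addr _ _) le) (leqnSn _)) /=.
  case: ifP => // h _; rewrite ifF //; apply/negbTE; move/negbT: h; rewrite -!leqNgt.
  by move=> h; apply: leq_trans h _; rewrite leq_sub2r.
- move=> /and5P[/eqP e1 /eqP e2 l2 /eqP e0 /andP[l12 l21]].
  rewrite -e1 e2 -e1 in l2 *; rewrite l2 (ltnW l2) !codK.
  have z00 : zpos p0 = 0%R by apply/eqP; rewrite zpos_eq0 e0.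
  rewrite z00 [conf t0.+1]/= fstep_next /step_ok /= eqxx /=.
  apply/forallP => i; apply/implyP => /eqP hm; rewrite !ffunE /act.
  by rewrite -(move_zpos l12 l21 hm) zpos_eq0.
- move=> /andP[/eqP -> /eqP e0]; rewrite leqnn codK.
  have z00 : zpos p0 = 0%R by apply/eqP; rewrite zpos_eq0 e0.
  case: acc => h [h0 _]; rewrite z00 /acc_ok /= h ffunE.
  by rewrite (h0 0 isT).
- move=> /andP[/eqP -> /eqP e0]; rewrite leqnn codK.
  have z01 : zpos p0 = 1%R by rewrite e0 /zpos; lia.
  case: acc => _ [_ h1]; rewrite z01 /nxt_ok /= ffunE.
  by have := h1; case: ((conf T).2 ord0 1%R) => [[b|]|] // /(_ b).
Qed.

End Run.

Section Decode.
Variables (m : nat) (w : nat -> nat) (x : seq bool).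
Hypothesis wok : forall v0 v1 v2, v0 < 2 ^ m -> v1 < 2 ^ m -> v2 < 2 ^ m ->
  chk x v0 v1 v2 (w v0) (w v1) (w v2).
Hypothesis mT : T.+1 * wd <= 2 ^ m.
Hypothesis TY : (size x).*2 + 2 + YB <= T.

Let X t p := dec (w (t * wd + p)).

Lemma chk_at t0 p0 t1 p1 t2 p2 : t0 <= T -> p0 < wd -> t1 <= T -> p1 < wd ->
  t2 <= T -> p2 < wd ->
  [&& (t0 == 0) ==> ini_ok (class x p0) (X t0 p0),
      [&& t0 == 0, t1 == 0, p1 == p0.+1, mid + ((size x).*2 + 2) <= p0 & blank_ok (X t0 p0)]
        ==> blank_ok (X t1 p1),
      [&& t0 == t1, t2 == t1.+1, t2 <= T, p0 == mid, p1 <= p2.+1 & p2 <= p1.+1]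
        ==> step_ok (p1 == mid) (p1.+1 - p2) (X t0 p0) (X t1 p1) (X t2 p2),
      (t0 == T) && (p0 == mid) ==> acc_ok (X t0 p0)
    & (t0 == T) && (p0 == mid.+1) ==> nxt_ok (X t0 p0)].
Proof.
move=> h0 l0 h1 l1 h2 l2; have lt t p : t <= T -> p < wd -> t * wd + p < 2 ^ m.
  by move=> ht hp; apply: leq_trans mT; apply: block_lt.
have := wok (lt _ _ h0 l0) (lt _ _ h1 l1) (lt _ _ h2 l2); rewrite /chk.
have dE t p : p < wd -> (t * wd + p) %/ wd = t by move=> hp; rewrite divnMDl // divn_small ?addn0.
have mE t p : p < wd -> (t * wd + p) %% wd = p by move=> hp; rewrite modnMDl modn_small.
by rewrite !dE // !mE.
Qed.

Let base := mid + ((size x).*2 + 2).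
Let sy j := (X 0 (base + j)).2 ord0.

Lemma X_ini p : p < wd -> ini_ok (class x p) (X 0 p).
Proof.
move=> lp; have := chk_at (leq0n T) lp (leq0n T) lp (leq0n T) lp.
by case/and5P.
Qed.

Lemma X_blank p : p.+1 < wd -> base <= p -> blank_ok (X 0 p) -> blank_ok (X 0 p.+1).
Proof.
move=> lp bp hb; have := chk_at (leq0n T) (ltnW lp) (leq0n T) lp (leq0n T) lp.
by case/and5P => _ + _ _ _; rewrite !eqxx bp hb.
Qed.

Lemma X_blank_le p p' : p <= p' -> p' < wd -> base <= p ->
  blank_ok (X 0 p) -> blank_ok (X 0 p').
Proof.
move=> /subnKC <-; elim: (p' - p) => [|j IH]; first by rewrite addn0.
rewrite addnS => lp bp hb; apply: X_blank => //; first exact: leq_trans bp (leq_addr _ _).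
by apply: IH => //; apply: ltnW.
Qed.

(** The second constraint of [chk] lets only blanks follow a blank of this region, so what precedes
    the first blank is a word; it is taken as the witness. *)
Let len := find (fun j => sy j == None) (iota 0 YB).

Definition witness : seq bool := mkseq (fun j => sy j == Some (inl true)) len.

Lemma len_le : len <= YB.
Proof. by rewrite /len -[X in _ <= X](size_iota 0) find_size. Qed.

Lemma size_witness : size witness <= YB.
Proof. by rewrite size_mkseq len_le. Qed.

Let conf t := iter t (@fstep V) (finit V (pair_code x witness)).

Lemma obs_eq (o o' : obs) : o.1 = o'.1 -> (forall i, o.2 i = o'.2 i) -> o = o'.
Proof. by case: o o' => [a f] [a' f'] /= -> /ffunP ->. Qed.

Lemma X0 p : p < wd -> X 0 p = obs_at (conf 0) (zpos p).
Proof.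
move=> lp; rewrite conf0_at ?size_witness // size_pair_code; have := X_ini lp.
move=> /andP[/eqP s0 /forallP hi]; apply: obs_eq => //= i; rewrite ffunE.
have := hi i; case: eqP => [->|_] /=; last by move/eqP.
rewrite {1}/class; have [lt|le] /= := ltnP p mid; first by move/eqP.
rewrite nth_pair_code; set j := p - mid; case: ltnP => h1.
  by rewrite ltn_addr //; case: prefix_bit => /eqP.
have pE : p = base + (j - ((size x).*2 + 2)) by rewrite /base /j; lia.
move: (j - _) pE h1 => j' pE h1.
have -> : (j < (size x).*2 + 2 + size witness) = (j' < len).
  by rewrite size_mkseq; move: pE; rewrite /base /j; lia.
have -> : (j < (size x).*2 + 2 + YB) = (j' < YB).
  by move: pE; rewrite /base /j; lia.
have [lj|lj] := ltnP j' len => h.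
  rewrite (leq_trans lj len_le) in h; rewrite nth_mkseq //.
  have := before_find 0 lj; rewrite nth_iota ?add0n; last exact: leq_trans lj len_le.
  move: h; rewrite /sy -pE; case: ((X 0 p).2 ord0) => [[b|]|] // _ _.
  by case: b.
move: h; case: ltnP => lY; last by move/eqP.
move=> _; apply/eqP; apply: (@X_blank_le (base + len)) => //.
- by rewrite pE leq_add2l.
- exact: leq_addr.
have hs : has (fun j => sy j == None) (iota 0 YB).
  by rewrite has_find size_iota; apply: leq_ltn_trans lj lY.
by have := nth_find 0 hs; rewrite nth_iota ?add0n //; apply: leq_ltn_trans lj lY.
Qed.

(** A cell at time [t + 1] is determined by the observation at the head and by the cell that moves
    to its place. This is why three variables per constraint suffice, with one constraint for each
    possible origin [p1]. *)
Lemma X_run t p : t <= T -> p + t <= wd.-1 -> t <= p -> X t p = obs_at (conf t) (zpos p).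
Proof.
elim: t p => [|t IH] p lt l1 l2.
  by apply: X0; move: l1; rewrite addn0 ltnS.
have lc : mid < wd by rewrite /mid /wd; lia.
have {}l1 : p + t.+1 <= (T.+1).*2 by [].
have lp : p < wd by rewrite /wd; lia.
have IHc : X t mid = obs_at (conf t) 0%R.
  rewrite (IH mid (ltnW lt)); last 2 first.
  - by rewrite /mid /wd /=; lia.
  - by rewrite /mid; lia.
  by congr obs_at; rewrite /zpos subrr.
have step p1 : p1 < wd -> p1 <= p.+1 -> p <= p1.+1 ->
    step_ok (p1 == mid) (p1.+1 - p) (X t mid) (X t p1) (X t.+1 p).
  move=> lp1 h1 h2; have := chk_at (ltnW lt) lc (ltnW lt) lp1 lt lp.
  by case/and5P => _ _ + _ _; rewrite !eqxx lt h1 h2.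
rewrite [conf t.+1]/= fstep_next -IHc; apply: obs_eq => /= [|i].
  have := step p lp; rewrite leqnSn => /(_ isT isT) /andP[/eqP-> _].
  by [].
rewrite ffunE; set mvi := ((trans_of (X t mid)).2 i).2.
have [p1 [lp1 h1 h2 hm]] : exists p1, [/\ p1 < wd, p1 <= p.+1, p <= p1.+1 &
    move_code mvi = p1.+1 - p].
  case: mvi => /=; [exists p.-1|exists p|exists p.+1]; split; rewrite /wd; lia.
have := step p1 lp1 h1 h2 => /andP[_ /forallP/(_ i)]; rewrite -/mvi hm eqxx => /eqP ->.
rewrite /act -(move_zpos h1 h2 hm) zpos_eq0; case: ifP => // _.
rewrite (IH p1 (ltnW lt)) ?ffunE //; rewrite /wd /=; lia.
Qed.

Lemma witness_accepted : halting (conf T).1 /\ outs ((conf T).2 ord0) [:: true].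
Proof.
have lc : mid < wd by rewrite /mid /wd; lia.
have lc1 : mid.+1 < wd by rewrite /mid /wd; lia.
have E0 : X T mid = obs_at (conf T) 0%R.
  rewrite X_run //; last 2 first; try by rewrite /mid /wd /=; lia.
  by congr obs_at; rewrite /zpos subrr.
have E1 : X T mid.+1 = obs_at (conf T) 1%R.
  rewrite X_run //; last 2 first; try by rewrite /mid /wd /=; lia.
  by congr obs_at; rewrite /zpos; lia.
have /and5P[_ _ _ + _] := chk_at (leqnn T) lc (leqnn T) lc (leqnn T) lc.
rewrite !eqxx E0 /= => /andP[/= h /eqP]; rewrite ffunE => h0.
have /and5P[_ _ _ _] := chk_at (leqnn T) lc1 (leqnn T) lc1 (leqnn T) lc1.
rewrite !eqxx E1 /= /nxt_ok /= ffunE => h1; split=> //; split=> [[|k] //|b e].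
by move: h1; rewrite e.
Qed.

End Decode.

End CookLevin.

(** * Computability on a promise *)

(* Functions of [x] such as [q (fm x)] have superpolynomial values, hence they are
   only computed when some register is promised to be large enough. *)
Section Promise.
Variable M : TM.
Notation Comp := (@Comp M).
Implicit Types (P : seq bool -> seq nat -> Prop) (a b n f : fn)
  (c d : seq bool -> seq nat -> bool).

Lemma Comp_sum_env n F : Comp n -> Comp F ->
  Comp (fun x e => \sum_(i < n x e) F x (val i :: e)).
Proof.
move=> hn hF.
have E x e i : iteri i (fun j acc => acc + F x (j :: e)) 0 = \sum_(j < i) F x (val j :: e).
  by elim: i => [|i /= ->]; rewrite ?big_ord0 ?big_ord_recr.
apply: (eq_Comp (f := fun x e => iteri (n x e) (fun j acc => acc + F x (j :: e)) 0)).
  by move=> x e; rewrite E.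
have [k hk] := Comp_PB hF.
apply: (Comp_rec (g := fun x e => nth 0 e 0 + F x (behead e)) (a := fun _ _ => 0)
  (B := fun x e => n x e * (n x e + sz x e) ^ k)) => //.
- exact: Comp_zero.
- exact: Comp_add (Comp_var _ _) (Comp_weak hF).
- exact: PB_mul (Comp_PB hn) (PB_exp _ (PB_add (Comp_PB hn) PB_sz)).
- move=> x e i li; rewrite /= E.
  apply: (@leq_trans (\sum_(j < i) (n x e + sz x e) ^ k)); last first.
    by rewrite sum_nat_const card_ord leq_mul2r li orbT.
  apply: leq_sum => j _; apply: leq_trans (hk x (val j :: e)) _.
  case: k {hk} => // k; rewrite leq_exp2r // sz_cons leq_add2r.
  by apply: leq_trans (ltnW (ltn_ord j)) li.
Qed.

(** A program has to be polynomially bounded on every environment, hence the total function [f'],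
    which agrees with [f] under the promise only. *)
Definition PComp P f := exists2 f', Comp f' & forall x e, P x e -> f' x e = f x e.

(* The promise [P] on the environment without its first variable, with the
   additional promise [Q]. *)
Definition plift P Q : seq bool -> seq nat -> Prop :=
  fun x e => P x (behead e) /\ Q x e.
Definition noQ : seq bool -> seq nat -> Prop := fun _ _ => True.
Definition ltQ n : seq bool -> seq nat -> Prop :=
  fun x e => nth 0 e 0 < n x (behead e).

Section Ops.
Variable P : seq bool -> seq nat -> Prop.

Lemma PComp_Comp f : Comp f -> PComp P f.
Proof. by exists f. Qed.

Lemma eq_PComp f g : (forall x e, P x e -> f x e = g x e) -> PComp P f -> PComp P g.
Proof. by move=> fg [f' cf h]; exists f' => // x e he; rewrite h ?fg. Qed.

Lemma PComp_lift f Q : PComp P f -> PComp (plift P Q) (fun x e => f x (behead e)).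
Proof.
move=> [f' cf h]; exists (fun x e => f' x (behead e)); first exact: Comp_weak.
by move=> x e [he _]; apply: h.
Qed.

Lemma PComp2 (op : nat -> nat -> nat) a b :
  (forall a b, Comp a -> Comp b -> Comp (fun x e => op (a x e) (b x e))) ->
  PComp P a -> PComp P b -> PComp P (fun x e => op (a x e) (b x e)).
Proof.
move=> hop [a' ca ha] [b' cb hb]; exists (fun x e => op (a' x e) (b' x e)).
  exact: hop.
by move=> x e he; rewrite ha ?hb.
Qed.

Lemma PComp_const k : PComp P (fun _ _ => k).
Proof. exact/PComp_Comp/Comp_const. Qed.
Lemma PComp_size : PComp P (fun x _ => size x).
Proof. exact/PComp_Comp/Comp_size. Qed.
Lemma PComp_var i : PComp P (fun _ e => nth 0 e i).
Proof. exact/PComp_Comp/Comp_var. Qed.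
Lemma PComp_add a b : PComp P a -> PComp P b -> PComp P (fun x e => a x e + b x e).
Proof. exact/PComp2/Comp_add. Qed.
Lemma PComp_mul a b : PComp P a -> PComp P b -> PComp P (fun x e => a x e * b x e).
Proof. exact/PComp2/Comp_mul. Qed.
Lemma PComp_sub a b : PComp P a -> PComp P b -> PComp P (fun x e => a x e - b x e).
Proof. exact/PComp2/Comp_sub. Qed.
Lemma PComp_div a b : PComp P a -> PComp P b -> PComp P (fun x e => a x e %/ b x e).
Proof. exact/PComp2/Comp_div. Qed.
Lemma PComp_mod a b : PComp P a -> PComp P b -> PComp P (fun x e => a x e %% b x e).
Proof. exact/PComp2/Comp_mod. Qed.
Lemma PComp_minn a b : PComp P a -> PComp P b -> PComp P (fun x e => minn (a x e) (b x e)).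
Proof. exact/PComp2/Comp_minn. Qed.
Lemma PComp_leq a b : PComp P a -> PComp P b -> PComp P (fun x e => a x e <= b x e).
Proof. exact: (@PComp2 (fun u v => u <= v) a b (@Comp_leq M)). Qed.
Lemma PComp_eqn a b : PComp P a -> PComp P b -> PComp P (fun x e => a x e == b x e).
Proof. exact: (@PComp2 (fun u v => u == v) a b (@Comp_eqn M)). Qed.

Lemma PComp_succ a : PComp P a -> PComp P (fun x e => (a x e).+1).
Proof.
by move=> ha; apply: eq_PComp (PComp_add ha (PComp_const 1)) => x e _; rewrite addn1.
Qed.
Lemma PComp_pred a : PComp P a -> PComp P (fun x e => (a x e).-1).
Proof.
by move=> ha; apply: eq_PComp (PComp_sub ha (PComp_const 1)) => x e _; rewrite subn1.
Qed.
Lemma PComp_double a : PComp P a -> PComp P (fun x e => (a x e).*2).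
Proof.
by move=> ha; apply: eq_PComp (PComp_add ha ha) => x e _; rewrite addnn.
Qed.
Lemma PComp_expc a k : PComp P a -> PComp P (fun x e => a x e ^ k).
Proof.
move=> ha; elim: k => [|k IH]; first exact: PComp_const.
by apply: eq_PComp (PComp_mul ha IH) => x e _; rewrite expnS.
Qed.
Lemma PComp_not c : PComp P (fun x e => c x e) -> PComp P (fun x e => ~~ c x e).
Proof.
move=> hc; apply: eq_PComp (PComp_eqn hc (PComp_const 0)) => x e _.
by case: (c x e).
Qed.
Lemma PComp_and c d : PComp P (fun x e => c x e) -> PComp P (fun x e => d x e) ->
  PComp P (fun x e => c x e && d x e).
Proof.
move=> hc hd; apply: eq_PComp (PComp_mul hc hd) => x e _.
by case: (c x e); case: (d x e).
Qed.
Lemma PComp_or c d : PComp P (fun x e => c x e) -> PComp P (fun x e => d x e) ->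
  PComp P (fun x e => c x e || d x e).
Proof.
move=> hc hd; apply: eq_PComp (PComp_not (PComp_and (PComp_not hc) (PComp_not hd))).
by move=> x e _; case: (c x e); case: (d x e).
Qed.
Lemma PComp_imp c d : PComp P (fun x e => c x e) -> PComp P (fun x e => d x e) ->
  PComp P (fun x e => c x e ==> d x e).
Proof.
move=> hc hd; apply: eq_PComp (PComp_or (PComp_not hc) hd) => x e _.
by case: (c x e).
Qed.
Lemma PComp_if (c : seq bool -> seq nat -> bool) a b :
  PComp P (fun x e => c x e) -> PComp P a -> PComp P b ->
  PComp P (fun x e => if c x e then a x e else b x e).
Proof.
move=> hc ha hb; apply: eq_PComp (PComp_add (PComp_mul hc ha)
  (PComp_mul (PComp_not hc) hb)) => x e _.
by case: (c x e); rewrite /= ?mul1n ?mul0n ?addn0.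
Qed.
Lemma PComp_ifb c c1 c2 :
  PComp P (fun x e => c x e) -> PComp P (fun x e => c1 x e) -> PComp P (fun x e => c2 x e) ->
  PComp P (fun x e => if c x e then c1 x e else c2 x e).
Proof.
move=> hc h1 h2; apply: eq_PComp (PComp_if hc h1 h2) => x e _.
by case: (c x e).
Qed.

Lemma PComp_inbit a : PComp P a -> PComp P (fun x e => nth false x (a x e)).
Proof.
move=> [a' ca ha]; exists (fun x e => nth false x (a' x e)); first exact: Comp_inbit.
by move=> x e he; rewrite ha.
Qed.

Lemma PComp_table (f : nat -> nat) k a : PComp P a ->
  PComp P (fun x e => if a x e < k then f (a x e) else 0).
Proof.
move=> [a' ca ha]; exists (fun x e => if a' x e < k then f (a' x e) else 0).
  exact: Comp_table.
by move=> x e he; rewrite ha.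
Qed.

(** The power is computed with the cap [g], which it does not exceed under the promise. *)
Lemma PComp_exp a b g : PComp P a -> PComp P b -> PComp P g ->
  (forall x e, P x e -> a x e ^ b x e <= g x e) ->
  PComp P (fun x e => a x e ^ b x e).
Proof.
move=> [a' ca ha] [b' cb hb] [g' cg hg] le.
exists (fun x e => minn (a' x e ^ b' x e) (g' x e)); first exact: Comp_minexp.
by move=> x e he; rewrite ha ?hb ?hg //; apply/minn_idPl/le.
Qed.

Lemma PComp_fact a g : PComp P a -> PComp P g ->
  (forall x e, P x e -> (a x e)`! <= g x e) -> PComp P (fun x e => (a x e)`!).
Proof.
move=> [a' ca ha] [g' cg hg] le.
exists (fun x e => minn (a' x e)`! (g' x e)); first exact: Comp_minfact.
by move=> x e he; rewrite ha ?hg //; apply/minn_idPl/le.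
Qed.

Lemma PComp_sum n (F : seq bool -> seq nat -> nat -> nat) : PComp P n ->
  PComp (plift P (ltQ n)) (fun x e => F x (behead e) (nth 0 e 0)) ->
  PComp P (fun x e => \sum_(i < n x e) F x e i).
Proof.
move=> [n' cn hn] [F' cF hF].
exists (fun x e => \sum_(i < n' x e) F' x (val i :: e)); first exact: Comp_sum_env.
by move=> x e he; rewrite hn //; apply: eq_bigr => i _; apply: hF; split=> //=; apply: ltn_ord.
Qed.

Lemma PComp_all n (F : seq bool -> seq nat -> nat -> bool) : PComp P n ->
  PComp (plift P (ltQ n)) (fun x e => F x (behead e) (nth 0 e 0)) ->
  PComp P (fun x e => all (F x e) (iota 0 (n x e))).
Proof.
move=> hn hF.
have hS : PComp P (fun x e => \sum_(i < n x e) (~~ F x e i)).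
  apply: (PComp_sum (F := fun x e i => ~~ F x e i)) => //.
  have [F' cF hF'] := hF; exists (fun x e => F' x e == 0); first exact: Comp_eq0.
  by move=> x e he; rewrite hF' //; case: (F _ _ _).
apply: eq_PComp (PComp_eqn hS (PComp_const 0)) => x e _; congr nat_of_bool.
rewrite -(count_iota (fun i => ~~ F x e i)); have -> : count (fun i => ~~ F x e i) = count (predC (F x e)) by [].
by rewrite -leqn0 leqNgt -has_count has_predC negbK.
Qed.

Lemma PComp_iter n a (f : seq bool -> seq nat -> nat -> nat) :
  (forall x e v, f x e v <= v) -> PComp P n -> PComp P a ->
  PComp (plift (plift P noQ) noQ) (fun x e => f x (behead (behead e)) (nth 0 e 0)) ->
  PComp P (fun x e => iter (n x e) (f x e) (a x e)).
Proof.
move=> fle [n' cn hn] [a' ca ha] [f' cf hf].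
(* Off the promise [f'] could exceed its argument; the minimum keeps every iterate at most [a']. *)
pose g : fn := fun x e => minn (f' x e) (nth 0 e 0).
exists (fun x e => iteri (n' x e) (fun j acc => g x [:: acc, j & e]) (a' x e)).
  apply: (Comp_rec (B := a')) => //; first exact: Comp_minn cf (Comp_var _ _).
    exact: Comp_PB ca.
  by move=> x e i _; elim: i => //= i; apply: leq_trans; apply: geq_minr.
move=> x e he; rewrite hn ?ha //; elim: (n x e) => //= i ->.
by rewrite /g /= hf //=; apply/minn_idPl.
Qed.

End Ops.

End Promise.

Arguments PComp_lift {M P f Q}.

Section Digits.
Variable M : TM.
Variable P : seq bool -> seq nat -> Prop.
Notation PComp := (@PComp M P).

Lemma PComp_dig B y i : PComp B -> PComp y -> PComp i ->
  PComp (fun x e => dig (B x e) (y x e) (i x e)).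
Proof.
move=> hB hy hi.
have h : PComp (fun x e => iter (i x e) (fun v => v %/ B x e) (y x e)).
  apply: (PComp_iter (f := fun x e v => v %/ B x e)) => //.
    by move=> x e v; apply: leq_div.
  by apply: PComp_div; [exact: PComp_var|exact: (PComp_lift (PComp_lift hB))].
apply: eq_PComp (PComp_mod h hB) => x e _; rewrite /dig; congr (_ %% _).
elim: (i x e) => [|j IH] /=; first by rewrite divn1.
by rewrite IH expnSr divnMA.
Qed.

End Digits.

Ltac pc1 := first
  [ assumption | exact: PComp_const | exact: PComp_size | exact: PComp_var
  | match goal with H : PComp _ _ ?a |- _ =>
      first [exact: (PComp_lift H) | exact: (PComp_lift (PComp_lift H))
            | exact: (PComp_lift (PComp_lift (PComp_lift H))) ] end
  | apply: PComp_dig | apply: PComp_and | apply: PComp_or | apply: PComp_not | apply: PComp_imp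
  | apply: PComp_eqn | apply: PComp_leq
  | apply: PComp_add | apply: PComp_mul | apply: PComp_sub | apply: PComp_div
  | apply: PComp_mod | apply: PComp_succ | apply: PComp_pred | apply: PComp_double
  | apply: PComp_minn | apply: PComp_expc | apply: PComp_inbit
  | lazymatch goal with
    | |- PComp _ _ (fun x e => nat_of_bool (@?b x e)) => apply: PComp_ifb
    | _ => apply: PComp_if end ].
Ltac pc := repeat pc1.

Section Functions.
Variable M : TM.
Variable P : seq bool -> seq nat -> Prop.
Notation PComp := (@PComp M P).

Lemma PComp_up W a : PComp W -> PComp a -> PComp (fun x e => up (W x e) (a x e)).
Proof. by move=> hW ha; rewrite /up; pc. Qed.

Lemma PComp_ci W a : PComp W -> PComp a -> PComp (fun x e => ci (W x e) (a x e)).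
Proof. by move=> hW ha; rewrite /ci; pc. Qed.

Lemma PComp_iter_up W a n : PComp W -> PComp a -> PComp n ->
  PComp (fun x e => iter (n x e) (up (W x e)) (a x e)).
Proof.
move=> hW ha hn; apply: (PComp_iter (f := fun x e => up (W x e))) => //.
  by move=> x e v; apply: leq_trans (leq_div _ _) (leq_pred _).
by rewrite /up; pc.
Qed.

End Functions.

(** * The reduction is computable *)

Section FiniteTables.
Variables (M V : TM) (P : seq bool -> seq nat -> Prop).
Notation PComp := (PComp M P).
Notation nobs := (nobs V).

(** [dec] is constant from [nobs] on: once the codes are capped, finitely many arguments remain and
    a table does. *)
Lemma PComp_fin K (F : nat -> obs V -> obs V -> obs V -> bool) u w0 w1 w2 :
  (forall x e, u x e < K) ->
  PComp u -> PComp w0 -> PComp w1 -> PComp w2 ->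
  PComp (fun x e => F (u x e) (dec V (w0 x e)) (dec V (w1 x e)) (dec V (w2 x e))).
Proof.
move=> uK hu h0 h1 h2; pose s := nobs.+1.
have s0 : 0 < s by [].
pose f c : nat := F (c %/ s %/ s %/ s) (dec V (c %/ s %/ s %% s)) (dec V (c %/ s %% s))
  (dec V (c %% s)).
pose c : fn := fun x e => ((u x e * s + minn (w0 x e) nobs) * s + minn (w1 x e) nobs) * s
  + minn (w2 x e) nobs.
have hc : PComp c by rewrite /c; pc.
apply: eq_PComp (PComp_table f (K * s * s * s) hc) => x e _.
have lm w : minn w nobs < s by rewrite ltnS geq_minr.
rewrite (_ : c x e < _); last by do 3 apply: block_lt => //.
have E a b : b < s -> (a * s + b) %/ s = a by move=> lb; rewrite divnMDl // divn_small ?addn0.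
have E' a b : b < s -> (a * s + b) %% s = b by move=> lb; rewrite modnMDl modn_small.
by rewrite /f /c !E // !E' // !dec_min.
Qed.

End FiniteTables.

Section Reduction.
Variables (M V : TM) (fT fY fm fk : seq bool -> nat).
Notation Comp := (@Comp M).
Notation PComp := (PComp M).
Hypotheses (cT : Comp (fun x _ => fT x)) (cY : Comp (fun x _ => fY x))
  (cm : Comp (fun x _ => fm x)) (ck : Comp (fun x _ => fk x)).

(** A common bound for the factorials and powers met in computing an entry of the adjacency matrix;
    it is what the large register is promised to reach. *)
Definition need x := (fm x).+1`! + q (fm x) ^ fm x + q (fm x) ^ (3 * D (fm x)) +
  aW (fm x) ^ (2 * fk x) + NV (fm x) ^ fk x.

Definition Big P := exists2 g, PComp P g & forall x e, P x e -> need x <= g x e.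

Lemma Big_lift P Q : Big P -> Big (plift P Q).
Proof.
move=> [g cg hg]; exists (fun x e => g x (behead e)); first exact: PComp_lift.
by move=> x e [/hg].
Qed.

Section OnPromise.
Variable P : seq bool -> seq nat -> Prop.
Hypothesis big : Big P.

Lemma PComp_m : PComp P (fun x _ => fm x). Proof. exact: PComp_Comp cm. Qed.
Lemma PComp_k : PComp P (fun x _ => fk x). Proof. exact: PComp_Comp ck. Qed.
Lemma PComp_T : PComp P (fun x _ => fT x). Proof. exact: PComp_Comp cT. Qed.
Lemma PComp_Y : PComp P (fun x _ => fY x). Proof. exact: PComp_Comp cY. Qed.

Lemma PComp_q : PComp P (fun x _ => q (fm x)).
Proof.
have [g cg hg] := big; have := PComp_m => hm; rewrite /q.
apply: PComp_succ; apply: (PComp_fact _ cg); first by pc.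
by move=> x e /hg; apply: leq_trans; rewrite /need; lia.
Qed.

Lemma PComp_D : PComp P (fun x _ => D (fm x)).
Proof. by have hm := PComp_m; rewrite /D; pc. Qed.

Lemma PComp_npt : PComp P (fun x _ => npt (fm x)).
Proof.
have [g cg hg] := big; apply: (PComp_exp PComp_q PComp_m cg) => x e /hg; apply: leq_trans.
by rewrite /need; lia.
Qed.

Lemma PComp_NB : PComp P (fun x _ => NB (fm x)).
Proof.
have [g cg hg] := big; have hD := PComp_D; rewrite /NB.
apply: (PComp_exp PComp_q _ cg) => [|x e /hg]; first by pc.
by apply: leq_trans; rewrite /need; lia.
Qed.

Lemma PComp_NT : PComp P (fun x _ => NT (fm x)).
Proof. exact: PComp_expc PComp_npt. Qed.

Lemma PComp_NV : PComp P (fun x _ => NV (fm x)).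
Proof. exact: PComp_mul PComp_npt PComp_q. Qed.

Lemma PComp_W : PComp P (fun x _ => aW (fm x)).
Proof. by have := PComp_NT; have := PComp_NB; have := PComp_D => *; rewrite /aW; pc. Qed.

Lemma PComp_I : PComp P (fun x _ => NV (fm x) ^ fk x).
Proof.
have [g cg hg] := big; apply: (PComp_exp PComp_NV PComp_k cg) => x e /hg; apply: leq_trans.
exact: leq_addl.
Qed.

Lemma aW_gt0 m : 0 < aW m.
Proof. by rewrite /aW ltn_addr // expn_gt0 npt_gt0. Qed.

End OnPromise.

Section OnPromise2.
Variable P : seq bool -> seq nat -> Prop.
Hypothesis big : Big P.
Let bigl Q : Big (plift P Q) := Big_lift Q big.

Lemma PComp_Z : PComp P (fun x _ => aZ (fm x) (fk x)).
Proof.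
have [g cg hg] := big; have hk := PComp_k P; rewrite /aZ /zc.
apply: (PComp_sum (F := fun x _ i => aW (fm x) ^ i)); first by pc.
apply: (PComp_exp (PComp_W (bigl _)) _ (PComp_lift cg)); first by pc.
move=> x e [/hg he hi]; apply: leq_trans he.
apply: (@leq_trans (aW (fm x) ^ (2 * fk x))); first by rewrite leq_pexp2l ?aW_gt0 // ltnW.
by rewrite /need; lia.
Qed.

Lemma PComp_num_q n d : PComp P n -> (forall x e, P x e -> n x e <= fm x) ->
  PComp (plift P (ltQ n)) (fun x e => d x (behead e) (nth 0 e 0)) ->
  PComp P (fun x e => num (q (fm x)) (n x e) (d x e)).
Proof.
move=> hn ln hd; rewrite /num.
apply: (PComp_sum (F := fun x e i => d x e i * q (fm x) ^ i)) => //.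
apply: PComp_mul hd _.
apply: (PComp_exp (PComp_q (bigl _)) _ (PComp_npt (bigl _))); first by pc.
move=> x e [/ln le hi]; rewrite /npt leq_pexp2l ?q_gt0 //.
exact: leq_trans (ltnW hi) le.
Qed.

Lemma PComp_pt a h t : PComp P a -> PComp P h -> PComp P t ->
  PComp P (fun x e => pt (fm x) (a x e) (h x e) (t x e)).
Proof.
move=> ha hh ht; rewrite /pt; have hm := PComp_m P.
apply: (PComp_num_q (d := fun x e i => (dig (q (fm x)) (a x e) i + t x e * dig (q (fm x)) (h x e) i)
  %% q (fm x))) => //.
have hq := PComp_q (bigl (ltQ (fun x _ => fm x))).
by pc.
Qed.

Lemma PComp_tx a l : PComp P a -> PComp P l ->
  PComp P (fun x e => tx (fm x) (a x e) (l x e)).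
Proof. by move=> ha hl; apply: PComp_dig => //; apply: PComp_npt. Qed.

Lemma PComp_th a l : PComp P a -> PComp P l ->
  PComp P (fun x e => th (fm x) (a x e) (l x e)).
Proof. by move=> ha hl; apply: PComp_dig; [apply: PComp_npt|pc|pc]. Qed.

Lemma PComp_tatom a b j : PComp P a -> PComp P b -> PComp P j ->
  PComp P (fun x e => tatom (fm x) (a x e) (b x e) (j x e)).
Proof.
move=> ha hb hj; have hD := PComp_D P; have hq := PComp_q big; rewrite /tatom.
apply: PComp_add; last exact: PComp_dig.
by apply: PComp_mul => //; apply: PComp_pt; [apply: PComp_tx|apply: PComp_th|]; pc.
Qed.

Lemma PComp_isq a : PComp P a -> PComp P (fun x e => isq (fm x) (a x e)).
Proof.
move=> ha; have hm := PComp_m P; have hq := PComp_q (bigl (ltQ (fun x _ => fm x))).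
apply: (PComp_all (F := fun x e i => dig (q (fm x)) (a x e) i <= 1)) => //.
by by pc.
Qed.

Lemma PComp_ix a : PComp P a -> PComp P (fun x e => ix (fm x) (a x e)).
Proof.
move=> ha; have hm := PComp_m P; have hq := PComp_q (bigl (ltQ (fun x _ => fm x))).
rewrite /ix /num.
apply: (PComp_sum (F := fun x e i => dig (q (fm x)) (a x e) i * 2 ^ i)) => //.
apply: PComp_mul; first by apply: PComp_dig; pc.
apply: (PComp_exp (PComp_const _ _ 2) _ (PComp_npt (bigl _))); first by pc.
move=> x e [_ hi]; rewrite /npt; apply: (@leq_trans (2 ^ fm x)).
  by rewrite leq_pexp2l // ltnW.
by case: (fm x) => // m'; rewrite leq_exp2r // q_gt1.
Qed.

Lemma PComp_bin t : PComp P t -> (forall x e, P x e -> t x e < D (fm x)) ->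
  PComp P (fun x e => 'C((fm x).+1, t x e)).
Proof.
move=> ht lt; have hm := PComp_m P; have hq := PComp_q big.
have lq x j : j <= (fm x).+1 -> j`! <= q (fm x).
  by move=> lj; apply: leq_trans (leq_fact lj) (leqnSn _).
apply: (eq_PComp (f := fun x e => (fm x).+1`! %/ ((t x e)`! * ((fm x).+1 - t x e)`!))).
  move=> x e /lt; rewrite ltnS => l; rewrite -(bin_fact l) mulnK //.
  by rewrite muln_gt0 !fact_gt0.
apply: PComp_div; first by apply: (PComp_fact _ hq); [pc|move=> x e _; apply: lq].
apply: PComp_mul; first by apply: (PComp_fact _ hq) => // x e /lt h; apply: lq.
by apply: (PComp_fact _ hq); [pc|move=> x e _; apply/lq/leq_subr].
Qed.

End OnPromise2.

Lemma PComp_odd P a : PComp P a -> PComp P (fun x e => odd (a x e)).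
Proof.
move=> ha; apply: eq_PComp (_ : PComp P (fun x e => a x e %% 2)); last by pc.
by move=> x e _; rewrite modn2.
Qed.

Section OnPromise3.
Variable P : seq bool -> seq nat -> Prop.
Hypothesis big : Big P.
Let bigl Q : Big (plift P Q) := Big_lift Q big.

Lemma PComp_altchk (b : seq bool -> seq nat -> nat -> nat) :
  PComp (plift P (ltQ (fun x _ => D (fm x)))) (fun x e => b x (behead e) (nth 0 e 0)) ->
  PComp P (fun x e => altchk (fm x) (b x e)).
Proof.
move=> hb; have hD := PComp_D P; have hq := PComp_q big; rewrite /altchk.
set P' := plift _ _ in hb.
have hC : PComp P' (fun x e => 'C((fm x).+1, nth 0 e 0)).
  by apply: (PComp_bin (bigl _)); [pc|move=> x e []].
have h0 : PComp P' (fun x e => if odd (nth 0 e 0) then 0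
    else 'C((fm x).+1, nth 0 e 0) * b x (behead e) (nth 0 e 0)).
  by apply: PComp_if; [apply: PComp_odd; pc|pc|pc].
have h1 : PComp P' (fun x e => if odd (nth 0 e 0) then
    'C((fm x).+1, nth 0 e 0) * b x (behead e) (nth 0 e 0) else 0).
  by apply: PComp_if; [apply: PComp_odd; pc|pc|pc].
apply: PComp_eqn; apply: PComp_mod => //.
- exact: (PComp_sum (F := fun x e t => if odd t then 0 else 'C((fm x).+1, t) * b x e t)).
- exact: (PComp_sum (F := fun x e t => if odd t then 'C((fm x).+1, t) * b x e t else 0)).
Qed.

Lemma PComp_all3 (F : seq bool -> seq nat -> nat -> bool) :
  PComp P (fun x e => F x e 0) -> PComp P (fun x e => F x e 1) ->
  PComp P (fun x e => F x e 2) ->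
  PComp P (fun x e => all (F x e) (iota 0 3)).
Proof.
move=> h0 h1 h2; have h := PComp_and h0 (PComp_and h1 h2).
by apply: eq_PComp h => x e _ /=; rewrite andbT.
Qed.

Lemma PComp_class p : PComp P p -> PComp P (fun x e => class (fT x) (fY x) x (p x e)).
Proof.
by move=> hp; have hT := PComp_T P; have hY := PComp_Y P; rewrite /class /mid; pc.
Qed.

Lemma class_lt T Y x p : class T Y x p < 4.
Proof. by rewrite /class; case: ifP => // _; case: ifP; [case: ifP|case: ifP]. Qed.

Lemma step_ok_min z d (o0 o1 o2 : obs V) :
  step_ok z d o0 o1 o2 = step_ok z (minn d 3) o0 o1 o2.
Proof.
rewrite /step_ok; congr (_ && _); apply: eq_forallb => i; congr (_ ==> _).
by case: ((trans_of o0).2 i).2 => /=; apply/eqP/eqP; lia.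
Qed.

Lemma PComp_chk v0 v1 v2 w0 w1 w2 :
  PComp P v0 -> PComp P v1 -> PComp P v2 -> PComp P w0 -> PComp P w1 -> PComp P w2 ->
  PComp P (fun x e => chk V (fT x) (fY x) x (v0 x e) (v1 x e) (v2 x e)
                          (w0 x e) (w1 x e) (w2 x e)).
Proof.
move=> h0 h1 h2 g0 g1 g2; have hT := PComp_T P; have hY := PComp_Y P.
have hwd : PComp P (fun x _ => wd (fT x)) by rewrite /wd; pc.
have hc : PComp P (fun x _ => mid (fT x)) by rewrite /mid; pc.
have hini : PComp P (fun x e => ini_ok (class (fT x) (fY x) x (v0 x e %% wd (fT x))) (dec V (w0 x e))).
  apply: (PComp_fin (K := 4) (fun u o _ _ => ini_ok u o) (w1 := w0) (w2 := w0)) => //.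
    by move=> x e; apply: class_lt.
  by apply: PComp_class; pc.
have hz : PComp P (fun _ _ => 0) by pc.
have hb w : PComp P w -> PComp P (fun x e => blank_ok (dec V (w x e))).
  move=> hw; exact: (PComp_fin (K := 1) (u := fun _ _ => 0) (fun u o _ _ => blank_ok o)
    (w0 := w) (w1 := w) (w2 := w)).
have ha : PComp P (fun x e => acc_ok (dec V (w0 x e))).
  exact: (PComp_fin (K := 1) (u := fun _ _ => 0) (fun u o _ _ => acc_ok o)
    (w0 := w0) (w1 := w0) (w2 := w0)).
have hn : PComp P (fun x e => nxt_ok (dec V (w0 x e))).
  exact: (PComp_fin (K := 1) (u := fun _ _ => 0) (fun u o _ _ => nxt_ok o)
    (w0 := w0) (w1 := w0) (w2 := w0)).
have hs : PComp P (fun x e => step_ok (v1 x e %% wd (fT x) == mid (fT x))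
    ((v1 x e %% wd (fT x)).+1 - v2 x e %% wd (fT x)) (dec V (w0 x e)) (dec V (w1 x e)) (dec V (w2 x e))).
  pose u : fn := fun x e => (v1 x e %% wd (fT x) == mid (fT x)) * 4 +
    minn ((v1 x e %% wd (fT x)).+1 - v2 x e %% wd (fT x)) 3.
  have hu : PComp P u by rewrite /u; pc.
  have lu x e : u x e < 8.
    by rewrite /u; case: eqP => _ /=; have := geq_minr ((v1 x e %% wd (fT x)).+1 - v2 x e %% wd (fT x)) 3; lia.
  apply: eq_PComp (PComp_fin (fun u o0 o1 o2 => step_ok (u %/ 4 == 1) (u %% 4) o0 o1 o2)
    lu hu g0 g1 g2) => x e _.
  rewrite [in RHS]step_ok_min; congr (nat_of_bool (step_ok _ _ _ _ _)); rewrite /u.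
    by rewrite divnMDl // divn_small ?addn0 ?ltnS ?geq_minr //; case: (_ %% _ == _).
  by rewrite modnMDl modn_small // ltnS geq_minr.
have hb0 := hb _ g0; have hb1 := hb _ g1.
by rewrite /chk; pc.
Qed.

Definition chkx x := chk V (fT x) (fY x) x.

Lemma PComp_valid a b : PComp P a -> PComp P b ->
  PComp P (fun x e => valid (fm x) (chkx x) (a x e) (b x e)).
Proof.
move=> ha hb; have hD := PComp_D P; have hq := PComp_q big; rewrite /valid.
have hl (l : nat) : PComp P (fun x e => altchk (fm x) (fun t => dig (q (fm x)) (b x e) (l * D (fm x) + t))).
  apply: (PComp_altchk (b := fun x e t => dig (q (fm x)) (b x e) (l * D (fm x) + t))).
  by have hq' := PComp_q (bigl (ltQ (fun x _ => D (fm x)))); have hD' := PComp_D (plift P (ltQ (fun x _ => D (fm x)))); apply: PComp_dig; pc.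
have htx (l : nat) : PComp P (fun x e => tx (fm x) (a x e) l) by apply: PComp_tx; pc.
apply: PComp_and.
  by apply: (PComp_all3 (F := fun x e l => altchk (fm x) (fun t => dig (q (fm x)) (b x e) (l * D (fm x) + t)))).
apply: PComp_imp.
  by apply: (PComp_all3 (F := fun x e l => isq (fm x) (tx (fm x) (a x e) l))); apply: PComp_isq.
by apply: PComp_chk; try (by apply: PComp_ix); apply: PComp_dig; pc.
Qed.

Lemma PComp_dep a : PComp P a -> PComp P (fun x e => dep (fm x) (fk x) (a x e)).
Proof.
move=> ha; have hk := PComp_k P.
apply: (PComp_sum (F := fun x e j => iter j (up (aW (fm x))) (a x e) != 0)); first by pc.
apply: PComp_not; apply: PComp_eqn; last by pc.
by apply: (PComp_iter_up (PComp_W (bigl _))); pc.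
Qed.

Lemma PComp_gact a g : PComp P a -> PComp P g ->
  PComp P (fun x e => gact (fm x) (fk x) (chkx x) (a x e) (g x e)).
Proof.
move=> ha hg; have hW := PComp_W big; have hB := PComp_NB big; rewrite /gact.
apply: PComp_ifb; [apply/PComp_odd/PComp_dep; pc| |pc].
by apply: PComp_and; [pc|apply: PComp_valid => //; apply: PComp_ci].
Qed.

Lemma PComp_gmem a g c : PComp P a -> PComp P g -> PComp P c ->
  PComp P (fun x e => gmem (fm x) (fk x) (a x e) (g x e) (c x e)).
Proof.
move=> ha hg hc; have hD := PComp_D P; have hT := PComp_NT big; rewrite /gmem.
by apply: PComp_ifb; [apply/PComp_odd/PComp_dep; pc|pc|pc].
Qed.

End OnPromise3.

(** The recursion becomes a sum over ancestors, to which [PComp_sum] applies. *)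
Lemma plabE m i z : plab m i z =
  \sum_(l < i) atomof m (iter (2 * l) (up (aW m)) z) * NV m ^ l.
Proof.
elim: i z => [|i IH] z; first by rewrite big_ord0.
rewrite big_ord_recl [plab _ _ _]/= muln0 expn0 muln1 addnC IH big_distrl; congr (_ + _).
apply: eq_bigr => l _; rewrite lift0 [LHS]/= -mulnA -expnSr; congr (atomof m _ * _).
by rewrite mulnS !iterSr.
Qed.

Section OnPromise4.
Variable P : seq bool -> seq nat -> Prop.
Hypothesis big : Big P.
Let bigl Q : Big (plift P Q) := Big_lift Q big.

Lemma PComp_atomof z : PComp P z -> PComp P (fun x e => atomof (fm x) (z x e)).
Proof.
move=> hz; have hD := PComp_D P; have hW := PComp_W big; have hV := PComp_NV big; rewrite /atomof.
have hc : PComp P (fun x e => ci (aW (fm x)) (z x e)) by apply: PComp_ci.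
have hu : PComp P (fun x e => ci (aW (fm x)) (up (aW (fm x)) (z x e))).
  by apply: PComp_ci => //; apply: PComp_up.
by apply: PComp_mod => //; apply: PComp_tatom => //; pc.
Qed.

End OnPromise4.

Section OnPromise5.
Variable P : seq bool -> seq nat -> Prop.
Hypothesis big : Big P.
Let bigl Q : Big (plift P Q) := Big_lift Q big.

Lemma PComp_plab z : PComp P z -> PComp P (fun x e => plab (fm x) (fk x) (z x e)).
Proof.
move=> hz; have hk := PComp_k P.
apply: (eq_PComp (f := fun x e => \sum_(l < fk x)
   atomof (fm x) (iter (2 * l) (up (aW (fm x))) (z x e)) * NV (fm x) ^ l)).
  by move=> x e _; rewrite plabE.
apply: (PComp_sum (F := fun x e l => atomof (fm x) (iter (2 * l) (up (aW (fm x))) (z x e))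
   * NV (fm x) ^ l)); first by pc.
apply: PComp_mul.
  apply: (PComp_atomof (bigl _)); apply: (PComp_iter_up (PComp_W (bigl _))); pc.
apply: (PComp_exp (PComp_NV (bigl _)) _ (PComp_I (bigl _))); first by pc.
move=> x e [_ hl]; rewrite leq_pexp2l ?(ltnW hl) //.
by rewrite /NV muln_gt0 npt_gt0.
Qed.

Lemma PComp_adj0 u v : PComp P u -> PComp P v ->
  PComp P (fun x e => adj0 (aW (fm x)) (aZ (fm x) (fk x)) (NV (fm x) ^ fk x)
     (gact (fm x) (fk x) (chkx x)) (gmem (fm x) (fk x)) (plab (fm x) (fk x)) (u x e) (v x e)).
Proof.
move=> hu hv; have hW := PComp_W big; have hZ := PComp_Z big; have hI := PComp_I big.
have hM : PComp P (fun x _ => nM (aW (fm x)) (aZ (fm x) (fk x))) by rewrite /nM; pc.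
have hidx w : PComp P w -> PComp P (fun x e => idx (aW (fm x)) (NV (fm x) ^ fk x) (w x e)).
  by move=> hw; rewrite /idx; pc.
have hadr w : PComp P w -> PComp P (fun x e => adr (aW (fm x)) (aZ (fm x) (fk x)) (NV (fm x) ^ fk x) (w x e)).
  by move=> hw; rewrite /adr; pc.
have hcp w : PComp P w -> PComp P (fun x e => cp (aW (fm x)) (aZ (fm x) (fk x)) (NV (fm x) ^ fk x) (w x e)).
  by move=> hw; rewrite /cp; pc.
have hiu := hidx _ hu; have hiv := hidx _ hv; have hau := hadr _ hu; have hav := hadr _ hv.
have hcu := hcp _ hu; have hcv := hcp _ hv.
have hlab := PComp_plab hav.
have hup := PComp_up hW hav; have hci := PComp_ci hW hav.
have hg := PComp_sub hiu (PComp_const M P 4).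
have hact := PComp_gact big hau hg; have hmem := PComp_gmem big hau hg hci.
rewrite /adj0 /hubadj /cadj /gateadj; pc.
Qed.

Lemma PComp_adj u v : PComp P u -> PComp P v ->
  PComp P (fun x e => adj (aW (fm x)) (aZ (fm x) (fk x)) (NV (fm x) ^ fk x)
     (gact (fm x) (fk x) (chkx x)) (gmem (fm x) (fk x)) (plab (fm x) (fk x)) (u x e) (v x e)).
Proof. by move=> hu hv; rewrite /adj; apply: PComp_or; apply: PComp_adj0. Qed.

Lemma PComp_nodes : PComp P (fun x _ => nodes (fm x) (fk x)).
Proof.
have hW := PComp_W big; have hZ := PComp_Z big; have hI := PComp_I big.
by rewrite /nodes /nN /nM /nR; pc.
Qed.

End OnPromise5.

End Reduction.

(** * The main program *)

Section Main.
Variable M : TM.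
Notation st := (st M).
Notation Comp := (@Comp M).
Notation runsB := (@runsB M).

(** The registers change during a loop, whereas its time bound has to be a fixed function of the
    initial data. *)
Lemma PB_uniform (T h : fn) k : PB T -> PB h -> exists2 U : fn, PB U &
  forall x e e', size e' = k -> (forall i, nth 0 e' i <= h x e) -> T x e' <= U x e.
Proof.
move=> [c hc] ph; exists (fun x e => (size x + k * h x e + 2) ^ c).
  apply: PB_exp; apply: PB_add (PB_const 2); apply: PB_add PB_size _.
  exact: PB_mul (PB_const k) ph.
move=> x e e' sk he; apply: leq_trans (hc _ _) _; case: c {hc} => // c.
rewrite leq_exp2r // /sz leq_add2r leq_add2l -sk.
elim: e' {sk} he => //= v e' IH he; rewrite mulSn leq_add //; first exact: (he 0).
by apply: IH => i; apply: (he i.+1).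
Qed.

Lemma wput_inp (p : seq bool) b :
  act (fun z => inp (maux M) p (z + (size p)%:Z)%R) (Some (inl b)) MoveR =
  (fun z => inp (maux M) (rcons p b) (z + (size (rcons p b))%:Z)%R).
Proof.
apply/funext => z; rewrite /act /= size_rcons.
case: eqP => [z1|z1].
  rewrite (_ : (z + (size p).+1%:Z)%R = Posz (size p)); last by lia.
  by rewrite inp_nth size_rcons ltnSn nth_rcons ltnn eqxx.
rewrite (_ : (z + (size p).+1%:Z)%R = (z + 1 + (size p)%:Z)%R); last by lia.
have : (z + 1 + (size p)%:Z)%R != Posz (size p) by apply/eqP; lia.
case: (z + 1 + (size p)%:Z)%R => [k|k] //= nk; rewrite map_rcons nth_rcons size_map.
case: ltngtP => // h; first by rewrite nth_default // size_map ltnW.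
by rewrite h eqxx in nk.
Qed.

(** Register [r] holds a bit. If it is 1, [Dec r] makes it 0 and the second [Jz] skips [F false]. *)
Definition putb (F : bool -> instr) r := [:: Jz r 4; F true; Dec r; Jz r 2; F false].

Lemma runsB_putb F r (b : bool) (s : st) : F = WPut \/ F = Fin -> rg s r = b ->
  runsB (putb F r) s (exec_st (F b) (setr s r 0)) 4.
Proof.
move=> FE rb; exists (if b then 4 else 2); first by case: b {rb}.
move=> pre post; set G := @stepG M (pre ++ putb F r ++ post).
have sG j s' : j < 5 -> G (size pre + j, s') =
  (minn (size pre + (5 + size post)) (exec_pc (nth InR (putb F r) j) (size pre + j) s'),
   exec_st (nth InR (putb F r) j) s') by move=> h; rewrite /G step_in.
have mE k : k < 5 -> minn (size pre + (5 + size post)) (size pre + k) = size pre + k by lia.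
rewrite -[X in (X, s)]addn0; case: b rb => rb.
  do 3 rewrite iterSr.
  by case: FE => FE; do 4 rewrite sG // FE [exec_pc _ _ _]/= /= ?rb ?eqxx /= -?addnS ?mE //;
     congr pair; try lia; apply: st_ext => //= r'; case: eqP.
rewrite iterSr; case: FE => FE; rewrite sG // FE [exec_pc _ _ _]/= rb /= addn0 mE //;
  rewrite sG // FE [exec_pc _ _ _]/= /=; congr pair; try lia;
  by apply: st_ext => //= r'; case: eqP => // ->.
Qed.

Definition putc := putb WPut.

Lemma runsB_put r (b : bool) p (s : st) : rg s r = b ->
  wt s = (fun z => inp _ p (z + (size p)%:Z)%R) ->
  runsB (putc r) s (St (fun r' => if r' == r then 0 else rg s r') (it s)
    (fun z => inp _ (rcons p b) (z + (size (rcons p b))%:Z)%R)) 4.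
Proof.
move=> rb wp; apply: runsB_eq (runsB_putb (or_introl erefl) rb) => //.
by apply: st_ext => //=; rewrite wp wput_inp.
Qed.

Definition finc := putb Fin.

Lemma runsB_fin r (b : bool) (s : st) : rg s r = b ->
  runsB (finc r) s (St (fun r' => if r' == r then 0 else rg s r')
    (act (it s) (Some (inl b)) Stay) (wt s)) 4.
Proof. exact: runsB_putb (or_intror erefl). Qed.

(** [fG x] will be superpolynomial in [size x]. It is computed once, by doubling, and then passed as
    an argument to the other programs: it counts in their [sz] and serves as the promised large
    register. *)
Variables (fG : seq bool -> nat) (fE : seq bool -> nat).
Variables (fN fA fK : fn).
Variables (N K : seq bool -> nat) (A : seq bool -> nat -> nat -> bool).
Hypotheses (cE : Comp (fun x _ => fE x)) (cN : Comp fN) (cA : Comp fA) (cK : Comp fK).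
Hypotheses (GE : forall x, fG x = 2 ^ fE x).
Hypotheses (NE : forall x, fN x [:: fG x] = N x).
Hypotheses (KE : forall x, fK x [:: fG x] = K x).
Hypotheses (AE : forall x i j, i < N x -> j < N x ->
  fA x [:: i; j; fG x] = A x i j).
Hypotheses (NG : forall x, N x <= fG x) (KG : forall x, K x <= fG x).

Definition regs (l : seq nat) (r : nat) : nat := nth 0 l r.

Lemma Comp_run f (loc : seq nat) t (h : fn) : Comp f -> all (fun r => r < t) loc -> PB h ->
  exists C (U : fn), PB U /\ forall x e l w,
    size l = t -> (forall r, nth 0 l r <= h x e) ->
    runsB C (St (regs l) (inp _ x) w)
      (St (regs (rcons l (f x [seq nth 0 l r | r <- loc]))) (inp _ x) w) (U x e).
Proof.
move=> [_ cf] ht ph; have [C [T [pT hC]]] := cf loc t ht.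
have [U pU hU] := PB_uniform (size loc) pT ph.
exists C, U; split=> // x e l w sl hl.
have := hC x (St (regs l) (inp _ x) w) erefl; rewrite /=.
have -> : [seq regs l r | r <- loc] = [seq nth 0 l r | r <- loc] by [].
move=> run; apply: runsB_le (runsB_eq _ (run _)).
- apply: hU; first by rewrite size_map.
  move=> i; have [li|gi] := ltnP i (size loc); first by rewrite (nth_map 0).
  by rewrite nth_default ?size_map.
- apply: st_ext => //= r; rewrite /regs nth_rcons sl; case: ltngtP => // h'.
  by rewrite nth_default // sl ltnW.
- by move=> r tr; rewrite /regs nth_default // sl.
Qed.

Let G1 : fn := fun _ e => nth 0 e 0.
Let pG1 : PB G1 := PB_nth 0.

(* In all that follows, register 0 is scratch, 1 holds [fG x] and 2 holds [N x]. *)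
Lemma pow_code : exists C (U : fn), PB U /\ forall x w,
  runsB C (St (regs [::]) (inp _ x) w) (St (regs [:: 0; fG x]) (inp _ x) w)
    (U x [:: fG x]).
Proof.
have [C1 [U1 [pU1 h1]]] := @Comp_run _ [::] 0 G1 cE isT pG1.
pose body := loopc 1 [:: Inc 2; Inc 2] ++ loopc 2 [:: Inc 1].
exists (C1 ++ [:: Inc 1] ++ loopc 0 body).
exists (fun x e => U1 x e + (1 + (nth 0 e 0 * (nth 0 e 0 * 13 + 2 + 3) + 1))); split.
  apply: PB_add pU1 (PB_add (PB_const 1) (PB_add (PB_mul pG1 _) (PB_const 1))).
  exact: PB_add (PB_add (PB_mul pG1 (PB_const _)) (PB_const _)) (PB_const _).
move=> x w; apply: runsB_cat.
  by apply: (h1 x [:: fG x] [::] w) => // r; rewrite nth_nil.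
apply: runsB_cat; first exact: runsB_inc.
have EG : fE x <= fG x by rewrite GE ltnW // ltn_expl.
pose S i : st := St (fun r => if r == 0 then fE x - i else if r == 1 then 2 ^ i else 0) (inp _ x) w.
apply: runsB_le (runsB_eq _ (_ : runsB _ _ (S (fE x)) (fE x * (fG x * 13 + 2 + 3) + 1))).
- by rewrite leq_add2r leq_mul2r EG orbT.
- rewrite /S subnn GE; apply: st_ext => //= -[|[|r]] //=.
  by rewrite /regs /= nth_nil.
set s0 := (X in runsB _ X _ _).
have -> : s0 = S 0.
  by apply: st_ext => //= -[|[|r]] //=; rewrite ?subn0 // /regs /= ?nth_nil.
apply: runsB_loop => i li //.
have l2 : 2 ^ i.+1 <= fG x by rewrite GE leq_pexp2l.
pose k := 2 ^ i.
pose S' j : st := St (fun r => if r == 0 then fE x - i.+1 else if r == 1 then k - j else if r == 2 then 2 * j else 0) (inp _ x) w.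
apply: runsB_le (runsB_cat (s2 := S' k) (B1 := k * (2 + 3) + 1) (B2 := (2 * k) * 4 + 1) _ _).
- by move: l2; rewrite expnS -/k; lia.
- have -> : setr (S i) 0 (fE x - i.+1) = S' 0.
    by apply: st_ext => //= -[|[|[|r]]] //=; rewrite subn0.
  apply: runsB_loop => j lj //.
  apply: (runsB_cat (B1 := 1) (B2 := 1) (C1 := [:: _])); first exact: runsB_inc.
  apply: runsB_eq (runsB_inc _ _ _) => //.
  by apply: st_ext => //= -[|[|[|r]]] //=; lia.
- apply: runsB_le (runsB_eq _ (@runsB_move M 2 1 (S' k) _ _)) => //=.
    apply: st_ext => //= -[|[|[|r]]] //=.
    by rewrite expnS.
  by rewrite subnn.
Qed.

Definition row x i := [seq A x i j | j <- iota 0 (N x)].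
Definition pre x i j := flatten [seq row x i' | i' <- iota 0 i] ++ [seq A x i j' | j' <- iota 0 j].
Definition gcode x := flatten [seq row x i | i <- iota 0 (N x)].

Lemma outputs_within_le (M' : TM) t t' x y : t <= t' ->
  outputs_within M' t x y -> outputs_within M' t' x y.
Proof.
move=> /subnK <-; rewrite /outputs_within iterD; set c := iter t _ _ => -[h <-].
suff -> : iter (t' - t) (@step M') c = c by [].
by elim: (t' - t) => //= n ->; rewrite /step h.
Qed.

Lemma iota_rcons m n : iota m n.+1 = rcons (iota m n) (m + n).
Proof. by rewrite -addn1 iotaD cats1. Qed.

Lemma preS x i j : pre x i j.+1 = rcons (pre x i j) (A x i j).
Proof. by rewrite /pre iota_rcons map_rcons rcons_cat. Qed.

Lemma pre_row x i : pre x i (N x) = pre x i.+1 0.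
Proof. by rewrite /pre iota_rcons map_rcons flatten_rcons cats0. Qed.

Definition wend (p : seq bool) : int -> msym M := fun z => inp _ p (z + (size p)%:Z)%R.

Definition rst x (l : seq nat) w : st := St (regs l) (inp _ x) w.

Ltac rg_eq := apply: st_ext => //; rewrite /regs /=;
  do 9? (case=> [|] /=; first by rewrite ?subn0 ?subnn); move=> ?; rewrite ?nth_nil //.

Lemma runsB_clear_reg t x l v w : size l = t ->
  runsB (loopc t [::]) (rst x (rcons l v) w) (rst x l w) (v * 3 + 1).
Proof.
move=> sl; apply: runsB_le (runsB_eq _ (runsB_clear _ _)).
- by rewrite /= /regs nth_rcons sl ltnn eqxx.
- apply: st_ext => //= r; rewrite /regs nth_rcons sl; case: ltngtP => // h.
    by rewrite nth_default // sl ltnW.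
  by rewrite nth_default // sl h.
Qed.

(** Registers 3 and 4 hold the number of rows left and the current row, 5 and 6 the same for the
    columns, and 7 the entry. *)
Lemma rows_code : exists C (U : fn), PB U /\ forall x,
  runsB C (rst x [:: 0; fG x; N x] (blank _)) (rst x [:: 0; fG x; N x] (wend (gcode x)))
    (U x [:: fG x]).
Proof.
have cV : Comp (fun _ e => nth 0 e 0) by exact: Comp_var.
have [C1 [U1 [pU1 h1]]] := @Comp_run _ [:: 2] 3 G1 cV isT pG1.
have [C2 [U2 [pU2 h2]]] := @Comp_run _ [:: 2] 5 G1 cV isT pG1.
have [C3 [U3 [pU3 h3]]] := @Comp_run _ [:: 4; 6; 1] 7 G1 cA isT pG1.
pose inner := C3 ++ putc 7 ++ [:: Inc 6].
pose outer := C2 ++ loopc 5 inner ++ loopc 6 [::] ++ [:: Inc 4].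
exists (C1 ++ loopc 3 outer ++ loopc 4 [::]).
pose Bi : fn := fun x e => U3 x e + (4 + 1).
pose Bo : fn := fun x e => U2 x e + ((G1 x e * (Bi x e + 3) + 1) + ((G1 x e * 3 + 1) + 1)).
exists (fun x e => U1 x e + ((G1 x e * (Bo x e + 3) + 1) + (G1 x e * 3 + 1))).
have pBi : PB Bi by apply: PB_add pU3 (PB_const _).
have pBo : PB Bo.
  apply: PB_add pU2 (PB_add (PB_add (PB_mul pG1 (PB_add pBi (PB_const _))) (PB_const _)) _).
  exact: PB_add (PB_add (PB_mul pG1 (PB_const _)) (PB_const _)) (PB_const _).
split.
  apply: PB_add pU1 (PB_add (PB_add (PB_mul pG1 (PB_add pBo (PB_const _))) (PB_const _)) _).
  exact: PB_add (PB_mul pG1 (PB_const _)) (PB_const _).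
move=> x; have lN := NG x; set g := fG x in lN *; set n := N x in lN *.
have G1E : G1 x [:: g] = g by [].
apply: runsB_cat.
  by apply: (h1 x [:: g] [:: 0; g; n]) => // -[|[|[|r]]] //=; rewrite nth_nil.
pose S i := rst x [:: 0; g; n; n - i; i] (wend (pre x i 0)).
apply: (runsB_cat (s2 := S n)); last first.
  apply: runsB_le (runsB_eq _ (@runsB_clear_reg 4 x [:: 0; g; n; n - n] n _ erefl)).
    by rewrite leq_add2r leq_mul2r lN orbT.
  rewrite /gcode /pre cats0 -/n; by rg_eq.
apply: runsB_le (_ : n * (Bo x [:: g] + 3) + 1 <= _) _.
  by rewrite leq_add2r leq_mul2r lN orbT.
have S0 : rst x [:: 0; g; n; n] (blank _) = S 0.
  rewrite /S /pre /= /wend; apply: st_ext => [r| |] //=.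
    by rewrite /regs; do 6? (case: r => [|r] //=); rewrite ?subn0 ?nth_nil.
  by apply/funext => z; rewrite inp_nil.
rewrite [X in runsB _ X _ _]S0; apply: runsB_loop => i li //.
apply: (runsB_cat (s2 := rst x [:: 0; g; n; n - i.+1; i; n] (wend (pre x i 0)))).
  apply: runsB_eq (_ : runsB _ _ (rst x [:: 0; g; n; n - i.+1; i; n] _) _) => //.
  have -> : setr (S i) 3 (n - i.+1) = rst x [:: 0; g; n; n - i.+1; i] (wend (pre x i 0)).
    by rg_eq.
  apply: (h2 x [:: g] [:: 0; g; n; n - i.+1; i]) => // -[|[|[|[|[|r]]]]] //=; rewrite ?nth_nil //.
    by apply: leq_trans (leq_subr _ _) lN.
  by apply: leq_trans (ltnW li) lN.
pose S' j := rst x [:: 0; g; n; n - i.+1; i; n - j; j] (wend (pre x i j)).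
apply: (runsB_cat (s2 := S' n)).
  apply: runsB_le (_ : n * (Bi x [:: g] + 3) + 1 <= _) _.
    by rewrite leq_add2r leq_mul2r lN orbT.
  have -> : rst x [:: 0; g; n; n - i.+1; i; n] (wend (pre x i 0)) = S' 0 by rg_eq.
  apply: runsB_loop => j lj //.
  have -> : setr (S' j) 5 (n - j.+1) = rst x [:: 0; g; n; n - i.+1; i; n - j.+1; j] (wend (pre x i j)).
    by rg_eq.
  apply: (runsB_cat (s2 := rst x [:: 0; g; n; n - i.+1; i; n - j.+1; j; A x i j : nat] (wend (pre x i j)))).
    have := h3 x [:: g] [:: 0; g; n; n - i.+1; i; n - j.+1; j] (wend (pre x i j)) erefl.
    rewrite /= AE //; apply => -[|[|[|[|[|[|[|r]]]]]]] //=; rewrite ?nth_nil //.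
    - by apply: leq_trans (leq_subr _ _) lN.
    - by apply: leq_trans (ltnW li) lN.
    - by apply: leq_trans (leq_subr _ _) lN.
    - by apply: leq_trans (ltnW lj) lN.
  apply: runsB_cat; first exact: (@runsB_put 7 (A x i j) (pre x i j)).
  apply: runsB_eq (runsB_inc _ _ _) => //.
  rewrite /S' /wend preS; by rg_eq.
apply: (runsB_cat (s2 := rst x [:: 0; g; n; n - i.+1; i] (wend (pre x i n)))).
  apply: runsB_le (runsB_eq _ (@runsB_clear_reg 6 x [:: 0; g; n; n - i.+1; i; n - n] n _ erefl)).
    by rewrite leq_add2r leq_mul2r lN orbT.
  by rg_eq.
apply: runsB_eq (runsB_inc _ _ _) => //.
rewrite /S -pre_row; by rg_eq.
Qed.

Lemma size_gcode x : size (gcode x) = N x * N x.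
Proof.
rewrite /gcode size_flatten /shape -map_comp.
have -> : [seq (size \o row x) i | i <- iota 0 (N x)] = nseq (N x) (N x).
  apply: (@eq_from_nth _ 0); first by rewrite size_map size_iota size_nseq.
  move=> i; rewrite size_map size_iota => li.
  by rewrite (nth_map 0) ?size_iota //= /row size_map size_iota nth_nseq li.
by rewrite sumn_nseq.
Qed.

Lemma rewind_code : exists C (U : fn), PB U /\ forall x,
  runsB C (rst x [:: 0; fG x; N x] (wend (gcode x))) (rst x [:: 0; fG x; N x] (inp _ (gcode x)))
    (U x [:: fG x]).
Proof.
have cV : Comp (fun _ e => nth 0 e 0 * nth 0 e 0) by apply: Comp_mul; exact: Comp_var.
have [C1 [U1 [pU1 h1]]] := @Comp_run _ [:: 2] 3 G1 cV isT pG1.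
exists (C1 ++ loopc 3 [:: WL]).
exists (fun x e => U1 x e + (G1 x e * G1 x e * (1 + 3) + 1)); split.
  apply: PB_add pU1 (PB_add (PB_mul (PB_mul pG1 pG1) (PB_const _)) (PB_const _)).
move=> x; have lN := NG x; set g := fG x in lN *; set n := N x in lN *.
apply: runsB_cat.
  by apply: (h1 x [:: g] [:: 0; g; n]) => // -[|[|[|r]]] //=; rewrite nth_nil.
rewrite [rcons _ _]/= -[[:: 0; g; n; n * n]]/[:: 0; g; n; n * n].
pose S i := rst x [:: 0; g; n; n * n - i] (fun z => inp _ (gcode x) (z + (n * n - i)%:Z)%R).
apply: runsB_le (runsB_eq _ (_ : runsB _ _ (S (n * n)) (n * n * (1 + 3) + 1))).
- by rewrite leq_add2r leq_mul2r leq_mul ?orbT.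
- rewrite /S subnn; apply: st_ext => //=.
    by rewrite /regs; do 4? (case=> [|] //=); move=> r; rewrite ?nth_nil.
  by apply/funext => z; rewrite addr0.
have S0 : rst x [:: 0; g; n; n * n] (wend (gcode x)) = S 0.
  by rewrite /S subn0 /wend size_gcode.
rewrite [X in runsB _ X _ _]S0; apply: runsB_loop => i li //.
have -> : S i.+1 = exec_st WL (setr (S i) 3 (n * n - i.+1)).
  apply: st_ext => //=.
    by rewrite /regs; do 4? (case=> [|] //=); move=> r; rewrite ?nth_nil.
  by apply/funext => z; rewrite /mv /=; congr inp; lia.
exact: runsB_instr.
Qed.

Lemma prog1_code : exists C (U : fn), PB U /\ forall x,
  runsB C (St (fun=> 0) (inp _ x) (blank _)) (rst x [:: 0; fG x; N x] (inp _ (gcode x)))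
    (U x [:: fG x]).
Proof.
have [C1 [U1 [pU1 h1]]] := pow_code.
have [C2 [U2 [pU2 h2]]] := @Comp_run _ [:: 1] 2 G1 cN isT pG1.
have [C3 [U3 [pU3 h3]]] := rows_code.
have [C4 [U4 [pU4 h4]]] := rewind_code.
exists (C1 ++ C2 ++ C3 ++ C4), (fun x e => U1 x e + (U2 x e + (U3 x e + U4 x e))).
split; first exact: PB_add pU1 (PB_add pU2 (PB_add pU3 pU4)).
move=> x; apply: runsB_cat.
  apply: runsB_eq (_ : runsB _ _ (rst x [:: 0; fG x] (blank _)) _) => //.
  have -> : St (fun=> 0) (inp _ x) (blank _) = rst x [::] (blank (maux M)).
    by apply: st_ext => //= r; rewrite /regs nth_nil.
  exact: h1.
apply: runsB_cat; last exact: runsB_cat (h3 x) (h4 x).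
have := h2 x [:: fG x] [:: 0; fG x] (blank _) erefl; rewrite /= NE; apply.
by move=> [|[|r]] //=; rewrite nth_nil.
Qed.

Lemma prog2_code : exists C (U : fn), PB U /\ forall x y w,
  size y = N x -> outs w y ->
  exists s3, runsB C (rst x [:: 0; fG x; N x] w) s3 (U x [:: fG x]) /\
    outs (it s3) [:: count id y < K x].
Proof.
have cV : Comp (fun _ e => nth 0 e 0) by exact: Comp_var.
have cS : Comp (fun x _ => size x) by exact: Comp_size.
have cL : Comp (fun _ e => (nth 0 e 0).+1 <= nth 0 e 1).
  by apply: Comp_leq; [apply: Comp_succ|]; exact: Comp_var.
have pGS : PB (fun x e => G1 x e + size x) by exact: PB_add pG1 PB_size.
have [C1 [U1 [pU1 h1]]] := @Comp_run _ [:: 2] 3 G1 cV isT pG1.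
have [C2 [U2 [pU2 h2]]] := @Comp_run _ [:: 1] 5 G1 cK isT pG1.
have [C3 [U3 [pU3 h3]]] := @Comp_run _ [:: 4; 5] 6 G1 cL isT pG1.
have [C4 [U4 [pU4 h4]]] := @Comp_run _ [::] 7 (fun x e => G1 x e + 1) cS isT
  (PB_add pG1 (PB_const 1)).
(* The answer is written on the first blank after the input word: inside the word, the bits to its
   right would belong to the output. *)
exists (C1 ++ loopc 3 (ifw [:: Inc 4] ++ [:: WR]) ++ C2 ++ C3 ++ C4 ++ loopc 7 [:: InR] ++ finc 6).
exists (fun x e => U1 x e + ((G1 x e * (2 + 1 + 3) + 1) + (U2 x e + (U3 x e + (U4 x e + (size x * (1 + 3) + 1 + 4)))))).
split.
  apply: PB_add pU1 (PB_add (PB_add (PB_mul pG1 (PB_const _)) (PB_const _)) _).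
  apply: PB_add pU2 (PB_add pU3 (PB_add pU4 _)).
  exact: PB_add (PB_add (PB_mul PB_size (PB_const _)) (PB_const _)) (PB_const _).
move=> x y w sy [ow _]; have lN := NG x; have lK := KG x.
set g := fG x in lN lK *; set n := N x in sy lN *; set kk := K x in lK *.
set b := _ < kk.
pose sf : st := St (regs [:: 0; g; n; 0; count id y; kk; 0; 0])
  (act (fun z => inp _ x (z + (size x)%:Z)%R) (Some (inl b)) Stay) (mv Stay (fun z => w (z + n%:Z)%R)).
exists sf; split; last first.
  split=> [[|k] //|b'].
  have -> : it sf (size [:: b]) = inp (maux M) x (1 + size x)%N by [].
  by rewrite inp_nth ltnNge leq_addl.
have ly : count id y <= g.
  by apply: leq_trans (count_size _ _) _; rewrite sy.
pose W i := fun z => w (z + i%:Z)%R.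
apply: runsB_cat.
  by apply: (h1 x [:: g] [:: 0; g; n]) => // -[|[|[|r]]] //=; rewrite nth_nil.
rewrite [rcons _ _]/=.
apply: (runsB_cat (s2 := rst x [:: 0; g; n; 0; count id y] (W n))).
  pose S i := rst x [:: 0; g; n; n - i; count id (take i y)] (W i).
  apply: runsB_le (runsB_eq _ (_ : runsB _ _ (S n) (n * (2 + 1 + 3) + 1))).
  - by rewrite leq_add2r leq_mul2r lN orbT.
  - by rewrite /S subnn -sy take_size.
  have S0 : rst x [:: 0; g; n; n] w = S 0.
    rewrite /S take0; apply: st_ext => //=.
      by rewrite /regs; do 5? (case=> [|] /=; first by rewrite ?subn0); move=> r; rewrite ?nth_nil.
    by apply/funext => z; rewrite /W addr0.
  rewrite [X in runsB _ X _ _]S0; apply: runsB_loop => i li //.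
  have liy : i < size y by rewrite sy.
  have cE' : count id (take i.+1 y) = count id (take i y) + nth false y i.
    by rewrite (take_nth false) // -cats1 count_cat /= addn0.
  have wi : (W i 0%R == tt_bit M) = nth false y i.
    rewrite /W add0r ow // /tt_bit; apply/eqP/idP => [[]|->] //.
  apply: (runsB_cat (s2 := rst x [:: 0; g; n; n - i.+1; count id (take i.+1 y)] (W i))).
    apply: (@runsB_ifw _ _ _ _ 1); rewrite [wt _]/= wi cE' => hy.
      apply: runsB_eq (runsB_inc _ _ _) => //; rewrite hy addn1; apply: st_ext => //=.
      by rewrite /regs; do 5? (case=> [|] //=); move=> r; rewrite ?nth_nil.
    rewrite (negbTE hy) addn0; apply: st_ext => //=.
    by rewrite /regs; do 5? (case=> [|] //=); move=> r; rewrite ?nth_nil.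
  have -> : S i.+1 = exec_st WR (rst x [:: 0; g; n; n - i.+1; count id (take i.+1 y)] (W i)).
    by apply: st_ext => //=; apply/funext => z; rewrite /mv /W /=; congr w; lia.
  exact: runsB_instr.
apply: runsB_cat.
  have := h2 x [:: g] [:: 0; g; n; 0; count id y] (W n) erefl; rewrite /= KE; apply.
  by move=> [|[|[|[|[|r]]]]] //=; rewrite nth_nil.
apply: runsB_cat.
  have := h3 x [:: g] [:: 0; g; n; 0; count id y; kk] (W n) erefl; rewrite /=; apply.
  by move=> [|[|[|[|[|[|r]]]]]] //=; rewrite nth_nil.
apply: runsB_cat.
  have := h4 x [:: g] [:: 0; g; n; 0; count id y; kk; b : nat] (W n) erefl; rewrite /=; apply.
  move=> [|[|[|[|[|[|[|r]]]]]]] //=; rewrite ?nth_nil //; rewrite /G1 /=; try lia.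
apply: (runsB_cat (s2 := St (regs [:: 0; g; n; 0; count id y; kk; b : nat])
   (fun z => inp _ x (z + (size x)%:Z)%R) (W n))).
  pose S i : st := St (regs [:: 0; g; n; 0; count id y; kk; b : nat; size x - i])
    (fun z => inp _ x (z + i%:Z)%R) (W n).
  apply: runsB_eq (_ : runsB _ _ (S (size x)) (size x * (1 + 3) + 1)).
    by rewrite /S subnn; apply: st_ext => //=; rewrite /regs; do 8? (case=> [|] //=); move=> r; rewrite ?nth_nil.
  have -> : St (regs [:: 0; g; n; 0; count id y; kk; b : nat; size x]) (inp _ x) (W n) = S 0.
    by rewrite /S subn0 inp_at0.
  apply: runsB_loop => i li //.
  have -> : S i.+1 = exec_st InR (setr (S i) 7 (size x - i.+1)).
    apply: st_ext; rewrite /= ?inp_addS //.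
    by rewrite /regs; do 8? (case=> [|] //=); move=> r; rewrite ?nth_nil.
  exact: runsB_instr.
apply: runsB_eq (@runsB_fin 6 b _ _) => //; rewrite /sf mv0.
by apply: st_ext => //=; rewrite /regs; do 8? (case=> [|] //=); move=> r; rewrite ?nth_nil.
Qed.

Theorem main_program : exists (p1 p2 : seq instr) (U : fn), PB U /\
  forall x t y, size y = N x -> outputs_within M t (gcode x) y ->
  outputs_within (mach M p1 p2) (U x [:: fG x] + t) x [:: count id y < K x].
Proof.
have [p1 [U1 [pU1 h1]]] := prog1_code.
have [p2 [U2 [pU2 h2]]] := prog2_code.
exists p1, p2, (fun x e => U1 x e + U2 x e + 3); split.
  exact: PB_add (PB_add pU1 pU2) (PB_const 3).
move=> x t y sy oM.
have [n1 ln1 run1] := h1 x.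
have {}run1 := run1 [::] [::]; rewrite cats0 in run1.
have := mach_outputs (n1 := n1) (n2 := U2 x [:: fG x]) run1 erefl oM.
move=> H; have {}H : outputs_within (mach M p1 p2) (n1 + t + U2 x [:: fG x] + 3) x [:: count id y < K x].
  apply: H => w ow; have [s3 [[n2 ln2 run2] o3]] := h2 x y w sy ow.
  exists n2, s3; split=> //.
  by have := run2 [::] [::]; rewrite cats0.
by apply: outputs_within_le H; lia.
Qed.

End Main.

(** * Size of the instances *)

(** [sbits], [wbits] and [ebits] are exponents of powers of 2 that bound [q], [aW] and the number of
    nodes. *)
Definition sbits m := m.+1 ^ 2 + 1.
Definition wbits m := 13 * sbits m * (m + 2).
(** By [K1_pow], [m + 1] compositions bring the gap to at least 2; [m ^ a] such groups bring it to
    [2 ^ m ^ a]. *)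
Definition kcomp a m := m.+1 * m ^ a.
Definition ebits a m := 4 * kcomp a m * wbits m.

Lemma fact_le_exp n : n`! <= 2 ^ (n ^ 2).
Proof.
elim: n => // n IH; rewrite factS.
have -> : n.+1 ^ 2 = (2 * n + 1) + n ^ 2 by rewrite -!mulnn; lia.
rewrite expnD leq_mul //; apply: leq_trans (_ : 2 ^ n.+1 <= _).
  exact: ltnW (ltn_expl _ _).
by rewrite leq_pexp2l //; lia.
Qed.

Lemma q_le m : q m <= 2 ^ sbits m.
Proof.
rewrite /q /sbits expnD expn1 muln2 -addnn -addn1; apply: leq_add.
  exact: fact_le_exp.
by rewrite expn_gt0.
Qed.

Lemma exp_le_exp b c s : b <= 2 ^ s -> b ^ c <= 2 ^ (s * c).
Proof. by move=> h; rewrite expnM; case: c => // c; rewrite leq_exp2r. Qed.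

Lemma aW_le m : aW m <= 2 ^ wbits m.
Proof.
have hq := q_le m; have hs : 0 < sbits m by rewrite /sbits addn1.
set s := sbits m in hq hs *.
have h1 : NT m <= 2 ^ (s * m * 6).
  by apply: exp_le_exp => //; apply: exp_le_exp.
have h2 : NB m <= 2 ^ (s * (3 * m.+2)) by apply: exp_le_exp.
have h3 : 3 * m.+2 <= 2 ^ (3 * m.+2) by apply: ltnW; apply: ltn_expl.
have h4 : NB m * (3 * m.+2) <= 2 ^ (s * (3 * m.+2) + 3 * m.+2).
  by rewrite expnD leq_mul.
rewrite /aW /D; apply: leq_trans (leq_add h1 h4) _.
have e1 : s * m * 6 <= (wbits m).-1 by rewrite /wbits -/s; nia.
have e2 : s * (3 * m.+2) + 3 * m.+2 <= (wbits m).-1 by rewrite /wbits -/s; nia.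
have w0 : 0 < wbits m by rewrite /wbits -/s; nia.
rewrite -(prednK w0) expnS mul2n -addnn.
by apply: leq_add; rewrite leq_pexp2l.
Qed.

Lemma aW_gt1 m : 1 < aW m.
Proof.
rewrite /aW; have : 0 < NT m by rewrite /NT expn_gt0 npt_gt0.
have hB : 0 < NB m by rewrite /NB expn_gt0 q_gt0.
have : 0 < NB m * (3 * D m) by rewrite muln_gt0 hB.
by lia.
Qed.

Lemma zc_le_exp m n : zc m n <= aW m ^ n.
Proof.
elim: n => [|n IH]; first by rewrite /zc big_ord0.
have h := aW_gt1 m; rewrite /zc big_ord_recr /=.
have : zc m n + aW m ^ n <= 2 * aW m ^ n by rewrite mul2n -addnn leq_add2r.
by move/leq_trans; apply; rewrite expnS leq_mul2r h orbT.
Qed.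

Lemma NV_le_aW m : 0 < m -> NV m <= aW m.
Proof.
move=> m0; apply: leq_trans (_ : NT m <= _); last exact: leq_addr.
rewrite /NV /NT -[npt m * q m]/(npt m * q m); have P0 := npt_gt0 m.
have qP : q m <= npt m by rewrite /npt -{1}(expn1 (q m)) leq_pexp2l ?q_gt0.
apply: leq_trans (_ : npt m ^ 2 <= _); first by rewrite -mulnn leq_mul2l qP orbT.
by rewrite leq_pexp2l.
Qed.

Lemma nodes_le m k : 0 < m -> 7 <= k -> nodes m k <= aW m ^ (4 * k).
Proof.
move=> m0 k7; have W1 := aW_gt1 m; have hV := NV_le_aW m0.
set W := aW m in W1 hV *; have W0 : 0 < W by apply: ltnW.
have pw i j : i <= j -> W ^ i <= W ^ j by move=> h; rewrite leq_pexp2l.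
have hI : NV m ^ k <= W ^ k by rewrite leq_exp2r //; lia.
have hR : nR m k <= W ^ k.+1.
  have : 2 <= W ^ k by apply: leq_trans W1 _; rewrite -{1}(expn1 W) pw //; lia.
  by rewrite /nR expnS; nia.
have hZ : nM W (aZ m k) <= W ^ (2 * k + 2).
  have hz := zc_le_exp m (2 * k); rewrite -/W in hz.
  have : 1 <= W ^ (2 * k) by rewrite expn_gt0 W0.
  by rewrite /nM /aZ expnD -mulnn -/W; nia.
have hW : W + 4 <= W ^ 3 by rewrite !expnS expn0; nia.
have hp : nR m k * nM W (aZ m k) * (W + 4) <= W ^ (3 * k + 6).
  have -> : 3 * k + 6 = k.+1 + (2 * k + 2) + 3 by lia.
  by rewrite (expnD _ _ 3) (expnD _ k.+1) leq_mul // leq_mul.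
rewrite /nodes /nN -/W.
have h1 : W ^ k < W ^ (3 * k + 6) by rewrite ltn_exp2l //; lia.
apply: (@leq_trans (2 * W ^ (3 * k + 6))).
  by rewrite mul2n -addnn -addSn leq_add //; apply: leq_ltn_trans hI h1.
apply: leq_trans (_ : W * W ^ (3 * k + 6) <= _); first by rewrite leq_mul2r W1 orbT.
(* The exponent [3 * k + 7] is at most [4 * k], whence the hypothesis [7 <= k]. *)
by rewrite -expnS; apply: pw; lia.
Qed.

Lemma nodes_gt1 m k : 1 < nodes m k.
Proof.
rewrite /nodes /nN ltnS; apply: leq_trans (leq_addr _ _).
by rewrite expn_gt0 /NV muln_gt0 npt_gt0.
Qed.

Lemma K1_exp_le m k : 0 < m -> 0 < k -> K1 m ^ k <= aW m ^ (4 * k).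
Proof.
move=> m0 k0; apply: (@leq_trans (aW m ^ k)).
  by rewrite leq_exp2r // (leq_trans (K1_le m)) // NV_le_aW.
by rewrite leq_pexp2l ?aW_gt0 //; lia.
Qed.

Lemma need_le m k : 0 < m -> 0 < k ->
  (m.+1)`! + q m ^ m + q m ^ (3 * D m) + aW m ^ (2 * k) + NV m ^ k <= aW m ^ (4 * k).
Proof.
move=> m0 k0; have W1 := aW_gt1 m; have hV := NV_le_aW m0.
have hP : npt m <= NV m by rewrite /NV leq_pmulr.
have hB : q m ^ (3 * D m) <= aW m.
  by rewrite /aW; apply: leq_trans (leq_addl _ _); rewrite -/(NB m) leq_pmulr.
have hf : (m.+1)`! <= q m ^ m.
  apply: leq_trans (_ : q m <= _); first by rewrite /q.
  by rewrite -{1}(expn1 (q m)) leq_pexp2l.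
rewrite -/(npt m) in hf *; move: (npt m) (q m ^ _) (_`!) hP hB hf => p b f hP hB hf.
have hI : NV m ^ k <= aW m ^ k by rewrite leq_exp2r.
set W := aW m in W1 hV hB hI *; set V := NV m in hV hP hI *.
have W0 : 0 < W by apply: ltnW.
have h1 : W <= W ^ k by rewrite -{1}(expn1 W) leq_pexp2l.
have e4 : W ^ (4 * k) = W ^ k * W ^ k * (W ^ k * W ^ k) by rewrite -!expnD; congr (_ ^ _); lia.
have e2 : W ^ (2 * k) = W ^ k * W ^ k by rewrite -!expnD; congr (_ ^ _); lia.
rewrite e4 e2; move: (W ^ k) h1 hI => w h1 hI.
have : w * w <= w * w * 2 by rewrite leq_pmulr.
have : 2 * w <= w * w by rewrite leq_mul2r; lia.
have : w * w * 4 <= w * w * (w * w) by rewrite leq_mul2l; nia.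
by lia.
Qed.

Lemma sbits_le m : 3 <= m -> sbits m <= m ^ 3.
Proof. by rewrite /sbits !expnS !expn0 => h; nia. Qed.

Lemma wbits_le m : 26 <= m -> wbits m <= m ^ 5.
Proof.
move=> h; rewrite /wbits -[5]/(3 + 2) expnD mulnAC mulnC.
apply: leq_mul; first by apply: sbits_le; lia.
by rewrite -mulnn; nia.
Qed.

Lemma ebits_le a m : 26 <= m -> ebits a m <= m ^ (a + 8).
Proof.
move=> h; rewrite /ebits /kcomp.
have h2 : 4 * m.+1 <= m ^ 3 by rewrite !expnS expn0; nia.
rewrite [4 * _]mulnA -[a + 8]/(a + (3 + 5)) !expnD.
rewrite -[_ * m ^ a]mulnC -mulnA leq_mul2l leq_mul ?wbits_le ?orbT //.
Qed.

(** The first two terms of the binomial expansion already give [(1 + 1/(m+1)) ^ (m+1) >= 2]. *)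
Lemma K1_pow m : 2 * npt m ^ m.+1 <= K1 m ^ m.+1.
Proof.
have h : npt m * m.+2 <= K1 m * m.+1.
  rewrite /K1; have := divn_eq (npt m + m) m.+1; have := ltn_pmod (npt m + m) (ltn0Sn m).
  by move: (_ %/ _) (_ %% _) => d r; lia.
have hb n : 2 * n.+1 ^ n.+1 <= n.+2 ^ n.+1.
  rewrite -[X in _ <= X ^ _]addn1 expnDn (bigD1 ord0) //= (bigD1 (inord 1)) /=; last first.
    by apply/eqP => /(congr1 val); rewrite /= inordK.
  rewrite inordK // bin0 bin1 !exp1n !muln1 subn0 mul1n subSS subn0 -expnS addnA addnn mul2n.
  exact: leq_addr.
rewrite -(@leq_pmul2r (m.+1 ^ m.+1)) ?expn_gt0 // -expnMn.
apply: leq_trans (_ : (npt m * m.+2) ^ m.+1 <= _); last by rewrite leq_exp2r.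
by rewrite expnMn mulnAC mulnC leq_mul2l hb orbT.
Qed.

Lemma K1_gap a m : 2 ^ m ^ a * npt m ^ kcomp a m <= K1 m ^ kcomp a m.
Proof.
rewrite /kcomp !expnM -expnMn; case: (posnP (m ^ a)) => [->|h]; first by rewrite !expn0.
by rewrite leq_exp2r // K1_pow.
Qed.

(** Lowering the exponent from [m ^ a] to [m ^ a.-1] makes room for the hub, which is the successor
    on the left. *)
Lemma gap_lt a m : 0 < a -> 3 <= m ->
  2 ^ m ^ a.-1 * (npt m ^ kcomp a m).+1 < K1 m ^ kcomp a m.
Proof.
case: a => // a _ m3 /=; apply: leq_trans (K1_gap a.+1 m).
set P := npt m ^ _; have P0 : 0 < P by rewrite expn_gt0 npt_gt0.
have h : m ^ a + 2 <= m ^ a.+1.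
  have : 0 < m ^ a by rewrite expn_gt0; lia.
  by rewrite expnS; nia.
apply: (@leq_trans (2 ^ (m ^ a + 2) * P)); last by rewrite leq_mul2r leq_pexp2l ?orbT.
rewrite expnD; set x := 2 ^ m ^ a; have : 0 < x by rewrite expn_gt0.
by rewrite -[2 ^ 2]/4; nia.
Qed.

Section Ratio.
Local Open Scope ring_scope.

(** For [eps < 1], the exponent of [m] on the left is at most [(a + 8) (1 - eps)], hence at most
    [a - 1] since [a * eps >= 9]. For [eps >= 1] the left-hand side is at most 2. *)
Lemma ratio_le (R : realType) (eps : R) a m N : 9 <= a%:R * eps -> (1 < m)%N ->
  (0 < a)%N -> (1 < N <= 2 ^ m ^ (a + 8))%N ->
  2 `^ (log2 R N `^ (1 - eps)) <= (2 ^ m ^ a.-1)%:R.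
Proof.
move=> ha m1 a0 /andP[N1 N2]; have l2 : 0 < ln 2 :> R by rewrite ln_gt0 // ltr1n.
have m1R : 1 <= m%:R :> R by rewrite ler1n ltnW.
have h1 : 1 <= log2 R N.
  by rewrite /log2 ler_pdivlMr // mul1r ler_ln ?posrE ?ler_nat // ltr0n ltnW.
have h2 : log2 R N <= (m ^ (a + 8))%:R.
  rewrite /log2 ler_pdivrMr // mulr_natl -lnXn // -natrX ler_ln ?posrE ?ler_nat //.
    by rewrite ltr0n ltnW.
  by rewrite ltr0n expn_gt0.
rewrite natrX -powR_mulrn //; apply: ler_powR; first by rewrite ler1n.
have [e1|e1] := lerP (1 - eps) 0.
  apply: le_trans (_ : 1 <= _); last by rewrite ler1n expn_gt0 ltnW.
  by rewrite -[leRHS](powRr0 (log2 R N)); apply: ler_powR.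
apply: le_trans (_ : (m ^ (a + 8))%:R `^ (1 - eps) <= _).
  by apply: ge0_ler_powR => //; rewrite ?nnegrE //; [exact: ltW|exact: le_trans h1].
rewrite !natrX -!powR_mulrn // -powRrM; apply: ler_powR => //.
have e0 : 0 < eps.
  by rewrite -(pmulr_rgt0 eps (_ : 0 < a%:R)) ?ltr0n //; lra.
rewrite -subn1 natrB // natrD; nra.
Qed.

End Ratio.

(** * Logarithms and running times *)

Lemma leq_expW a b k : a <= b -> a ^ k <= b ^ k.
Proof. by case: k => // k; rewrite leq_exp2r. Qed.

(** The shift by 2 makes [lg] positive and [2 ^ lg (size x)] at least [sz x [::]]. *)
Definition lg n := up_log 2 n.+2.

Lemma lg_gt0 n : 0 < lg n.
Proof. by rewrite /lg up_log_gt0. Qed.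

Lemma le_exp_lg n : n.+2 <= 2 ^ lg n.
Proof. exact: up_logP. Qed.

Lemma lgE n : lg n = \sum_(i < n.+2) (minn (2 ^ i) n.+2 < n.+2).
Proof.
have h (i : nat) : (minn (2 ^ i) n.+2 < n.+2) = (i < lg n).
  rewrite gtn_min ltnn orbF; apply/idP/idP => h; rewrite ltnNge; apply/negP => l.
    have := leq_trans h (le_exp_lg n); rewrite ltn_exp2l // => h'.
    by move: l h'; lia.
  by have := up_log_min (isT : 1 < 2) l; rewrite -/(lg n); lia.
under eq_bigr => i _ do rewrite h.
have ln : lg n <= n.+2 by apply: up_log_min => //; apply: ltnW; apply: ltn_expl.
rewrite -(count_iota (fun i => i < lg n)) -(subnKC ln) iotaD count_cat add0n.
rewrite (eq_in_count (a2 := predT)) => [|i]; last by rewrite mem_iota.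
rewrite [X in _ + X](eq_in_count (a2 := pred0)) => [|i]; last first.
  by rewrite mem_iota => /andP[li _]; rewrite ltnNge li.
by rewrite count_predT count_pred0 size_iota addn0.
Qed.

Lemma qpoly_bound cm b C : exists k c, forall n,
  2 ^ ((cm * lg n) ^ b * C) <= c * n ^ (up_log 2 n ^ k) + c.
Proof.
pose C4 := (cm * 2) ^ b * C; exists (C4 + b), (2 ^ C4) => n.
have hn : n <= 2 ^ up_log 2 n by apply: up_logP.
(* For [n <= 2] the power of [n] may be too small, and the additive constant takes over. *)
have [u1|u2] := leqP (up_log 2 n) 1.
  apply: leq_trans (leq_addl _ _); rewrite leq_pexp2l // /C4 leq_mul2r; apply/orP; right.
  apply: leq_expW; rewrite leq_mul2l; apply/orP; right; apply: up_log_min => //.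
  have : 2 ^ up_log 2 n <= 2 ^ 1 by rewrite leq_pexp2l.
  by rewrite expn1; move: hn; rewrite -[2 ^ 2]/4; lia.
apply: leq_trans (leq_addr _ _); set u := up_log 2 n in hn u2 *.
have n2 : 1 < n by move: u2; rewrite /u; case: (n) => [|[|]] //; rewrite ?up_log0 ?up_log1.
have hl : lg n <= 2 * u.
  apply: up_log_min => //; rewrite mul2n -addnn expnD.
  have : 2 ^ 2 <= 2 ^ u by rewrite leq_pexp2l.
  by rewrite -[2 ^ 2]/4; nia.
have h1 : (cm * lg n) ^ b * C <= u ^ (C4 + b).
  apply: (@leq_trans (C4 * u ^ b)).
    rewrite /C4 mulnAC -expnMn leq_mul2r; apply/orP; right.
    by apply: leq_expW; rewrite -mulnA leq_mul2l hl orbT.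
  rewrite expnD leq_mul2r; apply/orP; right.
  by apply: leq_trans (ltnW (ltn_expl C4 (isT : 1 < 2))) _; exact: leq_expW.
apply: (@leq_trans (n ^ (u ^ (C4 + b)))); last by rewrite leq_pmull // expn_gt0.
apply: (@leq_trans (2 ^ (u ^ (C4 + b)))); first by rewrite leq_pexp2l.
by rewrite leq_exp2r // expn_gt0 ltnW.
Qed.

Lemma time_bound cu c0 n N G : n.+2 <= G -> N <= G ->
  (n + (G + 0) + 2) ^ cu + (c0 * (N * N) ^ c0 + c0) <= G ^ (2 * cu + 3 * c0 + 2).
Proof.
move=> nG NG; have G2 : 1 < G by apply: leq_trans nG.
have G0 : 0 < G by apply: ltnW.
have pw i j : i <= j -> G ^ i <= G ^ j by move=> h; rewrite leq_pexp2l.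
have h1 : (n + (G + 0) + 2) ^ cu <= G ^ (2 * cu + 3 * c0).
  apply: (@leq_trans ((G ^ 2) ^ cu)); last by rewrite -expnM pw // leq_addr.
  by apply: leq_expW; rewrite -mulnn; nia.
have h2 : c0 <= G ^ c0 by apply: ltnW; apply: ltn_expl.
have h3 : c0 * (N * N) ^ c0 <= G ^ (2 * cu + 3 * c0).
  apply: (@leq_trans (G ^ c0 * (G ^ 2) ^ c0)).
    by apply: leq_mul => //; apply: leq_expW; rewrite -mulnn leq_mul.
  by rewrite -expnM -expnD pw //; lia.
have h4 : c0 <= G ^ (2 * cu + 3 * c0) by apply: leq_trans h2 _; apply: pw; lia.
rewrite expnD; set x := G ^ (_ + _) in h1 h3 h4 *.
have : 4 <= G ^ 2 by rewrite -mulnn; nia.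
have x0 : 0 < x by rewrite expn_gt0 G0.
by nia.
Qed.

Lemma graph_codeE n (A : nat -> nat -> bool) : graph_code (fun i j : 'I_n => A i j) =
  flatten [seq [seq A i j | j <- iota 0 n] | i <- iota 0 n].
Proof.
rewrite /graph_code -!val_enum_ord -!map_comp; congr flatten; apply: eq_map => i /=.
by rewrite -map_comp enumT.
Qed.

Lemma count_set_code n (S : {set 'I_n}) : count id (set_code S) = #|S|.
Proof. by rewrite /set_code count_map enumT cardE /enum_mem size_filter. Qed.

Lemma size_set_code n (S : {set 'I_n}) : size (set_code S) = n.
Proof. by rewrite size_map size_enum_ord. Qed.

(** * Deciding a language in NP *)

Section Verifier.
Variables (V : TM) (c kk c1 : nat) (L L' : language).
Hypothesis hV : forall z, exists2 b : bool,
  outputs_within V (c * size z ^ kk + c) z [:: b] & L' z <-> b.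
Hypothesis hL : forall x, L x <->
  exists2 y : seq bool, size y <= c1 * size x ^ c1 + c1 & L' (pair_code x y).

Definition ybound (x : seq bool) := c1 * size x ^ c1 + c1.
Definition zbound (x : seq bool) := (size x).*2 + 2 + ybound x.
(** The summand [zbound x] makes the window wide enough for the whole input of the verifier. *)
Definition tbound (x : seq bool) := c * zbound x ^ kk + c + zbound x.

Lemma pair_run x y : size y <= ybound x ->
  L' (pair_code x y) <-> outputs_within V (tbound x) (pair_code x y) [:: true].
Proof.
move=> sy; have [b ob ->] := hV (pair_code x y).
have st : c * size (pair_code x y) ^ kk + c <= tbound x.
  rewrite /tbound; apply: leq_trans (leq_addr _ _); rewrite leq_add2r leq_mul2l.
  apply/orP; right; apply: leq_expW; rewrite size_pair_code.
  by rewrite leq_add2l.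
have {}ob := outputs_within_le st ob; split=> [bt|[_ ot]]; first by rewrite bt in ob.
by case: ob => _; rewrite ot => -[<-].
Qed.

(** The bounds on [m] make the indices of the tableau cells fit in [m] bits and keep the codes of
    observations below [q]. *)
Lemma Sat_language m x : nobs V <= m -> (tbound x).+1 * wd (tbound x) <= 2 ^ m ->
  Sat m (chk V (tbound x) (ybound x) x) <-> L x.
Proof.
move=> hm ht; rewrite hL; split.
  move=> [w [_ wok]]; exists (witness V (tbound x) (ybound x) w x); first exact: size_witness.
  apply/(pair_run (size_witness _ _ _ _ _))/outputs_withinP.
  by apply: witness_accepted wok ht _; rewrite /tbound leq_addl.
move=> [y sy /(pair_run sy)/outputs_withinP acc].
exists (run_code V (tbound x) x y); split=> [v|v0 v1 v2 _ _ _]; last exact: chk_run.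
apply: leq_trans (run_code_lt _ _ _ _ _) (leq_trans hm _).
rewrite /q; apply: leqW; rewrite factS; apply: leq_trans (leqnSn _) _.
by rewrite leq_pmulr // fact_gt0.
Qed.

End Verifier.

Lemma Comp_lg M : Comp M (fun x _ => lg (size x)).
Proof.
apply: (eq_Comp (f := fun x _ => \sum_(i < (size x).+2) (minn (2 ^ i) (size x).+2 < (size x).+2))).
  by move=> x _; rewrite lgE.
have h : Comp M (fun x e => minn (2 ^ nth 0 e 0) (size x).+2).
  by apply: (Comp_minexp (a := fun _ _ => 2) (b := fun _ e => nth 0 e 0)); comp.
by apply: (Comp_sum (F := fun x _ i => minn (2 ^ i) (size x).+2 < (size x).+2)); comp.
Qed.

Lemma PB_lg f : PB f -> exists cf, forall x, f x [::] <= 2 ^ (cf * lg (size x)).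
Proof.
move=> [cf h]; exists cf => x; apply: leq_trans (h x [::]) _.
rewrite mulnC expnM; apply: leq_expW; rewrite /sz addn0 addn2; exact: le_exp_lg.
Qed.

Section Instance.
Variables (M V : TM) (c kk c1 cm a : nat).
Hypothesis cm_ge : 26 <= cm.

Let fY := ybound c1.
Let fT := tbound c kk c1.
Let fm (x : seq bool) := cm * lg (size x).
Let fk x := kcomp a (fm x).
Let fE x := ebits a (fm x).
Let fG x := 2 ^ fE x.
Let N x := nodes (fm x) (fk x).
Let K x := K1 (fm x) ^ fk x.
Let A x i j := adj (aW (fm x)) (aZ (fm x) (fk x)) (NV (fm x) ^ fk x)
  (gact (fm x) (fk x) (chkx V fT fY x)) (gmem (fm x) (fk x)) (plab (fm x) (fk x)) i j.

Lemma fm_ge x : 26 <= fm x.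
Proof. by apply: leq_trans cm_ge _; rewrite /fm leq_pmulr // lg_gt0. Qed.

Lemma fk_ge x : 7 <= fk x.
Proof.
have h := fm_ge x; rewrite /fk /kcomp; have : 0 < fm x ^ a by rewrite expn_gt0; lia.
by nia.
Qed.

Lemma aW_G x : aW (fm x) ^ (4 * fk x) <= fG x.
Proof.
rewrite /fG /fE /ebits -/(fk x) [X in 2 ^ X]mulnC; exact: exp_le_exp (aW_le _).
Qed.

Lemma Comp_fY : Comp M (fun x _ => fY x).
Proof. by rewrite /fY /ybound; comp. Qed.

Lemma Comp_fT : Comp M (fun x _ => fT x).
Proof.
have h := Comp_fY; have hz : Comp M (fun x _ => zbound c1 x).
  apply: (eq_Comp (f := fun x _ => 2 * size x + 2 + ybound c1 x)); last by comp.
  by move=> x _; rewrite /zbound mul2n.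
by rewrite /fT /tbound; comp.
Qed.

Lemma Comp_fm : Comp M (fun x _ => fm x).
Proof. by have h := Comp_lg M; rewrite /fm; comp. Qed.

Lemma Comp_fk : Comp M (fun x _ => fk x).
Proof. by have h := Comp_fm; rewrite /fk /kcomp; comp. Qed.

Lemma Comp_fE : Comp M (fun x _ => fE x).
Proof. by have h := Comp_fm; have h' := Comp_fk; rewrite /fE /ebits /wbits /sbits; comp. Qed.

Let P i (x : seq bool) (e : seq nat) := nth 0 e i = fG x.

Lemma big i : Big M fm fk (P i).
Proof.
exists (fun _ e => nth 0 e i); first exact: PComp_var.
move=> x e ->; apply: leq_trans (aW_G x); apply: need_le.
  by apply: leq_trans (fm_ge x).
by apply: leq_trans (fk_ge x).
Qed.

Lemma N_le x : N x <= fG x.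
Proof.
apply: leq_trans (aW_G x); apply: nodes_le; last exact: fk_ge.
by apply: leq_trans (fm_ge x).
Qed.

Lemma K_le x : K x <= fG x.
Proof.
apply: leq_trans (aW_G x); apply: K1_exp_le.
  by apply: leq_trans (fm_ge x).
by apply: leq_trans (fk_ge x).
Qed.

Lemma size_le x : (size x).+2 <= fG x.
Proof.
apply: leq_trans (le_exp_lg _) _; rewrite leq_pexp2l // /fE /ebits /kcomp /wbits.
have h := fm_ge x; have h1 : lg (size x) <= fm x by rewrite leq_pmull //; lia.
have p0 : 0 < fm x ^ a by rewrite expn_gt0; lia.
have s0 : 0 < sbits (fm x) by rewrite /sbits addn1.
apply: leq_trans h1 _; move: (fm x ^ a) (sbits _) p0 s0 h => p s p0 s0 h.
apply: (@leq_trans (4 * ((fm x).+1 * p))).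
  by rewrite mulnA (leq_trans _ (leq_pmulr _ p0)) //; lia.
by rewrite leq_pmulr // !muln_gt0 s0 addn2.
Qed.

Lemma program : exists (p1 p2 : seq instr) (C : nat),
  forall x c0 y, size y = N x ->
  outputs_within M (c0 * size (gcode N A x) ^ c0 + c0) (gcode N A x) y ->
  outputs_within (mach M p1 p2) (2 ^ (fm x ^ (a + 8) * (C + 3 * c0))) x [:: count id y < K x].
Proof.
have [fN cN hN] := PComp_nodes Comp_fm Comp_fk (big 0).
(* The environment of this program is [[:: i; j; fG x]], so the promise concerns variable 2. *)
have [fA cA hA] := PComp_adj V Comp_fT Comp_fY Comp_fm Comp_fk (big 2) (PComp_var M _ 0) (PComp_var M _ 1).
have [fK cK hK] : PComp M (P 0) (fun x _ => K x).
  have hm := PComp_m Comp_fm (P 0); have hk := PComp_k Comp_fk (P 0).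
  have hP := PComp_npt Comp_fm (big 0); rewrite /K /K1; apply: (PComp_exp _ hk (PComp_var M _ 0)).
    by pc.
  by move=> x e ->; apply: K_le.
have [p1 [p2 [U [[cu hu] h]]]] := @main_program M fG fE fN fA fK N K A Comp_fE cN cA cK
  (fun=> erefl) (fun x => hN x [:: fG x] erefl) (fun x => hK x [:: fG x] erefl)
  (fun x i j _ _ => hA x [:: i; j; fG x] erefl) N_le K_le.
exists p1, p2, (2 * cu + 2) => x c0 y sy oM; have := h x _ y sy oM.
apply: outputs_within_le.
apply: (@leq_trans ((size x + (fG x + 0) + 2) ^ cu + (c0 * (N x * N x) ^ c0 + c0))).
  by rewrite size_gcode leq_add2r; apply: hu.
apply: leq_trans (time_bound cu c0 (size_le x) (N_le x)) _.
rewrite /fG -expnM leq_pexp2l //; apply: leq_mul; last by lia.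
exact: ebits_le (fm_ge x).
Qed.

End Instance.

Section Main.
Local Open Scope ring_scope.
Variables (R : realType) (eps : R).

Lemma approximation_decides (M : TM) (c0 : nat) (L : language) : 0 < eps ->
  (forall (n : nat) (e : rel 'I_n), simple_graph e -> exists S : {set 'I_n},
    [/\ outputs_within M (c0 * size (graph_code e) ^ c0 + c0)%N (graph_code e) (set_code S),
        power_dominates e S
      & #|S|%:R <= 2 `^ (log2 R n `^ (1 - eps)) * (pds_opt e)%:R]) ->
  NP L -> QPTIME L.
Proof.
move=> eps0 hM [L' [kk [V [c hV]]] [c1 hL]].
have [cf hcf] : exists cf, forall x : seq bool,
    ((tbound c kk c1 x).+1 * wd (tbound c kk c1 x) <= 2 ^ (cf * lg (size x)))%N.
  have hT := Comp_fT M c kk c1.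
  have [|cf hcf] := @PB_lg (fun x _ => (tbound c kk c1 x).+1 * (2 * (tbound c kk c1 x).+1).+1)%N.
    by apply: (@Comp_PB M); comp.
  by exists cf => x; rewrite /wd -mul2n.
(* 9 is the 8 in the exponent [a + 8] that bounds the size, plus the 1 given up in [gap_lt]. *)
pose a := Num.bound (9 / eps).
have ha : 9 <= a%:R * eps.
  rewrite -ler_pdivrMr //; apply: ltW.
  by have := archi_boundP (_ : 0 <= 9 / eps); rewrite divr_ge0 //; [apply|apply: ltW].
have a0 : (0 < a)%N.
  by rewrite lt0n; apply/eqP => e; move: ha; rewrite e mul0r; lra.
(* 26 is required by [ebits_le], [nobs V] puts the codes of observations below [q], and [cf] makes
   the tableau fit in [2 ^ m] variables. *)
pose cm := (26 + nobs V + cf)%N.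
have cm26 : (26 <= cm)%N by rewrite /cm -addnA leq_addr.
have [p1 [p2 [C hp]]] := program M V c kk c1 a cm26.
have [k [c2 hk]] := qpoly_bound cm (a + 8) (C + 3 * c0).
exists k, (mach M p1 p2), c2 => x; set n := size x.
pose m := (cm * lg n)%N; pose kc := kcomp a m.
have m26 : (26 <= m)%N := fm_ge cm26 x.
pose ch := chkx V (tbound c kk c1) (ybound c1) x.
have SL : Sat m ch <-> L x.
  apply: (Sat_language hV hL).
    by apply: leq_trans (leq_pmulr _ (lg_gt0 n)); rewrite /cm -addnA addnCA leq_addr.
  by apply: leq_trans (hcf x) _; rewrite leq_pexp2l // leq_mul2r /cm leq_addl orbT.
have k0 : (0 < kc)%N := leq_trans (isT : (0 < 7)%N) (fk_ge a cm26 x).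
have [S [oM dS rS]] := hM _ (Gr ch) (Gr_simple m kc ch).
(* If [Sat] holds, the optimum is at most [npt ^ k + 1], and [gap_lt] puts the answer below the
   threshold; otherwise no power dominating set is that small. *)
exists (#|S| < K1 m ^ kc)%N; last first.
  rewrite -SL; split=> [sat|lt]; last first.
    by apply: contrapT => nsat; move: lt; rewrite ltnNge (reduction_no k0 nsat dS).
  apply: leq_ltn_trans (gap_lt a0 (leq_trans (isT : (3 <= 26)%N) m26)).
  rewrite -(ler_nat R) natrM; apply: le_trans rS _; apply: ler_pM => //.
  - exact: powR_ge0.
  - apply: ratio_le => //; first by apply: leq_trans m26.
    rewrite nodes_gt1 /=; apply: leq_trans (N_le a cm26 x) _.
    by rewrite leq_pexp2l // ebits_le.
  - by rewrite ler_nat reduction_yes.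
rewrite -count_set_code; apply: outputs_within_le (hk n) (hp x c0 _ (size_set_code _) _).
by rewrite graph_codeE in oM.
Qed.

End Main.

Local Open Scope ring_scope.

Theorem theorem2 (R : realType) (eps : R) :
  0 < eps ->
  ~ (forall L : language, NP L -> QPTIME L) ->
  ~ pds_approximable (fun n : nat => 2 `^ (log2 R n `^ (1 - eps))).
Proof.
move=> eps0 sep [M [c0 hM]]; apply: sep => L.
exact: approximation_decides eps0 hM.
Qed.
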